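(* There is an isomorphism of graded operads $\mathcal{LL}\cong\mathcal{L}ie\otimes\mathcal D$, where $(\mathcal{L}ie\otimes\mathcal D)(n)=\mathcal{L}ie(n)\otimes\mathcal D(n)$.
   Context: Fix a field $\mathbb K$ of characteristic zero; graded objects follow the Koszul sign rule. $\mathcal{L}ie$ is the operad generated by $(1,2)=-(2,1)$ (degree $0$) with the Jacobi identity. $\mathcal{LL}$ is the binary quadratic operad generated by a degree $0$ operation $(1,2)=-(2,1)$ and by a degree $+1$ operation $[1,2]$ with its transposition $[2,1]$ (no symmetry), with relations generated under $S_3$ by $[1,[2,3]]+[[1,2],3]+[2,[1,3]]=0$; $[1,(2,3)]-([1,2],3)-(2,[1,3])=0$; $[(1,2),3]-([1,2],3)+([2,1],3)=0$; $(1,(2,3))-((1,2),3)-(2,(1,3))=0$ (operadic composites, e.g. $[(1,2),3]=[1,2]\circ_1(1,2)$, $[1,(2,3)]=[1,2]\circ_2(1,2)$). $\mathcal O=\mathcal T(d,1\otimes1)/(R_{\mathcal O})$ is the quotient of the free operad on a unary operation $d$ of degree $+1$ and a binary commutative operation $1\otimes1$ of degree $0$ by the ideal generated by: $dd=0$; $d(1\otimes1)-d\otimes1-1\otimes d=0$ (where $d\otimes 1=(1\otimes1)\circ_1d$, $1\otimes d=(1\otimes1)\circ_2d$); and associativity $(1\otimes1)\otimes1-1\otimes(1\otimes1)=0$. It is graded by the number of $d$'s, $\mathcal O=(\mathcal O^i)$. The deriving operad $\mathcal D$ is the suboperad of $\mathcal O$ with $\mathcal D(n)=\mathcal O^0(n)\oplus\cdots\oplus\mathcal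 O^{n-1}(n)$ for each $n$. *)

(* Defs.v *)
From HB Require Import structures.
From mathcomp Require Import all_boot all_order all_algebra all_fingroup.
From mathcomp Require Import boolp.

Set Implicit Arguments.
Unset Strict Implicit.
Unset Printing Implicit Defensive.

Import Order.TTheory GRing.Theory Num.Theory.
Local Open Scope ring_scope.

Record lin_congr (K : fieldType) (T : Type) (z : T) (add : T -> T -> T)
    (scale : K -> T -> T) (E : T -> T -> Prop) : Prop := LinCongr {
  lc_refl : forall x, E x x;
  lc_sym : forall x y, E x y -> E y x;
  lc_trans : forall x y w, E x y -> E y w -> E x w;
  lc_add : forall x x' y y', E x x' -> E y y' -> E (add x y) (add x' y');
  lc_scale : forall a x x', E x x' -> E (scale a x) (scale a x');
  lc_addA : forall x y w, E (add x (add y w)) (add (add x y) w);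
  lc_addC : forall x y, E (add x y) (add y x);
  lc_add0 : forall x, E (add z x) x;
  lc_addN : forall x, E (add (scale (-1) x) x) z;
  lc_scaleA : forall a b x, E (scale a (scale b x)) (scale (a * b) x);
  lc_scale1 : forall x, E (scale 1 x) x;
  lc_scaleDr : forall a x y, E (scale a (add x y)) (add (scale a x) (scale a y));
  lc_scaleDl : forall a b x, E (scale (a + b) x) (add (scale a x) (scale b x)) }.

Record lsetoid (K : fieldType) := LSetoid {
  ls_sort :> Type;
  ls_zero : ls_sort;
  ls_add : ls_sort -> ls_sort -> ls_sort;
  ls_scale : K -> ls_sort -> ls_sort;
  ls_eq : ls_sort -> ls_sort -> Prop;
  ls_ok : lin_congr ls_zero ls_add ls_scale ls_eq }.

Section LinearQuotient.
Variables (K : fieldType) (S : lsetoid K).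
Local Notation E := (@ls_eq K S).

Definition ls_rel : rel {classic S} := fun x y => `[< E x y >].

Lemma ls_rel_refl : reflexive ls_rel.
Proof. by move=> x; apply/asboolP; apply: lc_refl (ls_ok S) _. Qed.
Lemma ls_rel_sym : symmetric ls_rel.
Proof.
by move=> x y; apply/asboolP/asboolP; apply: lc_sym (ls_ok S) _ _.
Qed.
Lemma ls_rel_trans : transitive ls_rel.
Proof.
move=> y x w /asboolP xy /asboolP yw; apply/asboolP.
exact: lc_trans (ls_ok S) _ _ _ xy yw.
Qed.
Canonical ls_equiv := EquivRel ls_rel ls_rel_refl ls_rel_sym ls_rel_trans.

Definition lquot : Type := {eq_quot ls_equiv}%qT.
HB.instance Definition _ := Choice.copy lquot {eq_quot ls_equiv}%qT.

Definition lcl (x : S) : lquot := (\pi_({eq_quot ls_equiv}) x)%qT.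
Definition lrepr (u : lquot) : S := generic_quotient.repr (u : {eq_quot ls_equiv}%qT).

Lemma lclE (x y : S) : lcl x = lcl y <-> E x y.
Proof.
by split=> [/eqmodP/asboolP//|xy]; apply/eqmodP/asboolP.
Qed.
Lemma lreprK u : lcl (lrepr u) = u.
Proof. exact: reprK. Qed.
Lemma lrepr_cl x : E (lrepr (lcl x)) x.
Proof. by apply/lclE; rewrite lreprK. Qed.

Definition lq_add (u v : lquot) := lcl (ls_add (lrepr u) (lrepr v)).
Definition lq_scale (a : K) (u : lquot) := lcl (ls_scale a (lrepr u)).

Lemma lcl_add x y : lcl (ls_add x y) = lq_add (lcl x) (lcl y).
Proof.
apply/lclE/(lc_sym (ls_ok S)); apply: (lc_add (ls_ok S)); exact: lrepr_cl.
Qed.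
Lemma lcl_scale a x : lcl (ls_scale a x) = lq_scale a (lcl x).
Proof.
apply/lclE/(lc_sym (ls_ok S)); apply: (lc_scale (ls_ok S)); exact: lrepr_cl.
Qed.

Lemma lq_addA : associative lq_add.
Proof.
move=> u v w; rewrite -[u]lreprK -[v]lreprK -[w]lreprK -!lcl_add.
by apply/lclE; apply: lc_addA (ls_ok S) _ _ _.
Qed.
Lemma lq_addC : commutative lq_add.
Proof.
move=> u v; rewrite -[u]lreprK -[v]lreprK -!lcl_add.
by apply/lclE; apply: lc_addC (ls_ok S) _ _.
Qed.
Lemma lq_add0 : left_id (lcl (ls_zero S)) lq_add.
Proof.
move=> u; rewrite -[u]lreprK -!lcl_add.
by apply/lclE; apply: lc_add0 (ls_ok S) _.
Qed.
Lemma lq_addN : left_inverse (lcl (ls_zero S)) (lq_scale (-1)) lq_add.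
Proof.
move=> u; rewrite -[u]lreprK -lcl_scale -lcl_add.
by apply/lclE; apply: lc_addN (ls_ok S) _.
Qed.
HB.instance Definition _ := GRing.isZmodule.Build lquot
  lq_addA lq_addC lq_add0 lq_addN.

Lemma lq_scaleA a b u : lq_scale a (lq_scale b u) = lq_scale (a * b) u.
Proof.
rewrite -[u]lreprK -!lcl_scale.
by apply/lclE; apply: lc_scaleA (ls_ok S) _ _ _.
Qed.
Lemma lq_scale1 : left_id 1 lq_scale.
Proof.
move=> u; rewrite -[u]lreprK -!lcl_scale.
by apply/lclE; apply: lc_scale1 (ls_ok S) _.
Qed.
Lemma lq_scaleDr : right_distributive lq_scale +%R.
Proof.
move=> a u v; rewrite -[u]lreprK -[v]lreprK -[_ + _]lcl_add -!lcl_scale.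
rewrite -[RHS]lcl_add.
by apply/lclE; apply: lc_scaleDr (ls_ok S) _ _ _.
Qed.
Lemma lq_scaleDl v : {morph lq_scale^~ v : a b / a + b}.
Proof.
move=> a b; rewrite -[v]lreprK -!lcl_scale -[RHS]lcl_add.
by apply/lclE; apply: lc_scaleDl (ls_ok S) _ _ _.
Qed.
HB.instance Definition _ := GRing.Zmodule_isLmodule.Build K lquot
  lq_scaleA lq_scale1 lq_scaleDr lq_scaleDl.

Lemma lclD x y : lcl (ls_add x y) = lcl x + lcl y.
Proof. exact: lcl_add. Qed.
Lemma lclZ a x : lcl (ls_scale a x) = a *: lcl x.
Proof. exact: lcl_scale. Qed.

End LinearQuotient.

Definition koszul (K : fieldType) (p q : int) : K := (-1) ^+ (`|p| * `|q|)%N.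

(* Inputs are numbered from 0.  In f \o_i g, with g of arity n plugged into
   input i of f, input j != i of f becomes input [outer i n j], and input k
   of g becomes input i + k. *)
Definition outer (i n j : nat) : nat := (if (j < i) then j else (j + n).-1)%N.

(* Partial compositions take the arity and the degree of the result together
   with a proof that they have the right value, so that no transport is
   needed to compare two composites.  [act s x] is the right action x.s for
   the product s * t (first s, then t) of permutations: input j of x becomes
   input s j.  The laws are stated up to a relation [E] so that they serve
   both for operads (E is equality) and for the congruence defining the free
   operad. *)
Record operad_laws (K : fieldType) (T : nat -> int -> Type)
    (add : forall n p, T n p -> T n p -> T n p)
    (scale : forall n p, K -> T n p -> T n p)
    (act : forall n p, 'S_n -> T n p -> T n p)
    (id1 : T 1%N 0)
    (comp : forall m n l (p q r : int), l = (m + n).-1%N -> r = p + q -> 'I_m ->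
       T m p -> T n q -> T l r)
    (E : forall n p, T n p -> T n p -> Prop) : Prop := OperadLaws {
  ol_actD : forall n p (s : 'S_n) (x y : T n p),
    E n p (act n p s (add n p x y)) (add n p (act n p s x) (act n p s y));
  ol_actZ : forall n p (s : 'S_n) a (x : T n p),
    E n p (act n p s (scale n p a x)) (scale n p a (act n p s x));
  ol_compDl : forall m n l (p q r : int) (hl : l = (m + n).-1%N) (hr : r = p + q) i x x' y,
    E l r (comp m n l p q r hl hr i (add m p x x') y)
      (add l r (comp m n l p q r hl hr i x y) (comp m n l p q r hl hr i x' y));
  ol_compZl : forall m n l (p q r : int) (hl : l = (m + n).-1%N) (hr : r = p + q) i a x y,
    E l r (comp m n l p q r hl hr i (scale m p a x) y)
      (scale l r a (comp m n l p q r hl hr i x y));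
  ol_compDr : forall m n l (p q r : int) (hl : l = (m + n).-1%N) (hr : r = p + q) i x y y',
    E l r (comp m n l p q r hl hr i x (add n q y y'))
      (add l r (comp m n l p q r hl hr i x y) (comp m n l p q r hl hr i x y'));
  ol_compZr : forall m n l (p q r : int) (hl : l = (m + n).-1%N) (hr : r = p + q) i a x y,
    E l r (comp m n l p q r hl hr i x (scale n q a y))
      (scale l r a (comp m n l p q r hl hr i x y));
  ol_act1 : forall n p (x : T n p), E n p (act n p 1%g x) x;
  ol_actM : forall n p (s t : 'S_n) (x : T n p),
    E n p (act n p (s * t)%g x) (act n p t (act n p s x));
  ol_id_comp : forall n p (hl : n = (1 + n).-1%N) (hr : p = 0 + p) i (x : T n p),
    E n p (comp 1%N n n 0 p p hl hr i id1 x) x;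
  ol_comp_id : forall n p (hl : n = (n + 1).-1%N) (hr : p = p + 0) i (x : T n p),
    E n p (comp n 1%N n p 0 p hl hr i x id1) x;
  ol_seq : forall a b c ab bc abc (p q r pq qr pqr : int)
      (h1 : bc = (b + c).-1%N) (d1 : qr = q + r)
      (h2 : abc = (a + bc).-1%N) (d2 : pqr = p + qr)
      (h3 : ab = (a + b).-1%N) (d3 : pq = p + q)
      (h4 : abc = (ab + c).-1%N) (d4 : pqr = pq + r)
      (i : 'I_a) (j : 'I_b) (k : 'I_ab) x y z,
    k = (i + j)%N :> nat ->
    E abc pqr
      (comp a bc abc p qr pqr h2 d2 i x (comp b c bc q r qr h1 d1 j y z))
      (comp ab c abc pq r pqr h4 d4 k (comp a b ab p q pq h3 d3 i x y) z);
  ol_par : forall a b c ab ac abc (p q r pq pr pqr : int)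
      (h1 : ab = (a + b).-1%N) (d1 : pq = p + q)
      (h2 : abc = (ab + c).-1%N) (d2 : pqr = pq + r)
      (h3 : ac = (a + c).-1%N) (d3 : pr = p + r)
      (h4 : abc = (ac + b).-1%N) (d4 : pqr = pr + q)
      (i k : 'I_a) (k' : 'I_ab) (i' : 'I_ac) x y z,
    (i < k)%N -> k' = (k + b).-1%N :> nat -> i' = i :> nat ->
    E abc pqr
      (comp ab c abc pq r pqr h2 d2 k' (comp a b ab p q pq h1 d1 i x y) z)
      (scale abc pqr (koszul K q r)
        (comp ac b abc pr q pqr h4 d4 i' (comp a c ac p r pr h3 d3 k x z) y));
  ol_equiv : forall m n l (p q r : int) (hl : l = (m + n).-1%N) (hr : r = p + q)
      (i : 'I_m) (s : 'S_m) (t : 'S_n) (u : 'S_l) x y,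
    (forall (j : 'I_m) (v : 'I_l), j != i -> v = outer i n j :> nat ->
       u v = outer (s i) n (s j) :> nat) ->
    (forall (k : 'I_n) (v : 'I_l), v = (i + k)%N :> nat ->
       u v = (s i + t k)%N :> nat) ->
    E l r (comp m n l p q r hl hr (s i) (act m p s x) (act n q t y))
      (act l r u (comp m n l p q r hl hr i x y)) }.

(* P n p is the component of arity n and degree p; only homogeneous elements
   are represented. *)
Record operad (K : fieldType) := Operad {
  op_car :> nat -> int -> lmodType K;
  op_act : forall n p, 'S_n -> op_car n p -> op_car n p;
  op_id : op_car 1%N 0;
  op_comp : forall m n l (p q r : int), l = (m + n).-1%N -> r = p + q -> 'I_m ->
    op_car m p -> op_car n q -> op_car l r;
  op_ok : operad_laws (fun n p => @GRing.add (op_car n p))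
    (fun n p => @GRing.scale K (op_car n p)) op_act op_id op_comp
    (fun n p => @eq (op_car n p)) }.

Section OperadTheory.
Variables (K : fieldType) (P : operad K).
Let L := op_ok P.

Lemma op_actB n p (s : 'S_n) (x y : P n p) :
  op_act s (x - y) = op_act s x - op_act s y.
Proof. by rewrite (ol_actD L) -scaleN1r (ol_actZ L) scaleN1r. Qed.
Lemma op_compBl m n l (p q r : int) (hl : l = (m + n).-1%N) (hr : r = p + q) i
    (x x' : P m p) (y : P n q) :
  op_comp hl hr i (x - x') y = op_comp hl hr i x y - op_comp hl hr i x' y.
Proof. by rewrite (ol_compDl L) -scaleN1r (ol_compZl L) scaleN1r. Qed.
Lemma op_compBr m n l (p q r : int) (hl : l = (m + n).-1%N) (hr : r = p + q) i
    (x : P m p) (y y' : P n q) :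
  op_comp hl hr i x (y - y') = op_comp hl hr i x y - op_comp hl hr i x y'.
Proof. by rewrite (ol_compDr L) -scaleN1r (ol_compZr L) scaleN1r. Qed.
Lemma op_act0 n p (s : 'S_n) : op_act s (0 : P n p) = 0.
Proof. by rewrite -(subrr 0) op_actB !subrr. Qed.
Lemma op_comp0l m n l (p q r : int) (hl : l = (m + n).-1%N) (hr : r = p + q) i
    (y : P n q) : op_comp hl hr i (0 : P m p) y = 0.
Proof. by rewrite -(subrr 0) op_compBl !subrr. Qed.
Lemma op_comp0r m n l (p q r : int) (hl : l = (m + n).-1%N) (hr : r = p + q) i
    (x : P m p) : op_comp hl hr i x (0 : P n q) = 0.
Proof. by rewrite -(subrr 0) op_compBr !subrr. Qed.
End OperadTheory.

Record is_operad_iso (K : fieldType) (P Q : operad K)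
    (f : forall n p, P n p -> Q n p) : Prop := IsOperadIso {
  oi_linear : forall n p, linear (f n p);
  oi_bij : forall n p, bijective (f n p);
  oi_id : f 1%N 0 (op_id P) = op_id Q;
  oi_act : forall n p s (x : P n p), f n p (op_act s x) = op_act s (f n p x);
  oi_comp : forall m n l (p q r : int) (hl : l = (m + n).-1%N) (hr : r = p + q)
      i (x : P m p) (y : P n q),
    f l r (op_comp hl hr i x y) = op_comp hl hr i (f m p x) (f n q y) }.

Record signature := Signature {
  gen :> Type;
  gen_ar : gen -> nat;
  gen_deg : gen -> int }.

Section FreeOperad.
Variables (K : fieldType) (X : signature).

Inductive term : nat -> int -> Type :=
| tgen (g : X) : term (gen_ar g) (gen_deg g)
| tzero n p : term n p
| tadd n p : term n p -> term n p -> term n p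
| tscale n p : K -> term n p -> term n p
| tact n p : 'S_n -> term n p -> term n p
| tid : term 1 0
| tcomp m n l (p q r : int) : l = (m + n).-1%N -> r = p + q -> 'I_m ->
    term m p -> term n q -> term l r.

Record operad_congr (E : forall n p, term n p -> term n p -> Prop) : Prop :=
  OperadCongr {
  oc_lin : forall n p, lin_congr (tzero n p) (@tadd n p) (@tscale n p) (@E n p);
  oc_act : forall n p s (x x' : term n p),
    E n p x x' -> E n p (tact s x) (tact s x');
  oc_comp : forall m n l (p q r : int) (hl : l = (m + n).-1%N) (hr : r = p + q) i
      (x x' : term m p) (y y' : term n q),
    E m p x x' -> E n q y y' ->
    E l r (tcomp hl hr i x y) (tcomp hl hr i x' y');
  oc_laws : operad_laws tadd tscale tact tid tcomp E }.

(* The least congruence for which terms form an operad. *)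
Definition teq n p (t u : term n p) : Prop :=
  forall E, operad_congr E -> E n p t u.

Lemma teq_lin n p :
  lin_congr (tzero n p) (@tadd n p) (@tscale n p) (@teq n p).
Proof.
split.
- by move=> x E H; apply: lc_refl (oc_lin H n p) _.
- by move=> x y xy E H; apply: lc_sym (oc_lin H n p) _ _ (xy E H).
- move=> x y w xy yw E H.
  exact: lc_trans (oc_lin H n p) _ _ _ (xy E H) (yw E H).
- move=> x x' y y' xx yy E H.
  exact: lc_add (oc_lin H n p) _ _ _ _ (xx E H) (yy E H).
- by move=> a x x' xx E H; apply: lc_scale (oc_lin H n p) _ _ _ (xx E H).
- by move=> x y w E H; apply: lc_addA (oc_lin H n p) _ _ _.
- by move=> x y E H; apply: lc_addC (oc_lin H n p) _ _.
- by move=> x E H; apply: lc_add0 (oc_lin H n p) _.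
- by move=> x E H; apply: lc_addN (oc_lin H n p) _.
- by move=> a b x E H; apply: lc_scaleA (oc_lin H n p) _ _ _.
- by move=> x E H; apply: lc_scale1 (oc_lin H n p) _.
- by move=> a x y E H; apply: lc_scaleDr (oc_lin H n p) _ _ _.
- by move=> a b x E H; apply: lc_scaleDl (oc_lin H n p) _ _ _.
Qed.

Lemma teq_congr : operad_congr teq.
Proof.
split; first exact: teq_lin.
- by move=> n p s x x' xx E H; apply: oc_act (H) _ _ _ _ _ (xx E H).
- move=> m n l p q r hl hr i x x' y y' xx yy E H.
  exact: oc_comp H _ _ _ _ _ _ _ _ _ _ _ _ _ (xx E H) (yy E H).
split.
- by move=> > [_ _ _ H]; apply: (ol_actD H).
- by move=> > [_ _ _ H]; apply: (ol_actZ H).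
- by move=> > [_ _ _ H]; apply: (ol_compDl H).
- by move=> > [_ _ _ H]; apply: (ol_compZl H).
- by move=> > [_ _ _ H]; apply: (ol_compDr H).
- by move=> > [_ _ _ H]; apply: (ol_compZr H).
- by move=> > [_ _ _ H]; apply: (ol_act1 H).
- by move=> > [_ _ _ H]; apply: (ol_actM H).
- by move=> > [_ _ _ H]; apply: (ol_id_comp H).
- by move=> > [_ _ _ H]; apply: (ol_comp_id H).
- by move=> > hk E [_ _ _ H]; apply: (ol_seq H).
- by move=> > h1 h2 h3 E [_ _ _ H]; apply: (ol_par H).
- by move=> > h1 h2 E [_ _ _ H]; apply: (ol_equiv H).
Qed.

Definition term_lsetoid n p : lsetoid K := LSetoid (teq_lin n p).
Definition free_car n p : lmodType K := lquot (term_lsetoid n p).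

Definition tcl n p (t : term n p) : free_car n p := @lcl K (term_lsetoid n p) t.
Definition trepr n p (u : free_car n p) : term n p := lrepr u.

Definition free_act n p (s : 'S_n) (u : free_car n p) : free_car n p :=
  tcl (tact s (trepr u)).
Definition free_comp m n l (p q r : int) (hl : l = (m + n).-1%N) (hr : r = p + q)
    (i : 'I_m) (u : free_car m p) (v : free_car n q) : free_car l r :=
  tcl (tcomp hl hr i (trepr u) (trepr v)).

Lemma tclE n p (t u : term n p) : tcl t = tcl u <-> teq t u.
Proof. exact: (@lclE K (term_lsetoid n p)). Qed.
Lemma treprK n p (u : free_car n p) : tcl (trepr u) = u.
Proof. exact: lreprK. Qed.
Lemma trepr_cl n p (t : term n p) : teq (trepr (tcl t)) t.
Proof. exact: (@lrepr_cl K (term_lsetoid n p)). Qed.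
Lemma tclD n p (t u : term n p) : tcl (tadd t u) = tcl t + tcl u.
Proof. exact: (@lclD K (term_lsetoid n p)). Qed.
Lemma tclZ n p a (t : term n p) : tcl (tscale a t) = a *: tcl t.
Proof. exact: (@lclZ K (term_lsetoid n p)). Qed.
Lemma tcl_act n p (s : 'S_n) (t : term n p) :
  tcl (tact s t) = free_act s (tcl t).
Proof.
by rewrite /free_act; apply/esym/tclE; apply: (oc_act teq_congr); apply: trepr_cl.
Qed.
Lemma tcl_comp m n l (p q r : int) (hl : l = (m + n).-1%N) (hr : r = p + q) i
    (t : term m p) (u : term n q) :
  tcl (tcomp hl hr i t u) = free_comp hl hr i (tcl t) (tcl u).
Proof.
by rewrite /free_comp; apply/esym/tclE; apply: (oc_comp teq_congr); apply: trepr_cl.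
Qed.

Definition tclX := (tclD, tclZ, tcl_act, tcl_comp).

Lemma free_ok : operad_laws (fun n p => @GRing.add (free_car n p))
  (fun n p => @GRing.scale K (free_car n p)) free_act (tcl tid) free_comp
  (fun n p => @eq (free_car n p)).
Proof.
have H := oc_laws teq_congr; split.
- move=> n p s x y; rewrite -(treprK x) -(treprK y) -!tclX.
  by apply/tclE; apply: (ol_actD H).
- move=> n p s a x; rewrite -(treprK x) -!tclX.
  by apply/tclE; apply: (ol_actZ H).
- move=> m n l p q r hl hr i x x' y.
  rewrite -(treprK x) -(treprK x') -(treprK y) -!tclX.
  by apply/tclE; apply: (ol_compDl H).
- move=> m n l p q r hl hr i a x y.
  rewrite -(treprK x) -(treprK y) -!tclX.
  by apply/tclE; apply: (ol_compZl H).
- move=> m n l p q r hl hr i x y y'.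
  rewrite -(treprK x) -(treprK y) -(treprK y') -!tclX.
  by apply/tclE; apply: (ol_compDr H).
- move=> m n l p q r hl hr i a x y.
  rewrite -(treprK x) -(treprK y) -!tclX.
  by apply/tclE; apply: (ol_compZr H).
- move=> n p x; rewrite -(treprK x) -!tclX.
  by apply/tclE; apply: (ol_act1 H).
- move=> n p s t x; rewrite -(treprK x) -!tclX.
  by apply/tclE; apply: (ol_actM H).
- move=> n p hl hr i x; rewrite -(treprK x) -!tclX.
  by apply/tclE; apply: (ol_id_comp H).
- move=> n p hl hr i x; rewrite -(treprK x) -!tclX.
  by apply/tclE; apply: (ol_comp_id H).
- move=> a b c ab bc abc p q r pq qr pqr h1 d1 h2 d2 h3 d3 h4 d4 i j k x y z hk.
  rewrite -(treprK x) -(treprK y) -(treprK z) -!tclX.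
  by apply/tclE; apply: (ol_seq H).
- move=> a b c ab ac abc p q r pq pr pqr h1 d1 h2 d2 h3 d3 h4 d4 i k k' i' x y z.
  move=> h1' h2' h3'.
  rewrite -(treprK x) -(treprK y) -(treprK z) -!tclX.
  by apply/tclE; apply: (ol_par H).
- move=> m n l p q r hl hr i s t u x y h1 h2.
  rewrite -(treprK x) -(treprK y) -!tclX.
  by apply/tclE; apply: (ol_equiv H).
Qed.

Definition free_operad : operad K := Operad free_ok.

Definition free_gen (g : X) : free_operad (gen_ar g) (gen_deg g) := tcl (tgen g).

End FreeOperad.

Record ideal (K : fieldType) (P : operad K) := Ideal {
  id_mem :> forall n p, P n p -> Prop;
  id_0 : forall n p, @id_mem n p 0;
  id_lin : forall n p a (x y : P n p), id_mem x -> id_mem y -> id_mem (a *: x + y);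
  id_act : forall n p s (x : P n p), id_mem x -> id_mem (op_act s x);
  id_compl : forall m n l (p q r : int) (hl : l = (m + n).-1%N) (hr : r = p + q) i
      (x : P m p) (y : P n q), id_mem x -> id_mem (op_comp hl hr i x y);
  id_compr : forall m n l (p q r : int) (hl : l = (m + n).-1%N) (hr : r = p + q) i
      (x : P m p) (y : P n q), id_mem y -> id_mem (op_comp hl hr i x y) }.

Section GeneratedIdeal.
Variables (K : fieldType) (P : operad K) (R : forall n p, P n p -> Prop).

Definition gen_mem n p (x : P n p) : Prop :=
  forall I : ideal P, (forall m q (y : P m q), R y -> I m q y) -> I n p x.

Definition ideal_gen : ideal P.
Proof.
exists gen_mem.
- by move=> n p I _; apply: id_0.
- by move=> n p a x y xR yR I IR; apply: id_lin; [apply: xR | apply: yR].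
- by move=> n p s x xR I IR; apply/id_act/xR.
- by move=> > xR I IR; apply/id_compl/xR.
- by move=> > xR I IR; apply/id_compr/xR.
Defined.
End GeneratedIdeal.

Section QuotientOperad.
Variables (K : fieldType) (P : operad K) (I : ideal P).

Definition ieq n p (x y : P n p) : Prop := I n p (x - y).

Lemma idD n p (x y : P n p) : I n p x -> I n p y -> I n p (x + y).
Proof. by move=> xI yI; rewrite -[x]scale1r; apply: id_lin. Qed.
Lemma idZ n p a (x : P n p) : I n p x -> I n p (a *: x).
Proof. by move=> xI; rewrite -[_ *: _]addr0; apply: id_lin => //; apply: id_0. Qed.
Lemma idN n p (x : P n p) : I n p x -> I n p (- x).
Proof. by move=> xI; rewrite -scaleN1r; apply: idZ. Qed.

Lemma ieq_eq n p (x y : P n p) : x = y -> ieq x y.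
Proof. by move=> ->; rewrite /ieq subrr; apply: id_0. Qed.

Lemma ieq_lin n p :
  lin_congr 0 (@GRing.add (P n p)) (@GRing.scale K (P n p)) (@ieq n p).
Proof.
split; try by move=> *; apply: ieq_eq; rewrite ?(addrA, add0r, scalerA,
  scale1r, scalerDr, scalerDl, scaleN1r, addNr).
- by move=> x y /idN; rewrite opprB.
- by move=> x y w xy yw; rewrite /ieq -(subrKA y); apply: idD.
- by move=> x x' y y' xx yy; rewrite /ieq opprD addrACA; apply: idD.
- by move=> a x x' xx; rewrite /ieq -scalerBr; apply: idZ.
- by move=> x y; apply: ieq_eq; rewrite addrC.
Qed.

Definition quot_lsetoid n p : lsetoid K := LSetoid (ieq_lin n p).
Definition quot_car n p : lmodType K := lquot (quot_lsetoid n p).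
Definition qcl n p (x : P n p) : quot_car n p := @lcl K (quot_lsetoid n p) x.
Definition qrepr n p (u : quot_car n p) : P n p := lrepr u.
Definition quot_act n p (s : 'S_n) (u : quot_car n p) : quot_car n p :=
  qcl (op_act s (qrepr u)).
Definition quot_comp m n l (p q r : int) (hl : l = (m + n).-1%N) (hr : r = p + q)
    (i : 'I_m) (u : quot_car m p) (v : quot_car n q) : quot_car l r :=
  qcl (op_comp hl hr i (qrepr u) (qrepr v)).

Lemma qclE n p (x y : P n p) : qcl x = qcl y <-> I n p (x - y).
Proof. exact: (@lclE K (quot_lsetoid n p)). Qed.
Lemma qreprK n p (u : quot_car n p) : qcl (qrepr u) = u.
Proof. exact: lreprK. Qed.
Lemma qrepr_cl n p (x : P n p) : I n p (qrepr (qcl x) - x).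
Proof. exact: (@lrepr_cl K (quot_lsetoid n p)). Qed.
Lemma qclD n p (x y : P n p) : qcl (x + y) = qcl x + qcl y.
Proof. exact: (@lclD K (quot_lsetoid n p)). Qed.
Lemma qclZ n p a (x : P n p) : qcl (a *: x) = a *: qcl x.
Proof. exact: (@lclZ K (quot_lsetoid n p)). Qed.
Lemma qcl_act n p (s : 'S_n) (x : P n p) : qcl (op_act s x) = quot_act s (qcl x).
Proof.
rewrite /quot_act; apply/esym/qclE; rewrite -op_actB; apply: id_act.
exact: qrepr_cl.
Qed.
Lemma qcl_comp m n l (p q r : int) (hl : l = (m + n).-1%N) (hr : r = p + q) i
    (x : P m p) (y : P n q) :
  qcl (op_comp hl hr i x y) = quot_comp hl hr i (qcl x) (qcl y).
Proof.
rewrite /quot_comp; apply/esym/qclE.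
rewrite -(subrKA (op_comp hl hr i x (qrepr (qcl y)))) -op_compBl -op_compBr.
by apply: idD; [apply: id_compl | apply: id_compr]; apply: qrepr_cl.
Qed.

Definition qclX := (qclD, qclZ, qcl_act, qcl_comp).

Let L := op_ok P.

Lemma quot_ok : operad_laws (fun n p => @GRing.add (quot_car n p))
  (fun n p => @GRing.scale K (quot_car n p)) quot_act (qcl (op_id P)) quot_comp
  (fun n p => @eq (quot_car n p)).
Proof.
split.
- move=> n p s x y; rewrite -(qreprK x) -(qreprK y) -!qclX.
  by congr qcl; apply: (ol_actD L).
- move=> n p s a x; rewrite -(qreprK x).
  by rewrite -qclZ -qcl_act (ol_actZ L) qclZ qcl_act.
- move=> m n l p q r hl hr i x x' y.
  rewrite -(qreprK x) -(qreprK x') -(qreprK y) -!qclX.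
  by congr qcl; apply: (ol_compDl L).
- move=> m n l p q r hl hr i a x y.
  rewrite -(qreprK x) -(qreprK y).
  by rewrite -qclZ -qcl_comp (ol_compZl L) qclZ qcl_comp.
- move=> m n l p q r hl hr i x y y'.
  rewrite -(qreprK x) -(qreprK y) -(qreprK y') -!qclX.
  by congr qcl; apply: (ol_compDr L).
- move=> m n l p q r hl hr i a x y.
  rewrite -(qreprK x) -(qreprK y).
  by rewrite -qclZ -qcl_comp (ol_compZr L) qclZ qcl_comp.
- move=> n p x; rewrite -(qreprK x) -!qclX.
  by congr qcl; apply: (ol_act1 L).
- move=> n p s t x; rewrite -(qreprK x) -!qclX.
  by congr qcl; apply: (ol_actM L).
- move=> n p hl hr i x; rewrite -(qreprK x) -!qclX.
  by congr qcl; apply: (ol_id_comp L).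
- move=> n p hl hr i x; rewrite -(qreprK x) -!qclX.
  by congr qcl; apply: (ol_comp_id L).
- move=> a b c ab bc abc p q r pq qr pqr h1 d1 h2 d2 h3 d3 h4 d4 i j k x y z hk.
  rewrite -(qreprK x) -(qreprK y) -(qreprK z) -!qclX.
  by congr qcl; apply: (ol_seq L).
- move=> a b c ab ac abc p q r pq pr pqr h1 d1 h2 d2 h3 d3 h4 d4 i k k' i' x y z.
  move=> h1' h2' h3'.
  rewrite -(qreprK x) -(qreprK y) -(qreprK z) -!qclX.
  by congr qcl; apply: (ol_par L).
- move=> m n l p q r hl hr i s t u x y h1 h2.
  rewrite -(qreprK x) -(qreprK y) -!qclX.
  by congr qcl; apply: (ol_equiv L).
Qed.

Definition quotient_operad : operad K := Operad quot_ok.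
End QuotientOperad.

Record suboperad (K : fieldType) (P : operad K) := Suboperad {
  so_mem :> forall n p, {pred P n p};
  so_submod : forall n p, submod_closed (@so_mem n p);
  so_act : forall n p s (x : P n p),
    x \in @so_mem n p -> op_act s x \in @so_mem n p;
  so_id : op_id P \in @so_mem 1%N 0;
  so_comp : forall m n l (p q r : int) (hl : l = (m + n).-1%N) (hr : r = p + q) i
      (x : P m p) (y : P n q),
    x \in @so_mem m p -> y \in @so_mem n q ->
    op_comp hl hr i x y \in @so_mem l r }.

Section SuboperadOperad.
Variables (K : fieldType) (P : operad K) (S : suboperad P).

Section Component.
Variables (n : nat) (p : int).
HB.instance Definition _ :=
  GRing.isSubmodClosed.Build K (P n p) (S n p) (so_submod S n p).

Record so_car := SoCar { so_val :> P n p; so_valP : so_val \in S n p }.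
HB.instance Definition _ := [isSub for so_val].
HB.instance Definition _ := [Choice of so_car by <:].
HB.instance Definition _ := [SubChoice_isSubZmodule of so_car by <:].
HB.instance Definition _ := [SubZmodule_isSubLmodule of so_car by <:].

Lemma so_val_inj : injective so_val.
Proof. exact: val_inj. Qed.
Lemma so_valD (x y : so_car) : so_val (x + y) = so_val x + so_val y.
Proof. exact: (raddfD (val : so_car -> P n p)). Qed.
Lemma so_valZ a (x : so_car) : so_val (a *: x) = a *: so_val x.
Proof. exact: (GRing.valZ a x). Qed.
End Component.

Definition sub_act n p (s : 'S_n) (x : so_car n p) : so_car n p :=
  SoCar (so_act s (so_valP x)).
Definition sub_comp m n l (p q r : int) (hl : l = (m + n).-1%N) (hr : r = p + q)
    (i : 'I_m) (x : so_car m p) (y : so_car n q) : so_car l r :=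
  SoCar (so_comp hl hr i (so_valP x) (so_valP y)).

Lemma sub_ok : operad_laws (fun n p => @GRing.add (so_car n p))
  (fun n p => @GRing.scale K (so_car n p)) sub_act (SoCar (so_id S)) sub_comp
  (fun n p => @eq (so_car n p)).
Proof.
have L := op_ok P.
split=> *; apply: so_val_inj; rewrite /= ?so_valD ?so_valZ /=.
- exact: (ol_actD L).
- exact: (ol_actZ L).
- exact: (ol_compDl L).
- exact: (ol_compZl L).
- exact: (ol_compDr L).
- exact: (ol_compZr L).
- exact: (ol_act1 L).
- exact: (ol_actM L).
- exact: (ol_id_comp L).
- exact: (ol_comp_id L).
- exact: (ol_seq L).
- exact: (ol_par L).
- exact: (ol_equiv L).
Qed.

Definition operad_of_sub : operad K :=
  @Operad K (fun n p => so_car n p) sub_act _ sub_comp sub_ok.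
End SuboperadOperad.

Section GradedTensor.
Variables (K : fieldType) (V W : int -> lmodType K) (k : int).

Inductive tens_term : Type :=
| ttzero
| ttadd (t u : tens_term)
| ttscale (a : K) (t : tens_term)
| ttpure i j (e : k = i + j) (v : V i) (w : W j).

Record tens_congr (E : tens_term -> tens_term -> Prop) : Prop := TensCongr {
  tc_lin : lin_congr ttzero ttadd ttscale E;
  tc_linl : forall i j (e : k = i + j) a v v' w,
    E (ttpure e (a *: v + v') w) (ttadd (ttscale a (ttpure e v w)) (ttpure e v' w));
  tc_linr : forall i j (e : k = i + j) a v w w',
    E (ttpure e v (a *: w + w')) (ttadd (ttscale a (ttpure e v w)) (ttpure e v w')) }.

Definition tens_eq (t u : tens_term) : Prop := forall E, tens_congr E -> E t u.

Lemma tens_lin : lin_congr ttzero ttadd ttscale tens_eq.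
Proof.
split.
- by move=> x E [H _ _]; apply: (lc_refl H).
- by move=> x y xy E H; apply: (lc_sym (tc_lin H));apply: xy.
- move=> x y w xy yw E H.
  by apply: (lc_trans (tc_lin H));[apply: xy | apply: yw].
- move=> x x' y y' xx yy E H.
  by apply: (lc_add (tc_lin H));[apply: xx | apply: yy].
- by move=> a x x' xx E H; apply: (lc_scale (tc_lin H));apply: xx.
- by move=> x y w E [H _ _]; apply: (lc_addA H).
- by move=> x y E [H _ _]; apply: (lc_addC H).
- by move=> x E [H _ _]; apply: (lc_add0 H).
- by move=> x E [H _ _]; apply: (lc_addN H).
- by move=> a b x E [H _ _]; apply: (lc_scaleA H).
- by move=> x E [H _ _]; apply: (lc_scale1 H).
- by move=> a x y E [H _ _]; apply: (lc_scaleDr H).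
- by move=> a b x E [H _ _]; apply: (lc_scaleDl H).
Qed.

Definition tens_lsetoid : lsetoid K := LSetoid tens_lin.

(* Degree k component of the tensor product of V and W: the direct sum over
   i + j = k of the V i (x) W j. *)
Definition tensor : lmodType K := lquot tens_lsetoid.

Definition pure i j (e : k = i + j) (v : V i) (w : W j) : tensor :=
  @lcl K tens_lsetoid (ttpure e v w).

Lemma pure_linl i j (e : k = i + j) w : linear (fun v => pure e v w).
Proof.
move=> a v v'; rewrite /pure -(@lclZ K tens_lsetoid) -(@lclD K tens_lsetoid).
by apply/lclE => E H; apply: (tc_linl H).
Qed.
Lemma pure_linr i j (e : k = i + j) v : linear (fun w => pure e v w).
Proof.
move=> a w w'; rewrite /pure -(@lclZ K tens_lsetoid) -(@lclD K tens_lsetoid).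
by apply/lclE => E H; apply: (tc_linr H).
Qed.

Lemma pureDl i j (e : k = i + j) v v' w :
  pure e (v + v') w = pure e v w + pure e v' w.
Proof. by have := pure_linl e w 1 v v'; rewrite !scale1r. Qed.
Lemma pureDr i j (e : k = i + j) v w w' :
  pure e v (w + w') = pure e v w + pure e v w'.
Proof. by have := pure_linr e v 1 w w'; rewrite !scale1r. Qed.
Lemma pure0l i j (e : k = i + j) w : pure e 0 w = 0.
Proof. by apply: (addrI (pure e 0 w));rewrite -pureDl !addr0. Qed.
Lemma pure0r i j (e : k = i + j) v : pure e v 0 = 0.
Proof. by apply: (addrI (pure e v 0));rewrite -pureDr !addr0. Qed.
Lemma pureZl i j (e : k = i + j) a v w : pure e (a *: v) w = a *: pure e v w.
Proof. by have := pure_linl e w a v 0; rewrite pure0l !addr0. Qed.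
Lemma pureZr i j (e : k = i + j) a v w : pure e v (a *: w) = a *: pure e v w.
Proof. by have := pure_linr e v a w 0; rewrite pure0r !addr0. Qed.

Lemma tens_ind (Q : tensor -> Prop) :
  (forall i j (e : k = i + j) v w, Q (pure e v w)) ->
  (forall u u', Q u -> Q u' -> Q (u + u')) ->
  (forall a u, Q u -> Q (a *: u)) -> forall u, Q u.
Proof.
move=> Qp QD QZ u; rewrite -(lreprK u); elim: (lrepr u) => [|t Qt t' Qt'|a t Qt|//].
- suff -> : @lcl K tens_lsetoid ttzero = 0 *: pure (esym (addr0 k)) 0 0.
    exact/QZ/Qp.
  by rewrite scale0r.
- by rewrite (@lclD K tens_lsetoid t t'); apply: QD.
- by rewrite (@lclZ K tens_lsetoid a t); apply: QZ.
Qed.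

Section Lift.
Variables (U : lmodType K) (F : forall i j, k = i + j -> V i -> W j -> U).

Fixpoint tens_eval (t : tens_term) : U :=
  match t with
  | ttzero => 0
  | ttadd t u => tens_eval t + tens_eval u
  | ttscale a t => a *: tens_eval t
  | ttpure i j e v w => F e v w
  end.

Definition tens_lift (u : tensor) : U := tens_eval (lrepr u).

Hypothesis Fl : forall i j (e : k = i + j) w, linear (fun v => F e v w).
Hypothesis Fr : forall i j (e : k = i + j) v, linear (F e v).

Lemma tens_lift_cl t : tens_lift (@lcl K tens_lsetoid t) = tens_eval t.
Proof.
apply: (@lrepr_cl K tens_lsetoid t (fun t u => tens_eval t = tens_eval u)).
split=> [|i j e a v v' w|i j e a v w w'] /=; [|exact: Fl | exact: Fr].
split=> //=; try by move=> *; rewrite ?(addrA, add0r, scalerA,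
  scale1r, scalerDr, scalerDl, scaleN1r, addNr).
- by move=> x y w -> ->.
- by move=> x x' y y' -> ->.
- by move=> a x x' ->.
- by move=> x y; rewrite addrC.
Qed.

Lemma tens_lift_pure i j (e : k = i + j) v w : tens_lift (pure e v w) = F e v w.
Proof. exact: tens_lift_cl. Qed.

Lemma tens_liftD u u' : tens_lift (u + u') = tens_lift u + tens_lift u'.
Proof.
rewrite -(lreprK u) -(lreprK u') -(@lclD K tens_lsetoid).
by rewrite !tens_lift_cl.
Qed.
Lemma tens_liftZ a u : tens_lift (a *: u) = a *: tens_lift u.
Proof.
by rewrite -(lreprK u) -(@lclZ K tens_lsetoid) !tens_lift_cl.
Qed.
End Lift.

End GradedTensor.

Section Koszul.
Variable K : fieldType.
Implicit Types p q r : int.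

Lemma odd_abszD p q : odd (absz (p + q)) = odd (absz p) (+) odd (absz q).
Proof.
have /eqP := @expfzDr rat (-1) p q isT.
by rewrite !expN1r -!(signr_odd _ (absz _)) -signr_addb; do 3 case: (odd _).
Qed.

Lemma koszulE p q : koszul K p q = (-1) ^+ (odd (absz p) && odd (absz q)).
Proof. by rewrite /koszul -signr_odd oddM. Qed.
End Koszul.

Section Hadamard.
Variables (K : fieldType) (P Q : operad K).
Let LP := op_ok P.
Let LQ := op_ok Q.

Definition had_car n k : lmodType K := tensor (P n) (Q n) k.

Definition had_act n k (s : 'S_n) (u : had_car n k) : had_car n k :=
  tens_lift (fun i j e a b => pure e (op_act s a) (op_act s b)) u.

Lemma had_deg (p q r i j i' j' : int) :
  r = p + q -> p = i + j -> q = i' + j' -> r = (i + i') + (j + j').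
Proof. by move=> -> -> ->; rewrite addrACA. Qed.

(* (a (x) b) \o_s (a' (x) b') = (-1)^(|b||a'|) (a \o_s a') (x) (b \o_s b') *)
Definition had_comp m n l (p q r : int) (hl : l = (m + n).-1%N) (hr : r = p + q)
    (s : 'I_m) (u : had_car m p) (v : had_car n q) : had_car l r :=
  tens_lift (fun i j e a b =>
    tens_lift (fun i' j' e' a' b' =>
      koszul K j i' *: pure (had_deg hr e e')
        (op_comp hl erefl s a a') (op_comp hl erefl s b b')) v) u.

Definition had_id : had_car 1 0 := pure (esym (addr0 (0 : int))) (op_id P) (op_id Q).

Lemma had_act_pure n k (s : 'S_n) i j (e : k = i + j) a b :
  had_act s (pure e a b) = pure e (op_act s a) (op_act s b).
Proof.
rewrite /had_act tens_lift_pure // => i' j' e'.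
- by move=> w c v v'; rewrite (ol_actD LP) (ol_actZ LP) pureDl pureZl.
- by move=> v c w w'; rewrite (ol_actD LQ) (ol_actZ LQ) pureDr pureZr.
Qed.
Lemma had_actD n k (s : 'S_n) (u v : had_car n k) :
  had_act s (u + v) = had_act s u + had_act s v.
Proof.
rewrite /had_act tens_liftD // => i j e.
- by move=> w c x y; rewrite (ol_actD LP) (ol_actZ LP) pureDl pureZl.
- by move=> w c x y; rewrite (ol_actD LQ) (ol_actZ LQ) pureDr pureZr.
Qed.
Lemma had_actZ n k (s : 'S_n) c (u : had_car n k) :
  had_act s (c *: u) = c *: had_act s u.
Proof.
rewrite /had_act tens_liftZ // => i j e.
- by move=> w d x y; rewrite (ol_actD LP) (ol_actZ LP) pureDl pureZl.
- by move=> w d x y; rewrite (ol_actD LQ) (ol_actZ LQ) pureDr pureZr.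
Qed.

Section Comp.
Variables (m n l : nat) (p q r : int) (hl : l = (m + n).-1%N) (hr : r = p + q).
Variable (s : 'I_m).

Let F i j (e : p = i + j) (a : P m i) (b : Q m j) i' j' (e' : q = i' + j')
  (a' : P n i') (b' : Q n j') : had_car l r :=
  koszul K j i' *: pure (had_deg hr e e')
    (op_comp hl erefl s a a') (op_comp hl erefl s b b').

Let Fl i j (e : p = i + j) a b i' j' (e' : q = i' + j') b' :
  linear (fun a' => F e a b e' a' b').
Proof.
move=> c x y; rewrite /F (ol_compDr LP) (ol_compZr LP) pureDl pureZl scalerDr.
by rewrite !scalerA mulrC.
Qed.
Let Fr i j (e : p = i + j) a b i' j' (e' : q = i' + j') a' :
  linear (fun b' => F e a b e' a' b').
Proof.
move=> c x y; rewrite /F (ol_compDr LQ) (ol_compZr LQ) pureDr pureZr scalerDr.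
by rewrite !scalerA mulrC.
Qed.

Let G (v : had_car n q) i j (e : p = i + j) a b : had_car l r :=
  tens_lift (fun i' j' e' a' b' => F e a b e' a' b') v.

Let GD v v' i j (e : p = i + j) a b : G (v + v') e a b = G v e a b + G v' e a b.
Proof. by rewrite /G tens_liftD; [|apply: Fl|apply: Fr]. Qed.
Let GZ c v i j (e : p = i + j) a b : G (c *: v) e a b = c *: G v e a b.
Proof. by rewrite /G tens_liftZ; [|apply: Fl|apply: Fr]. Qed.
Let Gp i j (e : p = i + j) a b i' j' (e' : q = i' + j') a' b' :
  G (pure e' a' b') e a b = F e a b e' a' b'.
Proof. by rewrite /G tens_lift_pure; [|apply: Fl|apply: Fr]. Qed.

Let Gl v i j (e : p = i + j) b : linear (fun a => G v e a b).
Proof.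
move=> c x y; elim/tens_ind: v => [i' j' e' a' b'|u u' hu hu'|d u hu].
- rewrite !Gp /F (ol_compDl LP) (ol_compZl LP) pureDl pureZl scalerDr.
  by rewrite !scalerA mulrC.
- by rewrite !GD hu hu' scalerDr addrACA.
- by rewrite !GZ hu scalerDr !scalerA mulrC.
Qed.
Let Gr v i j (e : p = i + j) a : linear (fun b => G v e a b).
Proof.
move=> c x y; elim/tens_ind: v => [i' j' e' a' b'|u u' hu hu'|d u hu].
- rewrite !Gp /F (ol_compDl LQ) (ol_compZl LQ) pureDr pureZr scalerDr.
  by rewrite !scalerA mulrC.
- by rewrite !GD hu hu' scalerDr addrACA.
- by rewrite !GZ hu scalerDr !scalerA mulrC.
Qed.

Lemma had_compDl u u' (v : had_car n q) :
  had_comp hl hr s (u + u') v = had_comp hl hr s u v + had_comp hl hr s u' v.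
Proof. exact: (tens_liftD (Gl v) (Gr v)). Qed.
Lemma had_compZl c u (v : had_car n q) :
  had_comp hl hr s (c *: u) v = c *: had_comp hl hr s u v.
Proof. exact: (tens_liftZ (Gl v) (Gr v)). Qed.

Let comp_purel i j (e : p = i + j) a b v :
  had_comp hl hr s (pure e a b) v = G v e a b.
Proof. exact: (tens_lift_pure (Gl v) (Gr v)). Qed.

Lemma had_compDr u (v v' : had_car n q) :
  had_comp hl hr s u (v + v') = had_comp hl hr s u v + had_comp hl hr s u v'.
Proof.
elim/tens_ind: u => [i j e a b|u u' hu hu'|d u hu].
- by rewrite !comp_purel GD.
- by rewrite !had_compDl hu hu' addrACA.
- by rewrite !had_compZl hu scalerDr.
Qed.
Lemma had_compZr c u (v : had_car n q) :
  had_comp hl hr s u (c *: v) = c *: had_comp hl hr s u v.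
Proof.
elim/tens_ind: u => [i j e a b|u u' hu hu'|d u hu].
- by rewrite !comp_purel GZ.
- by rewrite !had_compDl hu hu' scalerDr.
- by rewrite !had_compZl hu !scalerA mulrC.
Qed.

Lemma had_comp_pure i j (e : p = i + j) a b i' j' (e' : q = i' + j') a' b'
    ri rj (er : r = ri + rj) (hi : ri = i + i') (hj : rj = j + j') :
  had_comp hl hr s (pure e a b) (pure e' a' b') =
  koszul K j i' *: pure er (op_comp hl hi s a a') (op_comp hl hj s b b').
Proof.
rewrite comp_purel Gp /F; subst ri rj.
by rewrite (eq_irrelevance (had_deg hr e e') er).
Qed.
End Comp.

Definition had_compE := (had_compDl, had_compZl, had_compDr, had_compZr).

Lemma had_ok : operad_laws (fun n p => @GRing.add (had_car n p))
  (fun n p => @GRing.scale K (had_car n p)) had_act had_id had_comp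
  (fun n p => @eq (had_car n p)).
Proof.
split; try by [move=> *; apply: had_actD | move=> *; apply: had_actZ
  | move=> *; apply: had_compDl | move=> *; apply: had_compZl
  | move=> *; apply: had_compDr | move=> *; apply: had_compZr].
- move=> n p u; elim/tens_ind: u => [i j e a b|u u' hu hu'|c u hu].
  + by rewrite had_act_pure (ol_act1 LP) (ol_act1 LQ).
  + by rewrite had_actD hu hu'.
  + by rewrite had_actZ hu.
- move=> n p s t u; elim/tens_ind: u => [i j e a b|u u' hu hu'|c u hu].
  + by rewrite !had_act_pure (ol_actM LP) (ol_actM LQ).
  + by rewrite !had_actD hu hu'.
  + by rewrite !had_actZ hu.
- move=> n p hl hr s u; elim/tens_ind: u => [i j e a b|u u' hu hu'|c u hu].
  + rewrite (had_comp_pure _ _ _ _ _ _ _ _ _ e (esym (add0r i)) (esym (add0r j))).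
    by rewrite (ol_id_comp LP) (ol_id_comp LQ) /koszul mul0n scale1r.
  + by rewrite had_compDr hu hu'.
  + by rewrite had_compZr hu.
- move=> n p hl hr s u; elim/tens_ind: u => [i j e a b|u u' hu hu'|c u hu].
  + rewrite (had_comp_pure _ _ _ _ _ _ _ _ _ e (esym (addr0 i)) (esym (addr0 j))).
    by rewrite (ol_comp_id LP) (ol_comp_id LQ) /koszul muln0 scale1r.
  + by rewrite had_compDl hu hu'.
  + by rewrite had_compZl hu.
- move=> a b c ab bc abc p q r pq qr pqr h1 d1 h2 d2 h3 d3 h4 d4 i j k x y z hk.
  elim/tens_ind: x => [i1 j1 e1 x1 x2|u u' hu hu'|d u hu]; last 2 first.
  + by rewrite !had_compDl hu hu'.
  + by rewrite !had_compZl hu.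
  elim/tens_ind: y => [i2 j2 e2 y1 y2|u u' hu hu'|d u hu]; last 2 first.
  + by rewrite !(had_compDl, had_compDr) hu hu'.
  + by rewrite !(had_compZl, had_compZr) hu.
  elim/tens_ind: z => [i3 j3 e3 z1 z2|u u' hu hu'|d u hu]; last 2 first.
  + by rewrite !had_compDr hu hu'.
  + by rewrite !had_compZr hu.
  rewrite (had_comp_pure h1 d1 j e2 y1 y2 e3 z1 z2 (had_deg d1 e2 e3) erefl erefl).
  rewrite (had_comp_pure h3 d3 i e1 x1 x2 e2 y1 y2 (had_deg d3 e1 e2) erefl erefl).
  rewrite had_compZr had_compZl.
  have er := had_deg d2 e1 (had_deg d1 e2 e3).
  rewrite (had_comp_pure _ _ _ _ _ _ _ _ _ er erefl erefl).
  rewrite (had_comp_pure _ _ _ _ _ _ _ _ _ er (addrA i1 i2 i3) (addrA j1 j2 j3)).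
  rewrite (ol_seq LP _ _ _ _ h3 erefl h4 (addrA i1 i2 i3) _ _ _ hk).
  rewrite (ol_seq LQ _ _ _ _ h3 erefl h4 (addrA j1 j2 j3) _ _ _ hk).
  rewrite !scalerA; congr (_ *: _).
  rewrite !koszulE !odd_abszD -!signr_addb; congr (_ ^+ nat_of_bool _).
  by case: (odd (absz j1)); case: (odd (absz j2)); case: (odd (absz i2)); case: (odd (absz i3)).
- move=> a b c ab ac abc p q r pq pr pqr h1 d1 h2 d2 h3 d3 h4 d4 i k k' i' x y z.
  move=> h1' h2' h3'.
  elim/tens_ind: x => [i1 j1 e1 x1 x2|u u' hu hu'|d u hu]; last 2 first.
  + by rewrite !had_compDl hu hu' scalerDr.
  + by rewrite !had_compZl hu !scalerA mulrC.
  elim/tens_ind: y => [i2 j2 e2 y1 y2|u u' hu hu'|d u hu]; last 2 first.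
  + by rewrite !(had_compDl, had_compDr) hu hu' scalerDr.
  + by rewrite !(had_compZl, had_compZr) hu !scalerA mulrC.
  elim/tens_ind: z => [i3 j3 e3 z1 z2|u u' hu hu'|d u hu]; last 2 first.
  + by rewrite !(had_compDl, had_compDr) hu hu' scalerDr.
  + by rewrite !(had_compZl, had_compZr) hu !scalerA mulrC.
  rewrite (had_comp_pure h1 d1 i e1 x1 x2 e2 y1 y2 (had_deg d1 e1 e2) erefl erefl).
  rewrite (had_comp_pure h3 d3 k e1 x1 x2 e3 z1 z2 (had_deg d3 e1 e3) erefl erefl).
  rewrite !had_compZl.
  have er := had_deg d2 (had_deg d1 e1 e2) e3.
  rewrite (had_comp_pure _ _ _ _ _ _ _ _ _ er erefl erefl).
  rewrite (had_comp_pure _ _ _ _ _ _ _ _ _ er (addrAC i1 i2 i3) (addrAC j1 j2 j3)).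
  rewrite (ol_par LP _ _ _ _ h3 erefl h4 (addrAC i1 i2 i3) _ _ _ h1' h2' h3').
  rewrite (ol_par LQ _ _ _ _ h3 erefl h4 (addrAC j1 j2 j3) _ _ _ h1' h2' h3').
  rewrite pureZl pureZr !scalerA e2 e3; congr (_ *: _).
  rewrite !koszulE !odd_abszD -!signr_addb; congr (_ ^+ nat_of_bool _).
  by case: (odd (absz j1)); case: (odd (absz j2)); case: (odd (absz i2)); case: (odd (absz i3));
    case: (odd (absz j3)).
- move=> m n l p q r hl hr i s t u x y h1 h2.
  elim/tens_ind: x => [i1 j1 e1 x1 x2|v v' hv hv'|d v hv]; last 2 first.
  + by rewrite !(had_compDl, had_actD) hv hv'.
  + by rewrite !(had_compZl, had_actZ) hv.
  elim/tens_ind: y => [i2 j2 e2 y1 y2|v v' hv hv'|d v hv]; last 2 first.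
  + by rewrite !(had_compDr, had_actD) hv hv'.
  + by rewrite !(had_compZr, had_actZ) hv.
  have er := had_deg hr e1 e2.
  rewrite !had_act_pure !(had_comp_pure _ _ _ _ _ _ _ _ _ er erefl erefl).
  rewrite had_actZ had_act_pure.
  by rewrite (ol_equiv LP _ _ _ _ h1 h2) (ol_equiv LQ _ _ _ _ h1 h2).
Qed.

Definition hadamard : operad K := Operad had_ok.
End Hadamard.

(* T(X)/(R) *)
Definition presented (K : fieldType) (X : signature)
    (R : forall n p, free_operad K X n p -> Prop) : operad K :=
  quotient_operad (ideal_gen R).

Section BinaryComposites.
Variables (K : fieldType) (P : operad K).

Definition comp1 (p q r : int) (e : r = p + q) (x : P 2%N p) (y : P 2%N q) : P 3%N r :=
  op_comp (erefl : 3%N = (2 + 2).-1%N) e ord0 x y.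
Definition comp2 (p q r : int) (e : r = p + q) (x : P 2%N p) (y : P 2%N q) : P 3%N r :=
  op_comp (erefl : 3%N = (2 + 2).-1%N) e ord_max x y.

Definition tau (p : int) (x : P 2%N p) : P 2%N p := op_act (tperm ord0 ord_max) x.
Definition swap12 (p : int) (x : P 3%N p) : P 3%N p :=
  op_act (tperm ord0 (lift ord0 ord0)) x.
End BinaryComposites.

Definition deg00 : 0 = 0 + 0 :> int := erefl.
Definition deg01 : 1 = 0 + 1 :> int := erefl.
Definition deg10 : 1 = 1 + 0 :> int := erefl.
Definition deg11 : 2 = 1 + 1 :> int := erefl.

(* In all three presentations the symmetry of the generators is imposed by
   relations: T(E) for a generating S_2-module E is the free operad on
   generators without symmetry modulo the relations defining E. *)
Section Presentations.
Variable K : fieldType.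

Section Lie.
Definition Lie_sig : signature :=
  @Signature unit (fun=> 2%N) (fun=> 0).
Let par : free_operad K Lie_sig 2%N 0 := free_gen K (tt : Lie_sig).

Inductive Lie_rel : forall n p, free_operad K Lie_sig n p -> Prop :=
| Lie_anti : Lie_rel (par + tau par)
(* (1,(2,3)) - ((1,2),3) - (2,(1,3)) *)
| Lie_jacobi : Lie_rel
    (comp2 deg00 par par - comp1 deg00 par par
     - swap12 (comp2 deg00 par par)).

Definition operad_Lie : operad K := presented Lie_rel.
End Lie.

Section LL.
Inductive LL_gen := LL_par | LL_br.
Definition LL_sig : signature :=
  @Signature LL_gen (fun=> 2%N) (fun g => if g is LL_par then 0 else 1).
Let par : free_operad K LL_sig 2%N 0 := free_gen K (LL_par : LL_sig).
Let br : free_operad K LL_sig 2%N 1 := free_gen K (LL_br : LL_sig).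

Inductive LL_rel : forall n p, free_operad K LL_sig n p -> Prop :=
| LL_anti : LL_rel (par + tau par)
(* [1,[2,3]] + [[1,2],3] + [2,[1,3]] *)
| LL_rel1 : LL_rel
    (comp2 deg11 br br + comp1 deg11 br br
     + swap12 (comp2 deg11 br br))
(* [1,(2,3)] - ([1,2],3) - (2,[1,3]) *)
| LL_rel2 : LL_rel
    (comp2 deg10 br par - comp1 deg01 par br
     - swap12 (comp2 deg01 par br))
(* [(1,2),3] - ([1,2],3) + ([2,1],3) *)
| LL_rel3 : LL_rel
    (comp1 deg10 br par - comp1 deg01 par br
     + comp1 deg01 par (tau br))
(* (1,(2,3)) - ((1,2),3) - (2,(1,3)) *)
| LL_rel4 : LL_rel
    (comp2 deg00 par par - comp1 deg00 par par
     - swap12 (comp2 deg00 par par)).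

Definition operad_LL : operad K := presented LL_rel.
End LL.

Section Deriving.
Inductive O_gen := O_d | O_mul.
Definition O_sig : signature :=
  @Signature O_gen (fun g => if g is O_d then 1%N else 2%N)
    (fun g => if g is O_d then 1 else 0).
Let d : free_operad K O_sig 1%N 1 := free_gen K (O_d : O_sig).
Let mul : free_operad K O_sig 2%N 0 := free_gen K (O_mul : O_sig).

Inductive O_rel : forall n p, free_operad K O_sig n p -> Prop :=
| O_comm : O_rel (mul - tau mul)
| O_dd : O_rel (op_comp (erefl : 1%N = (1 + 1).-1%N) deg11 ord0 d d)
| O_der : O_rel
    (op_comp (erefl : 2%N = (1 + 2).-1%N) deg10 ord0 d mul
     - op_comp (erefl : 2%N = (2 + 1).-1%N) deg01 ord0 mul d
     - op_comp (erefl : 2%N = (2 + 1).-1%N) deg01 ord_max mul d)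
| O_assoc : O_rel
    (comp1 deg00 mul mul - comp2 deg00 mul mul).

(* The degree of a component is the number of d's. *)
Definition operad_O : operad K := presented O_rel.

(* D(n) = O^0(n) + ... + O^(n-1)(n): the components O^p(n) with 0 <= p < n are
   kept whole, the others are replaced by 0. *)
Definition D_mem n p : {pred operad_O n p} :=
  [pred x | ((0 <= p) && (p < n%:Z)) || (x == 0)].

Definition D_sub : suboperad operad_O.
Proof.
exists D_mem.
- move=> n p; rewrite /D_mem; split=> [|a x y]; rewrite !inE ?eqxx ?orbT //.
  by case: (_ && _) => //= /eqP-> /eqP->; rewrite scaler0 addr0.
- move=> n p s x; rewrite !inE => /orP[->//|/eqP->].
  by rewrite op_act0 eqxx orbT.
- by rewrite inE.
- move=> m n l p q r hl hr i x y; rewrite !inE.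
  case/orP=> [/andP[p0 pm]|/eqP->]; last first.
    by rewrite op_comp0l eqxx orbT.
  case/orP=> [/andP[q0 qn]|/eqP->]; last first.
    by rewrite op_comp0r eqxx orbT.
  apply/orP; left; rewrite hr addr_ge0 //=.
  case: p q p0 q0 pm qn {hr x y} => [p|//] [q|//] _ _.
  rewrite ltz_nat => pm; rewrite ltz_nat => qn.
  suff: (p + q < l)%N by [].
  rewrite hl -ltnS prednK ?addn_gt0 ?(leq_ltn_trans (leq0n p) pm) //.
  by rewrite -addnS -addSn leq_add.
Defined.

Definition operad_D : operad K := operad_of_sub D_sub.
End Deriving.

End Presentations.

(* Main.v *)
(* Let f : LL -> Lie (x) D send (1,2) to (1,2) (x) 1(x)1 and [1,2] to
   (1,2) (x) d(x)1.  The relations of LL rewrite a bracket applied to a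
   right-normed monomial into right-normed monomials {a_1,{a_2,...{a_(n-1),m}}},
   each {,} being (,) or [,]; call an input "derived" when it is the left
   argument of a [,].  The last input m is never derived, and any other
   underived input can be moved to the last place.  Hence, after the choice of an
   underived m(S) for every proper subset S of the inputs, LL(n) is spanned by the
   monomials with set S of derived inputs and last input m(S); f maps such a
   monomial to (a_1,(a_2,...,m(S))) (x) d^S.  These images span Lie(n) (x) D(n)
   because O obeys an analogous rewriting, which gives surjectivity.
   They are independent, which gives injectivity: Lie is tested on matrix units
   inside a matrix algebra, which detects one word with prescribed last letter,
   and O on odd elements th_i of a Grassmann algebra, where d^S becomes
   the product of the th_i, i in S. *)
Require Import Defs.
From mathcomp Require Import all_boot all_order all_algebra all_fingroup.
From mathcomp Require Import boolp zify ring.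

Set Implicit Arguments.
Unset Strict Implicit.
Unset Printing Implicit Defensive.

Import Order.TTheory GRing.Theory Num.Theory.
Local Open Scope ring_scope.

(** * Presented operads *)

(** The obstacle is that the last input of a monomial must be underived, so no single choice of it
    serves all monomials and the set S of derived inputs has to be followed. The relation for
    [[(1,2),3]] does not respect S: it replaces a derived compound by a difference of two monomials
    with different sets. Closure of the right-normed span under composition is therefore proved
    without following S. Only afterwards are elements sorted by S, which can be read off a
    right-normed monomial; moving an input to the last place then needs no compound as left argument
    of [[,]], and S is preserved. The bound on the number of d's in D leaves out the set of all
    inputs, the only one without a possible last input; in LL the corresponding piece vanishes
    because the last input is never derived. No basis of Lie(n) or of D(n) is needed: surjectivity
    uses spanning sets on both factors, and injectivity applies functionals to the tensor product
    itself. One family [G] of two brackets with an operation [B] treats Lie, LL and O together. *)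

Section PresentedOperads.
Variables (K : fieldType) (X : signature).
Variable R : forall n p, free_operad K X n p -> Prop.

(** A chosen representative: functions on the presented operad are defined by recursion on this
    term, and [of_term_congr] removes the dependence on the choice. *)
Definition term_of n p (x : presented R n p) : term K X n p := trepr (qrepr x).
Definition of_term n p (t : term K X n p) : presented R n p :=
  qcl (ideal_gen R) (tcl t : free_operad K X n p).

Lemma term_ofK n p (x : presented R n p) : of_term (term_of x) = x.
Proof. by rewrite /of_term /term_of treprK qreprK. Qed.

Lemma of_termD n p (t u : term K X n p) :
  of_term (tadd t u) = of_term t + of_term u.
Proof. by rewrite /of_term tclD qclD. Qed.
Lemma of_termZ n p a (t : term K X n p) : of_term (tscale a t) = a *: of_term t.
Proof. by rewrite /of_term tclZ qclZ. Qed.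
Lemma of_term_act n p (s : 'S_n) (t : term K X n p) :
  of_term (tact s t) = op_act s (of_term t).
Proof.
rewrite /of_term tcl_act.
exact: (qcl_act (ideal_gen R) s (tcl t : free_operad K X n p)).
Qed.
Lemma of_term_comp m n l (p q r : int) (hl : l = (m + n).-1%N) (hr : r = p + q) i
    (t : term K X m p) (u : term K X n q) :
  of_term (tcomp hl hr i t u) = op_comp hl hr i (of_term t) (of_term u).
Proof.
rewrite /of_term tcl_comp.
exact: (qcl_comp (ideal_gen R) hl hr i (tcl t : free_operad K X m p)
  (tcl u : free_operad K X n q)).
Qed.
Lemma of_term_id : of_term (@tid K X) = op_id (presented R).
Proof. by []. Qed.
Lemma of_term0 n p : of_term (@tzero K X n p) = 0.
Proof. by []. Qed.

Definition of_termE :=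
  (of_termD, of_termZ, of_term_act, of_term_comp, of_term_id, of_term0).

Definition pgen (g : X) : presented R (gen_ar g) (gen_deg g) := of_term (tgen K g).

Lemma presented_ind (Q : forall n p, presented R n p -> Prop) :
  (forall g, Q _ _ (pgen g)) ->
  (forall n p, Q n p 0) ->
  (forall n p x y, Q n p x -> Q n p y -> Q n p (x + y)) ->
  (forall n p a x, Q n p x -> Q n p (a *: x)) ->
  (forall n p s x, Q n p x -> Q n p (op_act s x)) ->
  Q 1%N 0 (op_id _) ->
  (forall m n l (p q r : int) (hl : l = (m + n).-1%N) (hr : r = p + q) i x y,
     Q m p x -> Q n q y -> Q l r (op_comp hl hr i x y)) ->
  forall n p x, Q n p x.
Proof.
move=> Qg Q0 QD QZ Qa Q1 Qc n p x; rewrite -(term_ofK x).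
elim: (term_of x) => {n p x}.
- exact: Qg.
- by move=> n p; rewrite of_termE.
- by move=> n p t Qt u Qu; rewrite of_termE; apply: QD.
- by move=> n p a t Qt; rewrite of_termE; apply: QZ.
- by move=> n p s t Qt; rewrite of_termE; apply: Qa.
- by rewrite of_termE.
- by move=> > Qt > Qu; rewrite of_termE; apply: Qc.
Qed.

(** * Congruences of terms that respect the relations *)

Section Congruence.
Variable E : forall n p, term K X n p -> term K X n p -> Prop.
Hypothesis HE : operad_congr E.
Hypothesis HR : forall n p (y : free_operad K X n p), R y -> E (trepr y) (tzero K X n p).

Let Er n p := lc_refl (oc_lin HE n p).
Let Et n p := lc_trans (oc_lin HE n p).

Lemma congr_tcl n p (t u : term K X n p) : tcl t = tcl u -> E t u.
Proof. by move/tclE; apply. Qed.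

Let idE0 n p (y : free_operad K X n p) := E (trepr y) (tzero K X n p).

Lemma congr_zero n p (t : term K X n p) : tcl t = 0 -> E t (tzero K X n p).
Proof. by move=> t0; apply: congr_tcl; rewrite t0. Qed.

Definition congr_ideal : ideal (free_operad K X).
Proof.
exists idE0.
- by move=> n p; apply: congr_zero; rewrite treprK.
- move=> n p a x y x0 y0.
  have: E (trepr (a *: x + y)) (tadd (tscale a (trepr x)) (trepr y)).
    by apply: congr_tcl; rewrite tclD tclZ !treprK.
  move/Et; apply; apply: Et (lc_add (oc_lin HE n p) (lc_scale (oc_lin HE n p) a x0) y0) _.
  by apply: congr_zero; rewrite tclD tclZ (_ : tcl (tzero _ _ _ _) = 0) // scaler0 addr0.
- move=> n p s x x0.
  have: E (trepr (op_act s x)) (tact s (trepr x)).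
    by apply: congr_tcl; rewrite tcl_act !treprK.
  move/Et; apply; apply: Et (oc_act HE s x0) _; apply: congr_zero.
  rewrite tcl_act; exact: (@op_act0 _ (free_operad K X)).
- move=> m n l p q r hl hr i x y x0.
  have: E (trepr (op_comp hl hr i x y)) (tcomp hl hr i (trepr x) (trepr y)).
    by apply: congr_tcl; rewrite tcl_comp !treprK.
  move/Et; apply; apply: Et (oc_comp HE hl hr i x0 (Er _)) _; apply: congr_zero.
  rewrite tcl_comp; exact: (@op_comp0l _ (free_operad K X)).
- move=> m n l p q r hl hr i x y y0.
  have: E (trepr (op_comp hl hr i x y)) (tcomp hl hr i (trepr x) (trepr y)).
    by apply: congr_tcl; rewrite tcl_comp !treprK.
  move/Et; apply; apply: Et (oc_comp HE hl hr i (Er _) y0) _; apply: congr_zero.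
  rewrite tcl_comp; exact: (@op_comp0r _ (free_operad K X)).
Defined.

(** Elements of the free operad congruent to zero form [congr_ideal], which contains the relations
    and hence the ideal they generate. A model of the presented operad therefore needs no operad
    structure of its own; an operadic congruence on terms is enough. *)
Lemma of_term_congr n p (t u : term K X n p) : of_term t = of_term u -> E t u.
Proof.
move/qclE => /(_ congr_ideal HR) /= tu0.
have {}tu0 : E (tadd t (tscale (-1) u)) (tzero K X n p).
  apply: Et tu0; apply: congr_tcl.
  by rewrite tclD tclZ treprK scaleN1r.
have: E (tadd (tadd t (tscale (-1) u)) u) (tadd (tzero K X n p) u).
  exact: lc_add (oc_lin HE n p) _ _ _ _ tu0 (Er _).
move/Et => /(_ _ (lc_add0 (oc_lin HE n p) u)); apply: Et.
by apply: congr_tcl; rewrite !tclD tclZ scaleN1r subrK.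
Qed.

Lemma term_of_congr n p (t : term K X n p) : E (term_of (of_term t)) t.
Proof. by apply: of_term_congr; rewrite term_ofK. Qed.

Lemma term_ofD n p (x y : presented R n p) :
  E (term_of (x + y)) (tadd (term_of x) (term_of y)).
Proof. by apply: of_term_congr; rewrite of_termE !term_ofK. Qed.
Lemma term_ofZ n p a (x : presented R n p) :
  E (term_of (a *: x)) (tscale a (term_of x)).
Proof. by apply: of_term_congr; rewrite of_termE !term_ofK. Qed.
Lemma term_of_act n p (s : 'S_n) (x : presented R n p) :
  E (term_of (op_act s x)) (tact s (term_of x)).
Proof. by apply: of_term_congr; rewrite of_termE !term_ofK. Qed.
Lemma term_of_comp m n l (p q r : int) (hl : l = (m + n).-1%N) (hr : r = p + q) i
    (x : presented R m p) (y : presented R n q) :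
  E (term_of (op_comp hl hr i x y)) (tcomp hl hr i (term_of x) (term_of y)).
Proof. by apply: of_term_congr; rewrite of_termE !term_ofK. Qed.
End Congruence.

(** * Universal property of a presented operad *)

Section Universal.
Variables (Q : operad K) (h : forall g : X, Q (gen_ar g) (gen_deg g)).
Let L := op_ok Q.

Fixpoint op_eval n p (t : term K X n p) : Q n p :=
  match t with
  | tgen g => h g
  | tzero n p => 0
  | tadd n p t u => op_eval t + op_eval u
  | tscale n p a t => a *: op_eval t
  | tact n p s t => op_act s (op_eval t)
  | tid => op_id Q
  | tcomp m n l p q r hl hr i t u => op_comp hl hr i (op_eval t) (op_eval u)
  end.

Lemma op_eval_congr : operad_congr (fun n p t u => op_eval t = op_eval u :> Q n p).
Proof.
split=> /=.
- move=> n p; split=> //=; try by move=> *; rewrite ?(addrA, add0r, scalerA,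
    scale1r, scalerDr, scalerDl, scaleN1r, addNr).
  + by move=> x y w -> ->.
  + by move=> x x' y y' -> ->.
  + by move=> a x x' ->.
  + by move=> x y; rewrite addrC.
- by move=> n p s x x' ->.
- by move=> > -> ->.
split=> * /=.
- exact: (ol_actD L).
- exact: (ol_actZ L).
- exact: (ol_compDl L).
- exact: (ol_compZl L).
- exact: (ol_compDr L).
- exact: (ol_compZr L).
- exact: (ol_act1 L).
- exact: (ol_actM L).
- exact: (ol_id_comp L).
- exact: (ol_comp_id L).
- exact: (ol_seq L).
- exact: (ol_par L).
- exact: (ol_equiv L).
Qed.

Hypothesis HR : forall n p (y : free_operad K X n p), R y -> op_eval (trepr y) = 0.

Definition presented_lift n p (x : presented R n p) : Q n p := op_eval (term_of x).

Lemma presented_liftP n p (t : term K X n p) :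
  presented_lift (of_term t) = op_eval t.
Proof. exact: (term_of_congr op_eval_congr HR). Qed.

Lemma presented_lift_linear n p : linear (@presented_lift n p).
Proof.
move=> a x y; rewrite -(term_ofK x) -(term_ofK y) -of_termZ -of_termD.
by rewrite !presented_liftP.
Qed.
Lemma presented_lift_act n p s (x : presented R n p) :
  presented_lift (op_act s x) = op_act s (presented_lift x).
Proof. by rewrite -(term_ofK x) -of_term_act !presented_liftP. Qed.
Lemma presented_lift_comp m n l (p q r : int) (hl : l = (m + n).-1%N) (hr : r = p + q) i
    (x : presented R m p) (y : presented R n q) :
  presented_lift (op_comp hl hr i x y) =
  op_comp hl hr i (presented_lift x) (presented_lift y).
Proof.
by rewrite -(term_ofK x) -(term_ofK y) -of_term_comp !presented_liftP.
Qed.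
Lemma presented_lift_id : presented_lift (op_id _) = op_id Q.
Proof. by rewrite -of_term_id presented_liftP. Qed.
Lemma presented_lift_gen g : presented_lift (pgen g) = h g.
Proof. exact: presented_liftP. Qed.
End Universal.

End PresentedOperads.

(** * Block permutations *)

Section NatPermutations.
Local Open Scope nat_scope.

(** Extending by the identity lets permutations of different arities act on flags and arguments
    indexed by [nat], without casts between ordinals. *)
Definition nperm n (s : 'S_n) (j : nat) : nat :=
  if insub j is Some i then nat_of_ord (s i) else j.

Lemma npermE n (s : 'S_n) (i : 'I_n) : nperm s i = s i.
Proof. by rewrite /nperm valK. Qed.
Lemma nperm_ord n (s : 'S_n) j (jn : j < n) : nperm s j = s (Ordinal jn).
Proof. by rewrite -npermE. Qed.
Lemma nperm_lt n (s : 'S_n) j : j < n -> nperm s j < n.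
Proof. by move=> jn; rewrite -[j]/(nat_of_ord (Ordinal jn)) npermE. Qed.
Lemma nperm_inj n (s : 'S_n) j k : j < n -> k < n -> nperm s j = nperm s k -> j = k.
Proof.
move=> jn kn; rewrite -[j]/(nat_of_ord (Ordinal jn)) -[k]/(nat_of_ord (Ordinal kn)).
by rewrite !npermE => /val_inj/perm_inj->.
Qed.
Lemma npermM n (s t : 'S_n) j : nperm (s * t)%g j = nperm t (nperm s j).
Proof.
rewrite /nperm; case: insubP => [i _ _|/negPf jn]; first by rewrite valK permM.
by rewrite insubF.
Qed.
Lemma nperm1 n j : nperm (1%g : 'S_n) j = j.
Proof. by rewrite /nperm; case: insubP => // i _ <-; rewrite perm1. Qed.

Lemma perm_of_nat n (f : nat -> nat) :
  (forall j, j < n -> f j < n) ->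
  (forall j k, j < n -> k < n -> f j = f k -> j = k) ->
  exists s : 'S_n, forall j : 'I_n, s j = f j :> nat.
Proof.
move=> fn finj.
have ginj : injective (fun j : 'I_n => Ordinal (fn j (ltn_ord j))).
  by move=> j k [] /finj - /(_ (ltn_ord j) (ltn_ord k))/val_inj.
by exists (perm ginj) => j; rewrite permE.
Qed.

Lemma outer_or_block m n i v : i < m -> v < (m + n).-1 ->
  (exists2 j, (j < m) && (j != i) & v = outer i n j) \/
  (exists2 k, k < n & v = i + k).
Proof.
move=> im vl; case: (ltnP v i) => vi.
  by left; exists v; rewrite /outer ?vi //; lia.
case: (ltnP v (i + n)) => vin; first by right; exists (v - i); lia.
by left; exists (v - n).+1; rewrite /outer; [|case: ifP]; lia.
Qed.

(** The axiom [ol_equiv] takes the block permutation [u] as given, described by its values. Its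
    existence is needed to pull permutations out of composites. *)
Lemma block_perm m n l (hl : l = (m + n).-1) (i : 'I_m) (s : 'S_m) (t : 'S_n) :
  exists u : 'S_l,
    (forall (j : 'I_m) (v : 'I_l), j != i -> v = outer i n j :> nat ->
       u v = outer (s i) n (s j) :> nat) /\
    (forall (k : 'I_n) (v : 'I_l), v = i + k :> nat -> u v = s i + t k :> nat).
Proof.
have im := ltn_ord i.
(* Before, inside and after the block of the inner operation; past the block, [(v - n).+1] inverts
   [outer]. *)
pose f v := if v < i then outer (nperm s i) n (nperm s v) else
  if v < i + n then nperm s i + nperm t (v - i) else
  outer (nperm s i) n (nperm s (v - n).+1).
have sim := nperm_lt s im.
have sne v : v < m -> v != i -> nperm s v != nperm s i.
  by move=> vm; apply: contra_neq => /nperm_inj; apply.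
have fout j : j < m -> j != i -> f (outer i n j) = outer (nperm s i) n (nperm s j).
  move=> jm ji; case: (ltnP j i) => ji'.
    by rewrite (_ : outer i n j = j) /f /outer ?ji'.
  have -> : outer i n j = (j + n).-1 by rewrite /outer ifF; lia.
  rewrite /f ifF; last by lia.
  by rewrite ifF; [congr outer; congr nperm|]; lia.
have fblk k : k < n -> f (i + k) = nperm s i + nperm t k.
  by move=> kn; rewrite /f ifF ?ifT; [congr (_ + nperm t _)| |]; lia.
have outer_lt j : j < m -> j != nperm s i -> outer (nperm s i) n j < l.
  by rewrite /outer; case: ifP; lia.
have [u uE] : exists u : 'S_l, forall v : 'I_l, u v = f v :> nat.
  apply: perm_of_nat => [v vl|v w vl wl].
    have: v < (m + n).-1 by rewrite -hl.
    case/(outer_or_block im) => [[j /andP[jm ji] ->]|[k kn ->]].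
      by rewrite fout //; apply: outer_lt; rewrite ?nperm_lt ?sne.
    by rewrite fblk // hl; have := nperm_lt t kn; lia.
  have: v < (m + n).-1 by rewrite -hl.
  have: w < (m + n).-1 by rewrite -hl.
  case/(outer_or_block im) => [[j /andP[jm ji] ->]|[k kn ->]];
  case/(outer_or_block im) => [[j' /andP[jm' ji'] ->]|[k' kn' ->]];
  rewrite ?fout ?fblk //.
  + move=> e; congr outer; apply: (@nperm_inj _ s) => //.
    have := sne _ jm ji; have := sne _ jm' ji'; move: e.
    by rewrite /outer; do 2 case: ifP; lia.
  + move=> e; have := sne _ jm ji; have := nperm_lt t kn'; move: e.
    by rewrite /outer; case: ifP; lia.
  + move=> e; have := sne _ jm' ji'; have := nperm_lt t kn; move: e.
    by rewrite /outer; case: ifP; lia.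
  + by move=> /addnI/nperm_inj ->.
exists u; split=> [j v ji ve|k v ve].
  by rewrite uE ve fout ?npermE.
by rewrite uE ve fblk ?npermE.
Qed.

End NatPermutations.

(** * Permutations pulled out of composites *)

Section Operads.
Variables (K : fieldType) (P : operad K).
Let L := op_ok P.

Lemma op_act_sum n p (s : 'S_n) (I : Type) (r : seq I) (Q : pred I) (F : I -> P n p) :
  op_act s (\sum_(i <- r | Q i) F i) = \sum_(i <- r | Q i) op_act s (F i).
Proof.
by apply: (big_morph (op_act s)) => [x y|]; [apply: (ol_actD L)|apply: op_act0].
Qed.
Lemma op_comp_sumr m n l (p q r : int) (hl : l = (m + n).-1%N) (hr : r = p + q) i
    (x : P m p) (I : Type) (w : seq I) (Q : pred I) (F : I -> P n q) :
  op_comp hl hr i x (\sum_(j <- w | Q j) F j) =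
  \sum_(j <- w | Q j) op_comp hl hr i x (F j).
Proof.
apply: (big_morph (op_comp hl hr i x)) => [y y'|]; first exact: (ol_compDr L).
exact: op_comp0r.
Qed.

Lemma op_actK n p (s : 'S_n) (x : P n p) : op_act s (op_act s^-1%g x) = x.
Proof. by rewrite -(ol_actM L) mulVg (ol_act1 L). Qed.
Lemma op_actKV n p (s : 'S_n) (x : P n p) : op_act s^-1%g (op_act s x) = x.
Proof. by rewrite -(ol_actM L) mulgV (ol_act1 L). Qed.

Lemma op_comp_irr m n l (p q r : int) (hl hl' : l = (m + n).-1%N) (hr hr' : r = p + q)
    (i i' : 'I_m) (x : P m p) (y : P n q) : i = i' :> nat ->
  op_comp hl hr i x y = op_comp hl' hr' i' x y.
Proof.
by move=> /val_inj->; rewrite (eq_irrelevance hl hl') (eq_irrelevance hr hr').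
Qed.

Lemma op_comp_act m n l (p q r : int) (hl : l = (m + n).-1%N) (hr : r = p + q)
    (i : 'I_m) (s : 'S_m) (t : 'S_n) (x : P m p) (y : P n q) :
  exists u : 'S_l,
    [/\ forall (j : 'I_m) (v : 'I_l), j != i -> v = outer i n j :> nat ->
          u v = outer (s i) n (s j) :> nat,
        forall (k : 'I_n) (v : 'I_l), v = (i + k)%N :> nat -> u v = (s i + t k)%N :> nat
      & op_comp hl hr (s i) (op_act s x) (op_act t y) =
        op_act u (op_comp hl hr i x y)].
Proof.
have [u [u1 u2]] := block_perm hl i s t.
by exists u; split=> //; apply: (ol_equiv L).
Qed.

Lemma op_comp_actl m n l (p q r : int) (hl : l = (m + n).-1%N) (hr : r = p + q)
    (i i' : 'I_m) (s : 'S_m) (x : P m p) (y : P n q) : i = s i' ->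
  exists u : 'S_l,
    [/\ forall (j : 'I_m) (v : 'I_l), j != i' -> v = outer i' n j :> nat ->
          u v = outer i n (s j) :> nat,
        forall (k : 'I_n) (v : 'I_l), v = (i' + k)%N :> nat -> u v = (i + k)%N :> nat
      & op_comp hl hr i (op_act s x) y = op_act u (op_comp hl hr i' x y)].
Proof.
move=> ->; have [u [u1 u2 u3]] := op_comp_act hl hr i' s 1%g x y.
exists u; split=> // [k v /u2->|]; first by rewrite perm1.
by rewrite -u3 (ol_act1 L).
Qed.

Lemma op_comp_actr m n l (p q r : int) (hl : l = (m + n).-1%N) (hr : r = p + q)
    (i : 'I_m) (t : 'S_n) (x : P m p) (y : P n q) :
  exists u : 'S_l,
    [/\ forall (j : 'I_m) (v : 'I_l), j != i -> v = outer i n j :> nat -> u v = v,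
        forall (k : 'I_n) (v : 'I_l), v = (i + k)%N :> nat -> u v = (i + t k)%N :> nat
      & op_comp hl hr i x (op_act t y) = op_act u (op_comp hl hr i x y)].
Proof.
have [u [u1 u2 u3]] := op_comp_act hl hr i 1%g t x y.
exists u; split=> [j v ji vE|k v /u2->|]; last by rewrite -u3 (ol_act1 L) perm1.
  by apply: val_inj; rewrite /= (u1 _ _ ji vE) !perm1 vE.
by rewrite perm1.
Qed.
End Operads.

(** * Right-normed monomials *)

(* Booleans index the two brackets: [true] is the one of degree 1. *)
Definition dg (g : bool) : int := Posz (nat_of_bool g).

Definition fixlast n (s : 'S_n) : bool :=
  [forall j : 'I_n, (j.+1 == n) ==> (s j == j)].

Lemma fixlastP n (s : 'S_n) :
  reflect (forall j : 'I_n, j.+1 = n -> s j = j) (fixlast s).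
Proof.
apply: (iffP forallP) => H j; first by move/eqP => jn; apply/eqP/(implyP (H j)).
by apply/implyP => /eqP/H->.
Qed.

Section RightNormed.
Variables (K : fieldType) (P : operad K).
Variables (G : forall g : bool, P 2%N (dg g)) (B : P 1%N 1).
Let L := op_ok P.

(* [rspan trk fx e x]: x is in the span of the permuted right-normed monomials in
   G, possibly ending in B.  With [trk] these monomials have set of derived inputs
   exactly e; with [fx] their last input is the last one, and is not derived.  B is
   d in the operad O, and 0 in Lie and LL. *)
Inductive rspan (trk fx : bool) : forall n p, (nat -> bool) -> P n p -> Prop :=
| RS_id (e : nat -> bool) : (trk -> e 0%N = false) -> rspan trk fx e (op_id P)
| RS_B (e : nat -> bool) : ~~ fx -> (trk -> e 0%N) -> rspan trk fx e B
| RS_comp n l (q r : int) g (hl : l = (2 + n).-1%N) (hr : r = dg g + q)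
    (e e0 : nat -> bool) (y : P n q) :
    (trk -> e 0%N = g) -> (forall j, (j < n)%N -> e j.+1 = e0 j) ->
    rspan trk fx e0 y -> rspan trk fx e (op_comp hl hr ord_max (G g) y)
| RS_act n p (s : 'S_n) (e e0 : nat -> bool) (x : P n p) :
    (fx -> fixlast s) -> (forall j : 'I_n, e (s j) = e0 j) ->
    rspan trk fx e0 x -> rspan trk fx e (op_act s x)
| RS_0 n p e : rspan trk fx e (0 : P n p)
| RS_add n p e (x y : P n p) :
    rspan trk fx e x -> rspan trk fx e y -> rspan trk fx e (x + y)
| RS_scale n p e a (x : P n p) : rspan trk fx e x -> rspan trk fx e (a *: x).

Lemma rspan_ext trk fx n p e e' (x : P n p) :
  (forall j, (j < n)%N -> e' j = e j) -> rspan trk fx e x -> rspan trk fx e' x.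
Proof.
move=> ee' Hx; elim: Hx e' ee' => {n p e x}.
- by move=> e e0 e' ee'; apply: RS_id => /e0; rewrite ee'.
- by move=> e fx0 e0 e' ee'; apply: RS_B => // /e0; rewrite ee'.
- move=> n l q r g hl hr e e0 y eg ee0 _ IH e' ee'.
  apply: (@RS_comp _ _ _ _ _ _ _ _ _ _ e0).
  + by rewrite ee' ?hl.
  + by move=> j jn; rewrite ee' ?ee0 // hl.
  + exact: IH.
- move=> n p s e e0 x fs ee0 _ IH e' ee'.
  by apply: (RS_act fs _ (IH _ _)) => [j|j jn //]; rewrite ee'.
- by move=> *; apply: RS_0.
- by move=> n p e x y _ IHx _ IHy e' ee'; apply: RS_add; [apply: IHx|apply: IHy].
- by move=> n p e a x _ IHx e' ee'; apply/RS_scale/IHx.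
Qed.

Lemma rspan_untracked fx n p e e' (x : P n p) :
  rspan false fx e x -> rspan false fx e' x.
Proof.
move=> Hx; elim: Hx e' => {n p e x}.
- by move=> *; apply: RS_id.
- by move=> *; apply: RS_B.
- move=> n l q r g hl hr e e0 y eg ee0 _ IH e'.
  by apply: (@RS_comp _ _ _ _ _ _ _ _ _ _ (fun j => e' j.+1)).
- move=> n p s e e0 x fs ee0 _ IH e'.
  apply: (@RS_act _ _ _ _ _ _ (fun j => e' (nperm s j)) _ fs).
    by move=> j; rewrite npermE.
  exact: IH.
- by move=> *; apply: RS_0.
- by move=> n p e x y _ IHx _ IHy e'; apply: RS_add.
- by move=> n p e a x _ IHx e'; apply/RS_scale/IHx.
Qed.

(** Disposes of arity 0, where there is no last input to compose at. *)
Lemma rspan_arity0 trk fx n p e (x : P n p) : rspan trk fx e x -> n = 0%N -> x = 0.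
Proof.
elim=> {n p e x} //.
- by move=> n l q r g hl *; lia.
- by move=> n p s e e0 x _ _ _ IH n0; rewrite IH // op_act0.
- by move=> n p e x y _ IHx _ IHy n0; rewrite IHx // IHy // addr0.
- by move=> n p e a x _ IHx n0; rewrite IHx // scaler0.
Qed.

(** The arities and degrees of the two sides agree only propositionally; a predicate [Q] over all of
    them avoids a transport. *)
Lemma op_comp_idr n l (p r : int) (hl : l = (n + 1).-1%N) (hr : r = p + 0) i (x : P n p)
    (Q : forall l r, P l r -> Prop) :
  Q n p x -> Q l r (op_comp hl hr i x (op_id P)).
Proof.
have el : l = n by rewrite hl addn1.
have er : r = p by rewrite hr addr0.
by move: hl hr; rewrite el er => hl hr; rewrite (ol_comp_id L).
Qed.

Lemma op_comp_idl n l (p r : int) (hl : l = (1 + n).-1%N) (hr : r = 0 + p) i (x : P n p)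
    (Q : forall l r, P l r -> Prop) :
  Q n p x -> Q l r (op_comp hl hr i (op_id P) x).
Proof.
have el : l = n by rewrite hl.
have er : r = p by rewrite hr add0r.
by move: hl hr; rewrite el er => hl hr; rewrite (ol_id_comp L).
Qed.

Lemma rspan_G (trk fx g : bool) (e : nat -> bool) :
  (trk -> e 0%N = g) -> (trk -> e 1%N = false) -> rspan trk fx e (G g).
Proof.
move=> e0 e1.
have -> : G g = op_comp (erefl : 2%N = (2 + 1).-1%N) (esym (addr0 (dg g))) ord_max
  (G g) (op_id P) by rewrite (ol_comp_id L).
by apply: (RS_comp _ _ e0 (fun j _ => erefl _)); apply: RS_id.
Qed.

Lemma op_par a b c ab ac abc (p q r pq pr pqr : int)
      (h1 : ab = (a + b).-1%N) (d1 : pq = p + q)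
      (h2 : abc = (ab + c).-1%N) (d2 : pqr = pq + r)
      (h3 : ac = (a + c).-1%N) (d3 : pr = p + r)
      (h4 : abc = (ac + b).-1%N) (d4 : pqr = pr + q)
      (i k : 'I_a) (k' : 'I_ab) (i' : 'I_ac) (x : P a p) (y : P b q) (z : P c r) :
    (i < k)%N -> k' = (k + b).-1 :> nat -> i' = i :> nat ->
  op_comp h4 d4 i' (op_comp h3 d3 k x z) y =
  koszul K q r *: op_comp h2 d2 k' (op_comp h1 d1 i x y) z.
Proof.
move=> ik ek ei; rewrite (ol_par L h1 d1 h2 d2 h3 d3 h4 d4 _ _ _ ik ek ei).
by rewrite scalerA /koszul -exprMn mulrNN mulr1 expr1n scale1r.
Qed.

(** Plugging y into the innermost place of {a_1,{a_2,...}} leaves the word right-normed, by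
    sequential associativity. If [fx] is asked of the result, y must have an input, since its last
    input becomes the last one of the composite. *)
Lemma rspan_comp_last trk m p e (x : P m p) : rspan trk true e x ->
  forall n (q : int) fx e2 (y : P n q), rspan trk fx e2 y -> (fx -> (0 < n)%N) ->
  forall l (r : int) (hl : l = (m + n).-1%N) (hr : r = p + q) (i : 'I_m) e', i.+1 = m ->
  (forall j, (j < m.-1)%N -> e' j = e j) ->
  (forall k, (k < n)%N -> e' (m.-1 + k)%N = e2 k) ->
  rspan trk fx e' (op_comp hl hr i x y).
Proof.
move En: {1}true => fx1 Hx; elim: Hx En => {m p e x}.
- move=> e e0 _ n q fx e2 y Hy fxn l r hl hr i e' im e'1 e'2.
  apply: (@op_comp_idl _ _ _ _ _ _ _ _ (fun l r z => rspan trk fx e' z)).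
  apply: rspan_ext Hy => j jn; exact: e'2.
- by move=> e nfx _ En; move: nfx; rewrite -En.
- move=> m' m p0 p g hm hp e e0 x eg ee0 Hx IH En n q fx e2 y Hy fxn.
  move=> l r hl hr i e' im e'1 e'2.
  case: (posnP m') => m'0.
    by rewrite (rspan_arity0 Hx m'0) op_comp0r op_comp0l; apply: RS_0.
  have im' : (m'.-1 < m')%N by lia.
  have h2 : l = (2 + (m' + n).-1).-1%N by lia.
  have d2 : r = dg g + (p0 + q) by rewrite hr hp addrA.
  rewrite -(@ol_seq _ _ _ _ _ _ _ _ L _ _ _ _ (m' + n).-1 _ _ _ _ _ (p0 + q) _
    erefl erefl h2 d2 hm hp hl hr ord_max (Ordinal im') i); last by rewrite /=; lia.
  apply: (@RS_comp _ _ _ _ _ _ _ _ _ _ (fun j => e' j.+1)) => //.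
    by move=> t; rewrite -(eg t); apply: e'1; lia.
  apply: (IH En _ _ _ _ _ Hy fxn).
  + by rewrite /=; lia.
  + by move=> j jm; rewrite e'1 ?ee0 //; lia.
  + by move=> k kn; rewrite -e'2 //; congr e'; lia.
- move=> m p s e e0 x fs ee0 _ IH En n q fx e2 y Hy fxn l r hl hr i e' im e'1 e'2.
  have si : s i = i by apply/fixlastP: im; apply: fs; rewrite -En.
  have [u [u1 u2 ->]] := op_comp_actl hl hr x y (esym si).
  have ui v : (i + v < l)%N -> (v < n)%N -> nperm u (i + v) = (i + v)%N.
    by move=> il vn; rewrite -[X in nperm u X]/(nat_of_ord (Ordinal il)) npermE (u2 (Ordinal vn)).
  apply: (@RS_act _ _ _ _ _ _ (fun j => e' (nperm u j))).
  + move=> fx1'; apply/fixlastP => v vl; apply: val_inj; rewrite -[LHS]npermE /=.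
    have n0 := fxn fx1'.
    have -> : nat_of_ord v = (i + n.-1)%N by clear -hl im vl n0; lia.
    by rewrite ui //; clear -hl im vl n0; lia.
  + by move=> j; rewrite npermE.
  apply: (IH En _ _ _ _ _ Hy fxn) => //.
  + move=> j jm; have jl : (j < l)%N by lia.
    have jm' : (j < m)%N by lia.
    rewrite -[X in nperm u X]/(nat_of_ord (Ordinal jl)) npermE.
    rewrite (u1 (Ordinal jm')); first 1 last.
    * by rewrite -val_eqE /=; lia.
    * by rewrite /outer /= ifT //; lia.
    have sj : s (Ordinal jm') != i by rewrite -si (inj_eq perm_inj) -val_eqE /=; lia.
    have {}sj : (s (Ordinal jm') < i)%N.
      by have := ltn_ord (s (Ordinal jm')); move: sj; rewrite -val_eqE /=; lia.
    by rewrite /outer sj e'1 ?ee0 //; lia.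
  + move=> k kn; have -> : m.-1 = i by lia.
    by rewrite ui -?e'2 //; [congr e'|]; lia.
- by move=> *; rewrite op_comp0l; apply: RS_0.
- move=> m p e x x' _ IH _ IH' En n q fx e2 y Hy fxn l r hl hr i e' im e'1 e'2.
  by rewrite (ol_compDl L); apply: RS_add; [apply: (IH En)|apply: (IH' En)]; eassumption.
- move=> m p e a x _ IH En n q fx e2 y Hy fxn l r hl hr i e' im e'1 e'2.
  by rewrite (ol_compZl L); apply: RS_scale; apply: (IH En); eassumption.
Qed.

(* [e0] and [e1] tell whether inputs 0 and 1 are derived; input 2 never is. *)
Inductive normal3 (trk e0 e1 : bool) : forall p, P 3%N p -> Prop :=
| N3_comp h h' (p : int) (hr : p = dg h + dg h') : (trk -> e0 = h) -> (trk -> e1 = h') ->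
    normal3 trk e0 e1 (comp2 hr (G h) (G h'))
| N3_swap h h' (p : int) (hr : p = dg h + dg h') : (trk -> e0 = h') -> (trk -> e1 = h) ->
    normal3 trk e0 e1 (swap12 (comp2 hr (G h) (G h')))
| N3_add p (x y : P 3%N p) :
    normal3 trk e0 e1 x -> normal3 trk e0 e1 y -> normal3 trk e0 e1 (x + y)
| N3_scale p a (x : P 3%N p) :
    normal3 trk e0 e1 x -> normal3 trk e0 e1 (a *: x).

(** The quadratic relations enter here: a left-nested composite becomes right-normed. With tracking
    the outer bracket must be [(,)], because [[,]] applied to a compound spreads the derivation over
    different inputs. *)
Hypothesis comp1_normal3 : forall (trk : bool) g g' (p : int) (hr : p = dg g + dg g'),
  (trk -> g = false) -> normal3 trk g' false (comp1 hr (G g) (G g')).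
(** In O this says that d in the left slot of the product is the odd bracket; where [B] is 0 the
    constant is 0. *)
Hypothesis comp_GB : exists c : K,
  forall (hl : 2%N = (2 + 1).-1%N) (hr : 1 = 0 + 1),
  op_comp hl hr ord0 (G false) B = c *: G true.
Hypothesis comp_GB0 : forall (r : int) (hl : 2%N = (2 + 1).-1%N) (hr : r = 1 + 1),
  op_comp hl hr ord0 (G true) B = 0.

(* Multiplying by a right-normed monomial on the left is a combination of iterated
   left multiplications by single inputs. *)
Lemma rspan_comp0 (trk : bool) n q e (y : P n q) : rspan trk false e y ->
  forall g, (trk -> g = false) ->
  forall l (r : int) (hl : l = (2 + n).-1%N) (hr : r = dg g + q) e',
  (forall j, (j < n)%N -> e' j = e j) -> (trk -> e' n = false) ->
  rspan trk true e' (op_comp hl hr ord0 (G g) y).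
Proof.
move En: {1}false => fx1 Hy; elim: Hy En => {n q e y}.
- move=> e e0 _ g tg l r hl hr e' e'0 e'1.
  apply: (@op_comp_idr _ _ _ _ _ _ _ _ (fun l r z => rspan trk true e' z)).
  apply: rspan_G => // t.
  by rewrite e'0 // e0 ?tg.
- move=> e _ e0 _ g tg l r hl hr e' e'0 e'1.
  have el : l = 2%N := hl.
  subst l; case: g tg hr => tg hr.
    by rewrite comp_GB0; apply: RS_0.
  have er : r = 1 by rewrite hr.
  move: hr; rewrite er => hr; have [c ->] := comp_GB; apply: RS_scale.
  by apply: (@rspan_G _ _ true) => // t; rewrite e'0 ?e0.
- move=> n' n q0 q g' hn hq e e0 y eg ee0 Hy IH En g tg l r hl hr e' e'0 e'1.
  have i1 : (1 < 3)%N by [].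
  have h4 : l = (3 + n').-1%N by clear -hl hn; lia.
  have d4 : r = (dg g + dg g') + q0 by rewrite hr hq addrA.
  rewrite (@ol_seq _ _ _ _ _ _ _ _ L _ _ _ 3%N _ _ _ _ _ (dg g + dg g') _ _
    hn hq hl hr erefl erefl h4 d4 ord0 ord_max (Ordinal i1)) //.
  have := comp1_normal3 (erefl (dg g + dg g')) tg; rewrite /comp1.
  move: (op_comp _ _ _ (G g) (G g')) h4 d4 => z h4 d4 Hz {hr}.
  move: (dg g + dg g') z d4 Hz; move=> p z d4; move E1 : {1}false => e1 Hz.
  move E0 : g' Hz => e00 Hz; subst e00.
  elim: Hz E1 d4 => {p z}.
  (* Here {{a,y},b} has become {a,{y,b}}, and induction applies to {y,b}. *)
  + move=> h h' p hp th th' E1 d4; rewrite /comp2.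
    have d2 : r = dg h + (dg h' + q0) by rewrite d4 hp addrA.
    have h2 : l = (2 + n'.+1).-1%N by clear -hl hn; lia.
    rewrite -(@ol_seq _ _ _ _ _ _ _ _ L _ 2%N n' 3%N n'.+1 _ _ _ _ _ (dg h' + q0) _
      erefl erefl h2 d2 erefl hp h4 d4 ord_max ord0) //.
    apply: (@RS_comp _ _ _ _ _ _ _ _ _ _ (fun j => e' j.+1)) => //.
      by move=> t; rewrite -th // e'0 ?hn // eg.
    apply: (IH En).
    * by move=> t; rewrite -th'.
    * by move=> j jn; rewrite e'0 ?ee0 // hn.
    * by move=> t; rewrite -(e'1 t) hn.
  (* The swapped term is {y,{a,b}}. The permutation [u] puts a behind the block of y; then [op_par]
     reads the term as {y,-}, right-normed by induction, with {a,b} plugged into its last input. *)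
  + move=> h h' p hp th th' E1 d4; rewrite /swap12 /comp2.
    set tau12 := tperm _ _.
    have tau0 : Ordinal i1 = tau12 ord0 by apply: val_inj; rewrite tpermL.
    have [u [u1 u2 ->]] := op_comp_actl h4 d4
      (op_comp (erefl : 3%N = (2 + 2).-1%N) hp ord_max (G h) (G h')) y tau0.
    have v0 : (0 < l)%N by clear -hl; lia.
    have vn : (n' < l)%N by clear -hl hn; lia.
    have vl : (n'.+1 < l)%N by clear -hl hn; lia.
    have u1n : u (Ordinal vn) = Ordinal v0.
      apply: val_inj => /=; rewrite (u1 (inord 1)) /=; first 1 last.
      - by rewrite -val_eqE /= inordK.
      - by rewrite inordK.
      rewrite (_ : inord 1 = lift ord0 ord0) ?tpermR //.
      by apply: val_inj; rewrite /= inordK.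
    have u1l : u (Ordinal vl) = Ordinal vl.
      apply: val_inj => /=; rewrite (u1 (inord 2)) /=; first 1 last.
      - by rewrite -val_eqE /= inordK.
      - by rewrite inordK.
      by rewrite tpermD -?val_eqE /= inordK.
    have u2k k (kn : (k < n')%N) (kl : (k < l)%N) : u (Ordinal kl) = k.+1 :> nat.
      by rewrite (u2 (Ordinal kn)).
    pose e3 j := e' (nperm u j).
    have e3n : e3 n' = e' 0%N.
      by rewrite /e3 -[X in nperm u X]/(nat_of_ord (Ordinal vn)) npermE u1n.
    have e3l : e3 n'.+1 = e' n.
      by rewrite /e3 -[X in nperm u X]/(nat_of_ord (Ordinal vl)) npermE u1l /= hn.
    have e3k k : (k < n')%N -> e3 k = e0 k.
      move=> kn; have kl : (k < l)%N by clear -kn vn; lia.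
      rewrite /e3 -[X in nperm u X]/(nat_of_ord (Ordinal kl)) npermE u2k //.
      by rewrite e'0 ?ee0 // hn.
    apply: (@RS_act _ _ _ _ _ _ e3); first 1 last.
    * by move=> j; rewrite /e3 npermE.
    * have k1 : (n' < n'.+1)%N by [].
      have d1 : r = (dg h + q0) + dg h' by rewrite d4 hp addrAC.
      have h1 : l = (n'.+1 + 2).-1%N by clear -hl hn; lia.
      rewrite (@op_par 2%N n' 2%N n'.+1 3%N _ _ _ _ (dg h + q0) _ _
        erefl erefl h1 d1 erefl hp h4 d4 ord0 ord_max (Ordinal k1) ord0) //.
      apply: RS_scale; apply: (@rspan_comp_last _ _ _
          (fun j => if (j < n')%N then e3 j else false) _ _ _ _ _ 
          (fun j => e3 (n' + j)%N)) => //.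
      - apply: (IH En).
        + by move=> t; rewrite -th'.
        + by move=> j jn; rewrite jn e3k.
        + by rewrite ltnn.
      - apply: rspan_G => t.
        + by rewrite addn0 e3n -th // e'0 ?hn // eg.
        + by rewrite addn1 e3l e'1.
      - by move=> j jn; rewrite jn.
    * move=> _; apply/fixlastP => j jl.
      rewrite (_ : j = Ordinal vl) //; apply: val_inj => /=.
      by clear -jl hl hn; lia.
  + move=> p x x' _ IHx _ IHx' E1 d4; rewrite (ol_compDl L).
    by apply: RS_add; [apply: IHx|apply: IHx'].
  + move=> p a x _ IHx E1 d4; rewrite (ol_compZl L).
    by apply: RS_scale; apply: IHx.
- move=> n p s e e0 x _ ee0 Hx IH En g tg l r hl hr e' e'0 e'1.
  have [u [u1 u2 ->]] := op_comp_actr hl hr ord0 s (G g) x.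
  have nl : (n < l)%N by clear -hl; lia.
  have un : u (Ordinal nl) = Ordinal nl by apply: (u1 ord_max).
  apply: (@RS_act _ _ _ _ _ _ (fun j => e' (nperm u j))); first 1 last.
  + by move=> j; rewrite npermE.
  + apply: (IH En) => // [j jn|t].
      have jl : (j < l)%N by clear -jn nl; lia.
      rewrite -[X in nperm u X]/(nat_of_ord (Ordinal jl)) npermE.
      by rewrite (u2 (Ordinal jn)) //= add0n e'0 // ee0.
    by rewrite -[X in nperm u X]/(nat_of_ord (Ordinal nl)) npermE un e'1.
  + move=> _; apply/fixlastP => j jl.
    rewrite (_ : j = Ordinal nl) //; apply: val_inj => /=.
    by clear -jl hl; lia.
- by move=> *; rewrite op_comp0r; apply: RS_0.
- move=> n q e x x' _ IH _ IH' En g tg l r hl hr e' e'1 e'2.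
  by rewrite (ol_compDr L); apply: RS_add; [apply: (IH En)|apply: (IH' En)].
- move=> n q e a x _ IH En g tg l r hl hr e' e'1 e'2.
  by rewrite (ol_compZr L); apply: RS_scale; apply: (IH En).
Qed.

Hypothesis comp_B : forall n q e (y : P n q), rspan false false e y ->
  forall l (r : int) (hl : l = (1 + n).-1%N) (hr : r = 1 + q) i,
  rspan false false e (op_comp hl hr i B y).

(** For x = {a,x'}, composing at an input of x' is the induction step. Composing at a gives {y,x'},
    that is {y,-}, normalised by [rspan_comp0], with x' plugged into its last input. *)
Lemma rspan_comp m p e1 (x : P m p) : rspan false false e1 x ->
  forall n (q : int) e2 (y : P n q), rspan false false e2 y ->
  forall l (r : int) (hl : l = (m + n).-1%N) (hr : r = p + q) i e,
  rspan false false e (op_comp hl hr i x y).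
Proof.
move Efx : {2}false => fx Hx; elim: Hx Efx => {m p e1 x}.
- move=> e1 _ Efx n q e2 y Hy l r hl hr i e.
  apply: (@op_comp_idl _ _ _ _ _ _ _ _ (fun l r z => rspan false false e z)).
  exact: rspan_untracked Hy.
- move=> e1 _ _ Efx n q e2 y Hy l r hl hr i e.
  apply: comp_B; exact: rspan_untracked Hy.
- move=> m' m p0 p g hm hp e1 e0 x _ _ Hx IH Efx n q e2 y Hy l r hl hr i e.
  case: (posnP i) => i0.
    have d1 : dg g + q = dg g + q by [].
    have h2 : l = (n.+1 + m').-1%N by clear -hl hm; lia.
    have d2 : r = (dg g + q) + p0 by rewrite hr hp addrAC.
    rewrite (@op_par 2%N n m' n.+1 m _ _ _ _ _ _ _ erefl d1 h2 d2 hm hp hl hr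
      ord0 ord_max ord_max i) //.
    apply: RS_scale; apply: (@rspan_comp_last _ _ _
      (fun j => if (j < n)%N then e j else false) _ _ _ _ _
      (fun j => e (n + j)%N)) => //.
    + by apply: (rspan_comp0 (rspan_untracked e Hy)) => // j jn; rewrite jn.
    + by have := Hx; rewrite -Efx; apply: rspan_untracked.
    + by move=> j jn; rewrite jn.
  have im' : (i.-1 < m')%N by have := ltn_ord i; clear -hm i0; lia.
  have h2 : l = (2 + (m' + n).-1).-1%N by clear -hl hm im'; lia.
  have d2 : r = dg g + (p0 + q) by rewrite hr hp addrA.
  rewrite -(@ol_seq _ _ _ _ _ _ _ _ L _ _ _ _ (m' + n).-1 _ _ _ _ _ (p0 + q) _
    erefl erefl h2 d2 hm hp hl hr ord_max (Ordinal im') i); last first.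
    by rewrite /=; clear -i0; lia.
  apply: (@RS_comp _ _ _ _ _ _ _ _ _ _ (fun j => e j.+1)) => //.
  exact: IH Hy _ _ _ _ _ _.
- move=> m p s e1 e0 x _ _ _ IH Efx n q e2 y Hy l r hl hr i e.
  have [|u [_ _ ->]] := @op_comp_actl _ _ _ _ _ _ _ _ hl hr i (s^-1%g i) s x y.
    by rewrite permKV.
  apply: (@RS_act _ _ _ _ _ _ (fun j => e (nperm u j))) => //.
    by move=> j; rewrite npermE.
  exact: IH Hy _ _ _ _ _ _.
- by move=> *; rewrite op_comp0l; apply: RS_0.
- move=> m p e1 x x' _ IHx _ IHx' Efx n q e2 y Hy l r hl hr i e.
  by rewrite (ol_compDl L); apply: RS_add; [apply: IHx Hy _ _ _ _ _ _|apply: IHx' Hy _ _ _ _ _ _].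
- move=> m p e1 a x _ IHx Efx n q e2 y Hy l r hl hr i e.
  by rewrite (ol_compZl L); apply: RS_scale; apply: IHx Hy _ _ _ _ _ _.
Qed.

Hypothesis G_sym : exists c : K, G false = c *: tau (G false).

(** In {a,y}, an underived a means that the bracket is [(,)]; symmetry up to a scalar gives (y,a),
    and [rspan_comp0] expands the left multiplication by y while keeping the set of derived inputs.
    An input inside y is moved by induction. *)
Lemma rspan_move_last n p e (x : P n p) : rspan true false e x ->
  forall (t : 'S_n) (e' : nat -> bool), (forall j : 'I_n, e' (t j) = e j) ->
  e' n.-1 = false ->
  rspan true true e' (op_act t x).
Proof.
move Efx : {1}false => fx Hx; elim: Hx Efx => {n p e x}.
- move=> e e0 _ t e' e't e'0.
  rewrite (_ : t = 1%g); last by apply/permP => j; rewrite !ord1.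
  by rewrite (ol_act1 L); apply: RS_id.
- move=> e _ /(_ isT) e0 _ t e' e't e'0.
  by move: (e't ord0) e0 => <-; rewrite ord1 e'0.
- move=> n l q r g hl hr e e0 y eg ee0 Hy IH Efx t e' e't e'l.
  have nl : (n < l)%N by clear -hl; lia.
  have zl : (0 < l)%N by clear -hl; lia.
  have e'n : e' n = false by rewrite -e'l hl.
  have tm : t (t^-1%g (Ordinal nl)) = Ordinal nl by rewrite permKV.
  (* The input that [t] sends to the last place is either the left argument of the outermost bracket
     or an input of [y]. *)
  case: (posnP (t^-1%g (Ordinal nl))) => m0.
    have t0 : t (Ordinal zl) = Ordinal nl.
      by rewrite -[RHS]tm; congr (t _); apply: val_inj; rewrite /= m0.
    have g0 : g = false.
      by rewrite -(eg isT) -[0%N]/(nat_of_ord (Ordinal zl)) -e't t0.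
    subst g; have [c ->] := G_sym; rewrite (ol_compZl L) (ol_actZ L).
    apply: RS_scale; rewrite /tau.
    have t21 : ord_max = tperm ord0 (@ord_max 1) ord0 by rewrite tpermL.
    have [u [u1 u2 ->]] := op_comp_actl hl hr (G false) y t21.
    have un : u (Ordinal nl) = Ordinal zl.
      by apply: val_inj; rewrite /= (u1 ord_max) //= tpermR.
    have uj j (jn : (j < n)%N) (jl : (j < l)%N) : u (Ordinal jl) = j.+1 :> nat.
      by rewrite (u2 (Ordinal jn)).
    rewrite -(ol_actM L).
    apply: (@RS_act _ _ _ _ _ _ (fun j => e' (nperm (u * t)%g j))); first 1 last.
    + by move=> j; rewrite npermE.
    + apply: (rspan_comp0 (e := e0)) => // [|j jn|_].
      * by have := Hy; rewrite -Efx.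
      * have jl : (j < l)%N by clear -jn nl; lia.
        rewrite nperm_ord permM e't uj // ee0 //.
      * by rewrite nperm_ord permM un t0.
    + move=> _; apply/fixlastP => j jl; rewrite permM.
      have -> : j = Ordinal nl by apply: val_inj; rewrite /=; clear -jl hl; lia.
      by rewrite un t0.
  set m := t^-1%g (Ordinal nl) in tm m0.
  have mn : (m.-1 < n)%N by have := ltn_ord m; clear -hl m0; lia.
  have ln : (n.-1 < n)%N by clear -mn; lia.
  (* The wanted input is first brought to the last place of [y]; the permutation that remains,
     [u * t], fixes the last place. *)
  pose t' := tperm (Ordinal mn) (Ordinal ln).
  have t'l : t'^-1%g (Ordinal ln) = Ordinal mn by rewrite tpermV tpermR.
  rewrite -(op_actKV t' y).
  have [u [u1 u2 ->]] := op_comp_actr hl hr ord_max t'^-1%g (G g) (op_act t' y).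
  have u0 : u (Ordinal zl) = Ordinal zl by apply: (u1 ord0).
  have uS (j : 'I_n) (jl : (j.+1 < l)%N) : u (Ordinal jl) = (t'^-1%g j).+1 :> nat.
    by rewrite (u2 j).
  have fl (j : 'I_l) : j.+1 = l -> (u * t)%g j = j.
    move=> jl; rewrite permM.
    have nl' : ((Ordinal ln).+1 < l)%N by rewrite /=; clear -nl ln; lia.
    have -> : j = Ordinal nl' by apply: val_inj => /=; clear -jl hl ln; lia.
    have -> : u (Ordinal nl') = m.
      by apply: val_inj; apply: (etrans (uS (Ordinal ln) nl')); rewrite t'l /= prednK.
    by rewrite tm; apply: val_inj => /=; rewrite prednK //; clear -ln; lia.
  rewrite -(ol_actM L).
  apply: (@RS_act _ _ _ _ _ _ (fun j => e' (nperm (u * t)%g j))); first 1 last.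
  + by move=> j; rewrite npermE.
  + apply: (@RS_comp _ _ _ _ _ _ _ _ _ _ (fun j => e' (nperm (u * t)%g j.+1))) => //.
      by move=> _; rewrite nperm_ord permM u0 e't; apply: eg.
    apply: IH => // [j|].
      have jl : ((t' j).+1 < l)%N by have := ltn_ord (t' j); clear -hl; lia.
      have jl' : (j.+1 < l)%N by have := ltn_ord j; clear -hl; lia.
      rewrite (nperm_ord _ jl) permM.
      have -> : u (Ordinal jl) = Ordinal jl' by apply: val_inj; rewrite /= uS permK.
      by rewrite e't /= ee0.
    have nl' : (n.-1.+1 < l)%N by clear -nl ln; lia.
    rewrite (nperm_ord _ nl') fl /=; last by clear -hl ln; lia.
    by rewrite -e'n; congr e'; clear -ln; lia.
  + by move=> _; apply/fixlastP.
- move=> n p s e e0 x _ ee0 Hx IH Efx t e' e't e'l.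
  rewrite -(ol_actM L); apply: IH => // j.
  by rewrite permM e't ee0.
- by move=> *; rewrite op_act0; apply: RS_0.
- move=> n p e x y _ IHx _ IHy Efx t e' e't e'l.
  by rewrite (ol_actD L); apply: RS_add; [apply: IHx|apply: IHy].
- move=> n p e a x _ IHx Efx t e' e't e'l.
  by rewrite (ol_actZ L); apply: RS_scale; apply: IHx.
Qed.

(** Each derived input contributes one bracket (or one [B]) of degree 1, so a tracked piece lives in
    a single degree. *)
Lemma rspan_deg fx n p e (x : P n p) : rspan true fx e x ->
  p <> Posz (\sum_(j < n) e j)%N -> x = 0.
Proof.
elim=> {n p e x}.
- by move=> e /(_ isT) e0; rewrite big_ord1 e0.
- by move=> e _ /(_ isT) e0; rewrite big_ord1 e0.
- move=> n l q r g hl hr e e0 y /(_ isT) eg ee0 _ IH rn.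
  rewrite IH ?op_comp0r // => qn; apply: rn; rewrite hr qn.
  have hl' : l = n.+1 := hl.
  rewrite hl' big_ord_recl eg -PoszD; congr (Posz (g + _)%N).
  by apply: eq_bigr => j _; rewrite -ee0.
- move=> n p s e e0 x _ ee0 _ IH pn; rewrite IH ?op_act0 // => pn'; apply: pn.
  rewrite pn' [in RHS](reindex_inj (@perm_inj _ s)) /=; congr Posz.
  by apply: eq_bigr => j _; rewrite ee0.
- by [].
- by move=> n p e x y _ IHx _ IHy pn; rewrite IHx ?IHy ?addr0.
- by move=> n p e a x _ IHx pn; rewrite IHx ?scaler0.
Qed.

(** Without [B], a monomial ends in the identity, whose input is never derived. This matches the
    degree bound of D. *)
Lemma rspan_full fx n p e (x : P n p) : B = 0 -> rspan true fx e x ->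
  (forall j, (j < n)%N -> e j) -> x = 0.
Proof.
move=> B0; elim=> {n p e x} //.
- by move=> e /(_ isT) e0 en; move: (en 0%N isT); rewrite e0.
- move=> n l q r g hl hr e e0 y _ ee0 _ IH en.
  by rewrite IH ?op_comp0r // => j jn; rewrite -ee0 // en // hl.
- move=> n p s e e0 x _ ee0 _ IH en; rewrite IH ?op_act0 // => j jn.
  by rewrite -(ee0 (Ordinal jn)) en.
- by move=> n p e x y _ IHx _ IHy en; rewrite IHx ?IHy ?addr0.
- by move=> n p e a x _ IHx en; rewrite IHx ?scaler0.
Qed.

Definition ffnat n (e : {ffun 'I_n -> bool}) (j : nat) : bool :=
  if insub j is Some i then e i else false.

Lemma ffnatE n (e : {ffun 'I_n -> bool}) (j : 'I_n) : ffnat e j = e j.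
Proof. by rewrite /ffnat valK. Qed.

Definition rsplit n p (x : P n p) := exists2 y : {ffun 'I_n -> bool} -> P n p,
  x = \sum_e y e & forall e, rspan true false (ffnat e) (y e).

Lemma rsplit0 n p : rsplit (0 : P n p).
Proof. by exists (fun=> 0) => [|e]; [rewrite big1|apply: RS_0]. Qed.
Lemma rsplitD n p (x x' : P n p) : rsplit x -> rsplit x' -> rsplit (x + x').
Proof.
move=> [y -> Hy] [y' -> Hy']; exists (fun e => y e + y' e); first by rewrite big_split.
by move=> e; apply: RS_add.
Qed.
Lemma rsplitZ n p a (x : P n p) : rsplit x -> rsplit (a *: x).
Proof.
move=> [y -> Hy]; exists (fun e => a *: y e); first by rewrite scaler_sumr.
by move=> e; apply: RS_scale.
Qed.
Lemma rsplit_of n p e (x : P n p) : rspan true false e x -> rsplit x.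
Proof.
move=> Hx; exists (fun e' => if e' == [ffun j : 'I_n => e j] then x else 0).
  by rewrite -big_mkcond /= big_pred1_eq.
move=> e'; case: eqP => [->|_]; last exact: RS_0.
by apply: rspan_ext Hx => j jn; rewrite -[j]/(nat_of_ord (Ordinal jn)) ffnatE ffunE.
Qed.
Lemma rsplit_sum n p (I : Type) (r : seq I) (F : I -> P n p) :
  (forall i, rsplit (F i)) -> rsplit (\sum_(i <- r) F i).
Proof.
by move=> HF; apply: (big_ind (@rsplit n p)) => //; [apply: rsplit0|apply: rsplitD].
Qed.

(** Each right-normed monomial determines its own set of derived inputs, so any combination can be
    grouped by that set. *)
Lemma rspan_split e n p (x : P n p) : rspan false false e x -> rsplit x.
Proof.
elim=> {n p e x}.
- by move=> e _; apply: (@rsplit_of _ _ (fun=> false)); apply: RS_id.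
- by move=> e _ _; apply: (@rsplit_of _ _ (fun=> true)); apply: RS_B.
- move=> n l q r g hl hr e e0 y _ _ _ [z -> Hz]; rewrite op_comp_sumr.
  apply: rsplit_sum => e1.
  apply: (@rsplit_of _ _ (fun j => if j is k.+1 then ffnat e1 k else g)).
  by apply: (RS_comp _ _ _ _ (Hz e1)).
- move=> n p s e e0 x _ _ _ [z -> Hz]; rewrite op_act_sum.
  apply: rsplit_sum => e1.
  apply: (@rsplit_of _ _ (fun j => ffnat e1 (nperm s^-1%g j))).
  apply: (RS_act _ _ (Hz e1)) => // j.
  by rewrite npermE permK.
- by move=> *; apply: rsplit0.
- by move=> *; apply: rsplitD.
- by move=> *; apply: rsplitZ.
Qed.

Lemma mono_deg (p q : int) : p = q + (p - q).
Proof. by rewrite addrC subrK. Qed.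

(* Degree p must be the number of derived inputs among all but the last for the
   result to be nonzero. *)
Fixpoint mono n : (nat -> bool) -> forall p, P n p :=
  match n return (nat -> bool) -> forall p, P n p with
  | 0%N => fun _ _ => 0
  | S n' =>
    match n' as k return ((nat -> bool) -> forall p, P k p) ->
      (nat -> bool) -> forall p, P k.+1 p with
    | 0%N => fun _ _ p => if p is Posz 0 then op_id P else 0
    | S k => fun rec e p => op_comp (erefl : k.+2 = (2 + k.+1).-1%N)
        (mono_deg p (dg (e 0%N))) ord_max (G (e 0%N))
        (rec (fun j => e j.+1) (p - dg (e 0%N)))
    end (mono n')
  end.

(** The bound is [n.-1] because the last input is not the left argument of any bracket: its flag is
    never read. *)
Lemma mono_ext n e e' p : (forall j, (j < n.-1)%N -> e' j = e j) ->
  mono n e' p = mono n e p.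
Proof.
elim: n e e' p => [//|[//|n] IH] e e' p ee'.
rewrite /= -/(mono n.+1) (ee' 0%N isT); congr op_comp.
by apply: IH => j jn; apply: ee'.
Qed.

Lemma mono_comp n l (q r : int) (hl : l = (2 + n).-1%N) g (hr : r = dg g + q) e e0 :
  (0 < n)%N -> e 0%N = g -> (forall j, (j.+1 < n)%N -> e j.+1 = e0 j) ->
  op_comp hl hr ord_max (G g) (mono n e0 q) = mono l e r.
Proof.
case: n hl => [//|n] hl _ eg ee0.
have el : l = n.+2 := hl.
move: hl; rewrite el => hl /=; rewrite -/(mono n.+1).
have eq : q = r - dg g by rewrite hr addrC addKr.
move: hr; rewrite eq -eg => hr.
rewrite (eq_irrelevance hl erefl) (eq_irrelevance hr (mono_deg r (dg (e 0%N)))).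
by congr op_comp; apply: mono_ext => j jn; rewrite ee0.
Qed.

(** Pulling [e] back along [s] gives all the permuted monomials of the sum the same set [e] of
    derived inputs. *)
Definition mspan n p (e : nat -> bool) (x : P n p) := exists c : 'S_n -> K,
  x = \sum_(s : 'S_n | fixlast s) c s *: op_act s (mono n (fun j => e (nperm s j)) p).

Lemma mspan0 n p e : mspan e (0 : P n p).
Proof. by exists (fun=> 0); rewrite big1 // => s _; rewrite scale0r. Qed.
Lemma mspanD n p e (x y : P n p) : mspan e x -> mspan e y -> mspan e (x + y).
Proof.
move=> [c ->] [d ->]; exists (fun s => c s + d s).
by rewrite -big_split /=; apply: eq_bigr => s _; rewrite scalerDl.
Qed.
Lemma mspanZ n p e a (x : P n p) : mspan e x -> mspan e (a *: x).
Proof.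
move=> [c ->]; exists (fun s => a * c s).
by rewrite scaler_sumr; apply: eq_bigr => s _; rewrite scalerA.
Qed.
Lemma mspan_sum n p e (I : Type) (r : seq I) (Q : pred I) (F : I -> P n p) :
  (forall i, Q i -> mspan e (F i)) -> mspan e (\sum_(i <- r | Q i) F i).
Proof.
by move=> HF; apply: (big_ind (@mspan n p e)) => //; [apply: mspan0|apply: mspanD].
Qed.
Lemma mspan_mono n p e (s : 'S_n) e0 : fixlast s ->
  (forall j, (j < n)%N -> e (nperm s j) = e0 j) ->
  mspan e (op_act s (mono n e0 p)).
Proof.
move=> fs ee0; exists (fun t => if t == s then 1 else 0).
rewrite (bigD1 s) //= eqxx scale1r big1 ?addr0.
  by congr op_act; apply: mono_ext => j jn; rewrite ee0 //; clear -jn; lia.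
by move=> t /andP[_ /negPf->]; rewrite scale0r.
Qed.

Lemma fixlastM n (s t : 'S_n) : fixlast s -> fixlast t -> fixlast (s * t)%g.
Proof.
move=> /fixlastP fs /fixlastP ft; apply/fixlastP => j jn.
by rewrite permM fs // ft.
Qed.

(** Replaces the inductive span by explicit coefficients: the permutations fixing the last input are
    closed under product, and extend along a new first input. *)
Lemma rspan_expand n p e (x : P n p) : rspan true true e x -> mspan e x.
Proof.
move Efx : {2}true => fx Hx; elim: Hx Efx => {n p e x}.
- move=> e _ _; rewrite -(ol_act1 L (op_id P)).
  apply: (@mspan_mono 1%N 0 e _ e) => [|j _]; last by rewrite nperm1.
  by apply/fixlastP => j _; rewrite perm1.
- by move=> e + _ Efx; rewrite -Efx.
- move=> n l q r g hl hr e e0 y /(_ isT) eg ee0 Hy IH Efx.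
  case: (posnP n) => n0.
    by rewrite (rspan_arity0 Hy n0) op_comp0r; apply: mspan0.
  have [c ->] := IH Efx; rewrite op_comp_sumr; apply: mspan_sum => s fs.
  rewrite (ol_compZr L); apply: mspanZ.
  have [u [u1 u2 ->]] := op_comp_actr hl hr ord_max s (G g)
    (mono n (fun j => e0 (nperm s j)) q).
  have zl : (0 < l)%N by clear -hl; lia.
  have uS j (jn : (j < n)%N) : nperm u j.+1 = (nperm s j).+1.
    have jl : (j.+1 < l)%N by clear -hl jn; lia.
    by rewrite (nperm_ord _ jl) (u2 (Ordinal jn)) //= (nperm_ord _ jn).
  rewrite (@mono_comp _ _ _ _ _ _ _ (fun j => e (nperm u j))) //.
  + apply: mspan_mono => //; apply/fixlastP => j jl; apply: val_inj.
    rewrite /= -npermE (_ : nat_of_ord j = n.-1.+1); last by clear -jl hl n0; lia.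
    have ln : (n.-1 < n)%N by clear -n0; lia.
    rewrite uS // (nperm_ord _ ln); congr _.+1.
    by move/fixlastP: fs => -> //=; clear -n0; lia.
  + rewrite -eg; congr e; rewrite (nperm_ord _ zl).
    by rewrite (u1 ord0).
  + move=> j jn; have jn' : (j < n)%N by clear -jn; lia.
    by rewrite uS // ee0 // nperm_lt.
- move=> n p s e e0 x fs ee0 _ IH Efx.
  have [c ->] := IH Efx; rewrite op_act_sum; apply: mspan_sum => t ft.
  rewrite (ol_actZ L) -(ol_actM L); apply: mspanZ; apply: mspan_mono.
    by apply: fixlastM => //; apply: fs; rewrite -Efx.
  move=> j jn; rewrite npermM.
  have jn' := nperm_lt t jn.
  by rewrite (nperm_ord _ jn') ee0.
- by move=> *; apply: mspan0.
- by move=> n p e x y _ IHx _ IHy Efx; apply: mspanD; [apply: IHx|apply: IHy].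
- by move=> n p e a x _ IHx Efx; apply: mspanZ; apply: IHx.
Qed.
End RightNormed.

(** * Operads whose left multiplications commute up to a scalar *)

Section CommutingMonomials.
Variables (K : fieldType) (P : operad K) (G : forall g : bool, P 2%N (dg g)).
Let L := op_ok P.

Hypothesis G_comm : forall g h (p : int) (hr : p = dg g + dg h) (hr' : p = dg h + dg g),
  exists c : K, comp2 hr (G g) (G h) = c *: swap12 (comp2 hr' (G h) (G g)).

Lemma monoS n (e : nat -> bool) p : mono G n.+2 e p =
  op_comp (erefl : n.+2 = (2 + n.+1).-1%N) (mono_deg p (dg (e 0%N))) ord_max
    (G (e 0%N)) (mono G n.+1 (fun j => e j.+1) (p - dg (e 0%N))).
Proof. by []. Qed.

(** Applied to D: reordering all inputs but the last only rescales a monomial, so in a tensor with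
    Lie the order is carried by the Lie word alone. *)
Lemma mono_act n (e e' : nat -> bool) p (s : 'S_n) : fixlast s ->
  (forall j : 'I_n, e' (s j) = e j) ->
  exists c : K, op_act s (mono G n e p) = c *: mono G n e' p.
Proof.
elim: n e e' p s => [|[|n] IH] e e' p s fs ee'.
- by exists 0; rewrite op_act0 scale0r.
- exists 1; rewrite (_ : s = 1%g) ?(ol_act1 L) ?scale1r //.
  by apply/permP => j; rewrite !ord1.
(* A permutation fixing input 0 acts on the right argument of the outermost bracket, where induction
   applies. *)
have fix0 (t : 'S_n.+2) (d d' : nat -> bool) : fixlast t -> t ord0 = ord0 ->
    (forall j : 'I_n.+2, d' (t j) = d j) ->
    exists c : K, op_act t (mono G n.+2 d p) = c *: mono G n.+2 d' p.
  move=> ft t0 dd'.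
  have tS j : (j < n.+1)%N -> (nperm t j.+1).-1.+1 = nperm t j.+1.
    move=> jn; apply: prednK; rewrite lt0n; apply/eqP => tj.
    have : j.+1 = 0%N; last by [].
    by apply: (@nperm_inj _ t) => //; rewrite tj (nperm_ord _ (ltn0Sn _)) t0.
  have [t' t'E] : exists t' : 'S_n.+1, forall j : 'I_n.+1, t' j = (nperm t j.+1).-1 :> nat.
    apply: (@perm_of_nat _ (fun j => (nperm t j.+1).-1)) => [j jn|j k jn kn].
      by have := @nperm_lt _ t j.+1 jn; rewrite -(tS j jn).
    by move=> /(congr1 S); rewrite !tS // => e1; case: (@nperm_inj _ t j.+1 k.+1 jn kn e1).
  have t't (j : 'I_n.+1) : (t' j).+1 = nperm t j.+1 by rewrite t'E tS.
  rewrite monoS.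
  have [u [u1 u2 Hu]] := op_comp_actr (erefl : n.+2 = (2 + n.+1).-1%N)
    (mono_deg p (dg (d 0%N))) ord_max t' (G (d 0%N))
    (mono G n.+1 (fun j => d j.+1) (p - dg (d 0%N))).
  have -> : t = u.
    apply/permP => j; apply: val_inj; case: (posnP j) => [j0|jS].
      rewrite (_ : j = ord0) ?t0; last exact: val_inj.
      by rewrite (u1 ord0).
    have jn : (j.-1 < n.+1)%N by have := ltn_ord j; clear -jS; lia.
    rewrite /= (u2 (Ordinal jn)); last by rewrite /=; clear -jS; lia.
    by rewrite /= add1n t't /= prednK // npermE.
  rewrite -Hu.
  have [|j|c ->] := IH (fun j => d j.+1) (fun j => d' j.+1) (p - dg (d 0%N)) t'.
  - apply/fixlastP => j jn; apply: val_inj => /=; apply/eqP; rewrite -eqSS; apply/eqP.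
    have jl : (j.+1 < n.+2)%N by rewrite jn.
    rewrite t't (nperm_ord _ jl); move/fixlastP: ft => -> //.
    by rewrite /= jn.
  - have jl : (j.+1 < n.+2)%N by have := ltn_ord j.
    by rewrite t't (nperm_ord _ jl) dd'.
  exists c; rewrite (ol_compZr L); congr (_ *: _).
  by apply: mono_comp => //; have := dd' ord0; rewrite t0.
case: (posnP (s^-1%g ord0)) => m0.
  by apply: fix0 => //; rewrite -[RHS](permKV s); congr (s _); apply: val_inj.
set m := s^-1%g ord0 in m0.
have sm : s m = ord0 by rewrite permKV.
have mn1 : m <> n.+1 :> nat.
  move=> mn; have := sm; move/fixlastP: fs => ->; last by rewrite mn.
  by move=> m0'; move: m0; rewrite m0'.
have mn : (m.-1 < n.+1)%N by have := ltn_ord m; clear -m0 mn1; lia.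
pose t' := tperm (Ordinal mn) ord0.
have t'0 : t' ord0 = Ordinal mn by rewrite tpermR.
have ft' : fixlast t'.
  apply/fixlastP => j [jn]; rewrite tpermD // -val_eqE /=.
    by rewrite jn; have := ltn_ord m; clear -m0 mn1; lia.
  by have := ltn_ord m; clear -jn m0 mn1; lia.
(* Inputs 0, m and the last one are distinct, which forces arity at least 3. *)
case: n IH fix0 s e e' fs ee' m m0 sm mn1 mn @t' t'0 ft' => [|n] IH fix0 s e e' fs ee'
  m m0 sm mn1 mn t' t'0 ft'.
  by have := ltn_ord m; clear -m0 mn1; lia.
pose q := p - dg (e 0%N).
pose e2 j := e (nperm t' j).+1.
have [|c Hc] := IH (fun j => e j.+1) e2 q t' ft'.
  move=> j; rewrite /e2 npermE -permM.
  by rewrite /t' tperm2 perm1.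
have {}Hc : mono G n.+2 (fun j => e j.+1) q = c *: op_act t'^-1%g (mono G n.+2 e2 q).
  by rewrite -(ol_actZ L) -Hc op_actKV.
rewrite [mono _ _ e _]monoS Hc (ol_compZr L) (ol_actZ L).
have [u [u1 u2 ->]] := op_comp_actr (erefl : n.+3 = (2 + n.+2).-1%N)
    (mono_deg p (dg (e 0%N))) ord_max t'^-1%g (G (e 0%N)) (mono G n.+2 e2 q).
rewrite -(ol_actM L) [mono _ _ e2 _]monoS.
set a := e 0%N; set b := e2 0%N; set e3 := (fun j => e2 j.+1).
set Z := mono G n.+1 e3 _.
have k2 : (2 < 3)%N by [].
have d4 : p = (dg a + dg b) + (q - dg b) by rewrite /q /a addrA; lia.
rewrite (@ol_seq _ _ _ _ _ _ _ _ L 2%N 2%N n.+1 3%N n.+2 n.+3 _ _ _ (dg a + dg b) _ _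
    erefl (mono_deg q (dg b)) erefl (mono_deg p (dg a)) erefl erefl erefl d4
    ord_max ord_max (Ordinal k2)) //.
have hr' : dg a + dg b = dg b + dg a by rewrite addrC.
(* The inputs 0 and m now come first and are exchanged; the remaining permutation [w] fixes input 0
   and is left to [fix0]. *)
have [c' ] := G_comm (erefl (dg a + dg b)) hr'.
rewrite {1}/comp2 => ->; rewrite /swap12 /comp2 (ol_compZl L) (ol_actZ L).
have tau2 : Ordinal k2 = tperm ord0 (lift ord0 (@ord0 1)) (Ordinal k2).
  by rewrite tpermD.
have [u' [u'1 u'2 ->]] := op_comp_actl (erefl : n.+3 = (3 + n.+1).-1%N) d4
  (op_comp (erefl : 3%N = (2 + 2).-1%N) hr' ord_max (G b) (G a)) Z tau2.
rewrite -(ol_actM L).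
have d1 : p - dg b = dg a + (q - dg b) by rewrite /q /a; lia.
rewrite -(@ol_seq _ _ _ _ _ _ _ _ L 2%N 2%N n.+1 3%N n.+2 n.+3 _ _ _ _ (p - dg b) _
    erefl d1 erefl (mono_deg p (dg b)) erefl hr' erefl d4
    ord_max ord_max (Ordinal k2)) //.
set w := (u' * (u * s))%g.
have u'0 : u' ord0 = lift ord0 ord0.
  by apply: val_inj; rewrite /= (u'1 ord0) //= tpermL.
have u'1' : u' (lift ord0 ord0) = ord0.
  by apply: val_inj; rewrite /= (u'1 (lift ord0 ord0)) //= tpermR.
have u'S (v : 'I_n.+3) : (1 < v)%N -> u' v = v.
  move=> v1; have vn : (v - 2 < n.+1)%N by have := ltn_ord v; clear -v1; lia.
  by apply: val_inj; rewrite /= (u'2 (Ordinal vn)) /=; clear -v1; lia.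
have u0 : u ord0 = ord0 by apply: (u1 ord0).
have uS (v : 'I_n.+2) : u (lift ord0 v) = lift ord0 (t' v).
  by apply: val_inj; rewrite /= (u2 v) //= tpermV.
have w0 : w ord0 = ord0.
  rewrite !permM u'0 (uS ord0) t'0 -[RHS]sm; congr (s _).
  by apply: val_inj; rewrite /= /bump /=; clear -m0; lia.
have e'w0 : e' (w ord0) = b.
  rewrite !permM u'0 (uS ord0) t'0 ee' /b /e2 -[0%N]/(nat_of_ord (@ord0 n.+1)) npermE t'0.
  by [].
have e'w1 : e' (w (lift ord0 ord0)) = a by rewrite !permM u'1' u0 ee'.
have e'wS (v : 'I_n.+1) : e' (w (lift ord0 (lift ord0 v))) = e2 v.+1.
  rewrite !permM u'S // uS ee' /e2.
  by rewrite -[v.+1]/(nat_of_ord (lift ord0 v)) npermE.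
have fw : fixlast w.
  apply/fixlastP => j jn; rewrite !permM u'S; last by clear -jn; lia.
  have -> : j = lift ord0 ord_max.
    by apply: val_inj; rewrite /= /bump /=; clear -jn; lia.
  rewrite uS; move/fixlastP: ft' => -> //.
  by move/fixlastP: fs => ->.
pose e4 j := e' (nperm w j).
have [|c4 Hc4] := fix0 w e4 e' fw w0; first by move=> j; rewrite /e4 npermE.
exists (c * c' * c4); rewrite -scalerA -Hc4 -scalerA; do 2 congr (_ *: _).
congr op_act; rewrite /Z.
rewrite (@mono_comp _ _ _ _ _ _ _ _ _ _ (fun j => e4 j.+1)) //.
- apply: mono_comp => //.
  by rewrite /e4 -[0%N]/(nat_of_ord (@ord0 n.+2)) npermE e'w0.
- by rewrite /e4 -[1%N]/(nat_of_ord (lift ord0 (@ord0 n.+1))) npermE e'w1.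
- move=> j jn.
  have jn' : (j < n.+1)%N by clear -jn; lia.
  rewrite /e3 /e4 (_ : j.+2 = nat_of_ord (lift ord0 (lift ord0 (Ordinal jn')))) //.
  by rewrite npermE e'wS.
Qed.
End CommutingMonomials.

(** * Grassmann algebras *)

Section Grassmann.
Variable K : fieldType.

(** This is 2^n, written as a sum so that a [block_mx] of two halves has this size by conversion. *)
Fixpoint gdim (n : nat) : nat := if n is k.+1 then (gdim k + gdim k)%N else 1%N.

(* [block_mx a c 0 (+- a)] encodes a + c eps, for a new odd generator eps; [gpar]
   says that a matrix encodes an even ([false]) or odd ([true]) element. *)
Fixpoint gpar (n : nat) (b : bool) : 'M[K]_(gdim n) -> Prop :=
  match n return 'M[K]_(gdim n) -> Prop with
  | 0%N => fun x => b -> x = 0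
  | k.+1 => fun x => exists a c, [/\ gpar b a, gpar (~~ b) c &
      x = block_mx a c 0 ((-1) ^+ b *: a)]
  end.

Lemma gpar_lin n b c (x y : 'M_(gdim n)) :
  gpar b x -> gpar b y -> gpar b (c *: x + y).
Proof.
elim: n b x y => [|n IH] b x y /=; first by move=> Hx Hy hb; rewrite Hx ?Hy ?scaler0 ?addr0.
move=> [a [d [Ha Hd ->]]] [a' [d' [Ha' Hd' ->]]].
exists (c *: a + a'), (c *: d + d'); split; [exact: IH|exact: IH|].
by rewrite scale_block_mx add_block_mx scaler0 addr0 scalerDr !scalerA mulrC.
Qed.
Lemma gpar0 n b : gpar b (0 : 'M_(gdim n)).
Proof.
elim: n b => [//|n IH] b /=; exists 0, 0; split=> //.
by rewrite scaler0 block_mx0.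
Qed.
Lemma gparD n b (x y : 'M_(gdim n)) : gpar b x -> gpar b y -> gpar b (x + y).
Proof. by rewrite -[x in x + y]scale1r; apply: gpar_lin. Qed.
Lemma gparZ n b c (x : 'M_(gdim n)) : gpar b x -> gpar b (c *: x).
Proof. by move=> Hx; rewrite -[_ *: _]addr0; apply: gpar_lin (gpar0 _ _). Qed.
Lemma gpar_sum n b (m : nat) (F : nat -> 'M_(gdim n)) :
  (forall j, gpar b (F j)) -> gpar b (\sum_(j < m) F j).
Proof.
move=> HF; apply: (big_ind (gpar b)) => //; [exact: gpar0|exact: gparD].
Qed.
Lemma gpar1 n : gpar false (1%:M : 'M_(gdim n)).
Proof.
elim: n => [//|n IH] /=; exists 1%:M, 0; split=> //; first exact: gpar0.
by rewrite expr0 scale1r -scalar_mx_block.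
Qed.
(** In (a + d eps)(a' + d' eps) moving eps past a' costs the sign of a', which the lower right block
    provides; eps squared is 0 because the lower left block is 0. *)
Lemma gpar_mul n b b' (x y : 'M_(gdim n)) :
  gpar b x -> gpar b' y -> gpar (b (+) b') (x *m y).
Proof.
elim: n b b' x y => [|n IH] b b' x y /=.
  case: b => [-> // _ _|]; first by rewrite mul0mx.
  by move=> _ Hy b'1; rewrite Hy // mulmx0.
move=> [a [d [Ha Hd ->]]] [a' [d' [Ha' Hd' ->]]].
exists (a *m a'), (a *m d' + (-1) ^+ b' *: (d *m a')); split; first exact: IH.
  apply: gparD; first by rewrite -addbN; apply: IH.
  by apply: gparZ; rewrite -addNb; apply: IH.
rewrite mulmx_block !mulmx0 !mul0mx !addr0 add0r -!scalemxAl -!scalemxAr scalerA.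
by rewrite -signr_addb.
Qed.
Lemma gpar_comm n b b' (x y : 'M_(gdim n)) :
  gpar b x -> gpar b' y -> x *m y = (-1) ^+ (b && b') *: (y *m x).
Proof.
elim: n b b' x y => [|n IH] b b' x y /=.
  case: b => [-> // _|_]; first by rewrite mul0mx mulmx0 scaler0.
  case: b' => [-> //|_]; first by rewrite mul0mx mulmx0 scaler0.
  rewrite expr0 scale1r; apply/matrixP => i j; rewrite !mxE !big_ord1 mulrC.
  by rewrite !ord1.
move=> [a [d [Ha Hd ->]]] [a' [d' [Ha' Hd' ->]]].
rewrite !mulmx_block !mulmx0 !mul0mx !addr0 !add0r -!scalemxAl -!scalemxAr !scalerA.
rewrite scale_block_mx scaler0 scalerDr !scalerA.
rewrite (IH _ _ _ _ Ha Ha') (IH _ _ _ _ Ha Hd') (IH _ _ _ _ Hd Ha') !scalerA.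
rewrite -!signr_addb addrC; congr block_mx.
- congr (_ *: _ + _ *: _); last by case: b b' {Ha Hd Ha' Hd' IH} => [] [].
  by congr (_ ^+ nat_of_bool _); case: b b' {Ha Hd Ha' Hd' IH} => [] [].
- by congr (_ ^+ nat_of_bool _ *: _); case: b b' {Ha Hd Ha' Hd' IH} => [] [].
Qed.
(** The diagonal blocks vanish by induction; the corner is a d - d a, which is 0 since d is even. *)
Lemma gpar_sq n (x : 'M_(gdim n)) : gpar true x -> x *m x = 0.
Proof.
elim: n x => [|n IH] x /=; first by move=> ->; rewrite ?mulmx0.
move=> [a [d [Ha Hd ->]]].
rewrite mulmx_block !mulmx0 !mul0mx !addr0 add0r -!scalemxAl -!scalemxAr (IH _ Ha).
rewrite (gpar_comm Ha Hd) expr0 scale1r expr1 scaleN1r subrr !scaler0.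
by rewrite block_mx0.
Qed.

(** Index 0 is the newest generator eps. The others, being odd, change sign in the second block, and
    indices from n on give 0. *)
Fixpoint ggen (n j : nat) : 'M[K]_(gdim n) :=
  match n return 'M[K]_(gdim n) with
  | 0%N => 0
  | k.+1 => if j is i.+1 then block_mx (ggen k i) 0 0 (- ggen k i)
            else block_mx 0 1%:M 0 0
  end.

Lemma ggen_odd n j : gpar true (ggen n j).
Proof.
elim: n j => [//|n IH] [|j] /=.
  by exists 0, 1%:M; split; [exact: gpar0|exact: gpar1|rewrite scaler0].
by exists (ggen n j), 0; split; [exact: IH|exact: gpar0|rewrite expr1 scaleN1r].
Qed.

Fixpoint gprod (d n : nat) (th : nat -> 'M[K]_d) (e : nat -> bool) : 'M[K]_d :=
  if n is k.+1 then
    (if e 0%N then th 0%N else 1%:M) *m gprod k (fun j => th j.+1) (fun j => e j.+1)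
  else 1%:M.

Lemma gprod_ext d n (th th' : nat -> 'M[K]_d) (e : nat -> bool) :
  (forall j, (j < n)%N -> e j -> th j = th' j) -> gprod n th e = gprod n th' e.
Proof.
elim: n th th' e => [//|n IH] th th' e H /=.
rewrite (IH _ (fun j => th' j.+1)); last by move=> j jn; apply: H.
by case: ifP => // e0; rewrite H.
Qed.

Lemma gprod0 d n (th : nat -> 'M[K]_d) (e : nat -> bool) j :
  (j < n)%N -> e j -> th j = 0 -> gprod n th e = 0.
Proof.
elim: n th e j => [//|n IH] th e [_ /= -> ->|j jn ej tj /=]; first by rewrite mul0mx.
by rewrite (IH (fun j => th j.+1) (fun j => e j.+1) j) ?mulmx0.
Qed.

Lemma gprod_block d n (th : nat -> 'M[K]_d) (e : nat -> bool) :
  exists b : bool, gprod n (fun j => block_mx (th j) 0 0 (- th j)) e =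
    block_mx (gprod n th e) 0 0 ((-1) ^+ b *: gprod n th e).
Proof.
elim: n th e => [|n IH] th e /=.
  by exists false; rewrite expr0 scale1r -scalar_mx_block.
have [b ->] := IH (fun j => th j.+1) (fun j => e j.+1).
case: ifP => _; last by exists b; rewrite !mul1mx.
exists (~~ b); rewrite mulmx_block !mulmx0 !mul0mx !addr0 add0r.
by rewrite mulNmx -scalemxAr -scaleNr signrN.
Qed.

(** The product of the other generators is block diagonal with blocks equal up to sign; multiplying
    by eps moves the lower block to the corner, so nothing is lost. *)
Lemma gprod_ggen n (e : nat -> bool) : gprod n (ggen n) e != 0.
Proof.
elim: n e => [|n IH] e /=; first by rewrite oner_eq0.
have [b ->] := gprod_block n (ggen n) (fun j => e j.+1).
apply: contraNneq (IH (fun j => e j.+1)) => H; apply/eqP.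
move: H; case: ifP => _.
  rewrite mulmx_block !mulmx0 !mul0mx mul1mx !addr0 add0r.
  rewrite -[X in _ = X]block_mx0 => /eq_block_mx[_ + _ _].
  move=> /(congr1 ( *:%R ((-1) ^+ b))).
  by rewrite scalerA -signr_addb addbb expr0 scale1r scaler0.
by rewrite mul1mx -[X in _ = X]block_mx0 => /eq_block_mx[].
Qed.
End Grassmann.

(** * Arguments of the outer operation of a composite *)

Section Substitution.
Local Open Scope nat_scope.
Variable T : Type.
Implicit Types (a : nat -> T) (z : T).

(** [z] stands for the value of an inner operation of arity [n] at slot [i]. The lemmas that follow
    mirror the sequential, parallel and equivariance axioms. *)
Definition subst i n a z j : T := if j == i then z else a (outer i n j).

Lemma subst_seq b c bc i j k a z y : bc = (b + c).-1 -> j < b -> k = i + j ->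
  subst i b (subst k c a z) y = subst i bc a y.
Proof.
move=> -> jb ->; apply: funext => v; rewrite /subst; case: (ltngtP v i) => //= vi.
  rewrite /outer vi ifF; last by lia.
  by rewrite ifT //; lia.
have -> : outer i b v = (v + b).-1 by rewrite /outer ifF; lia.
have -> : outer i (b + c).-1 v = (v + (b + c).-1).-1 by rewrite /outer ifF; lia.
rewrite ifF; last by lia.
by congr a; rewrite /outer ifF; lia.
Qed.
Lemma subst_seq_block c i j k a z : k = i + j ->
  (fun t => subst k c a z (i + t)) = subst j c (fun t => a (i + t)) z.
Proof.
move=> ->; apply: funext => t; rewrite /subst eqn_add2l; case: eqP => // tj.
by congr a; rewrite /outer ltn_add2l; case: ltngtP tj => //; lia.
Qed.
Lemma subst_par b c i k k' a z y : i < k -> k' = (k + b).-1 ->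
  subst i b (subst k' c a z) y = subst k c (subst i b a y) z.
Proof.
move=> ik ->; apply: funext => v; rewrite /subst /outer.
case: (ltngtP v i) => vi; case: (ltngtP v k) => vk; try (exfalso; lia); subst;
  repeat first [rewrite ifF; [|by lia] | rewrite ifT; [|by lia]]; try by []; by congr a; lia.
Qed.
Lemma subst_par_block1 b c k' a z i k t : i < k -> k' = (k + b).-1 -> t < b ->
  subst k' c a z (i + t) = a (i + t).
Proof.
by move=> ik -> tb; rewrite /subst ifF ?/outer ?ifT //; lia.
Qed.
Lemma subst_par_block2 b k' a y i k t : i < k -> k' = (k + b).-1 ->
  subst i b a y (k + t) = a (k' + t).
Proof.
by move=> ik ->; rewrite /subst ifF ?/outer ?ifF //; [congr a|..]; lia.
Qed.
Lemma subst_equiv m n l (i : 'I_m) (s : 'S_m) (u : 'S_l) a z v :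
  l = (m + n).-1 -> v < m ->
  (forall (j : 'I_m) (w : 'I_l), j != i -> w = outer i n j :> nat ->
       u w = outer (s i) n (s j) :> nat) ->
  subst (s i) n a z (nperm s v) = subst i n (fun j => a (nperm u j)) z v.
Proof.
move=> hl vm Hu; rewrite /subst (nperm_ord s vm).
have -> : (nat_of_ord (s (Ordinal vm)) == s i) = (v == i).
  by rewrite (inj_eq val_inj) (inj_eq perm_inj) -val_eqE.
case: eqP => // vi.
have wl : outer i n v < l by rewrite /outer; have := ltn_ord i; case: ifP; lia.
rewrite (nperm_ord u wl) -(Hu (Ordinal vm) (Ordinal wl)) //.
by rewrite -val_eqE; apply/eqP.
Qed.
Lemma subst_lt m n l (i : 'I_m) a a' z v :
  l = (m + n).-1 -> v < m -> (forall j, j < l -> a j = a' j) ->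
  subst i n a z v = subst i n a' z v.
Proof.
move=> hl vm aa'; rewrite /subst; case: eqP => // vi; apply: aa'.
by rewrite /outer; have := ltn_ord i; case: ifP; lia.
Qed.
End Substitution.

(** * Models of Lie and O *)

Section LieModel.
Variables (K : fieldType) (N : nat).
Local Notation A := 'M[K]_N.
Implicit Types (a : nat -> A) (x y z : A).

Fixpoint lie_eval n p (t : term K Lie_sig n p) (a : nat -> A) : A :=
  match t with
  | tgen _ => a 0%N *m a 1%N - a 1%N *m a 0%N
  | tzero n p => 0
  | tadd n p t u => lie_eval t a + lie_eval u a
  | tscale n p c t => c *: lie_eval t a
  | tact n p s t => lie_eval t (fun j => a (nperm s j))
  | tid => a 0%N
  | tcomp m n l p q r hl hr i t u =>
      lie_eval t (subst i n a (lie_eval u (fun j => a (i + j)%N)))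
  end.

Lemma lie_eval_ext n p (t : term K Lie_sig n p) a a' :
  (forall j, (j < n)%N -> a j = a' j) -> lie_eval t a = lie_eval t a'.
Proof.
elim: t a a' => {n p} /=.
- by move=> _ a a' aa'; rewrite !aa'.
- by [].
- by move=> n p t IHt u IHu a a' aa'; rewrite (IHt a a') ?(IHu a a').
- by move=> n p c t IHt a a' aa'; rewrite (IHt a a').
- by move=> n p s t IHt a a' aa'; apply: IHt => j jn; rewrite aa' ?nperm_lt.
- by move=> a a'; apply.
- move=> m n l p q r hl hr i t IHt u IHu a a' aa'.
  rewrite (IHu _ (fun j => a' (i + j)%N)) => [|j jn]; last first.
    by rewrite aa' //; have := ltn_ord i; clear -jn hl; lia.
  by apply: IHt => j jm; apply: (@subst_lt _ _ _ _ _ _ _ _ _ hl jm aa').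
Qed.

Definition upd a i z j := if j == i then z else a j.

Lemma subst_upd i n a z : subst i n a z = upd (subst i n a 0) i z.
Proof. by apply: funext => j; rewrite /upd /subst; case: eqP. Qed.

(** The inner value of a composite is an argument of the outer operation, so linearity of
    composition on the right rests on linearity in each argument. *)
Lemma lie_eval_linear n p (t : term K Lie_sig n p) j a c x y : (j < n)%N ->
  lie_eval t (upd a j (c *: x + y)) =
  c *: lie_eval t (upd a j x) + lie_eval t (upd a j y).
Proof.
elim: t j a c x y => {n p} /=.
- move=> _ [|[|//]] a c x y _; rewrite /upd /=.
    by rewrite mulmxDl mulmxDr -scalemxAl -scalemxAr scalerBr opprD addrACA.
  by rewrite mulmxDl mulmxDr -scalemxAl -scalemxAr scalerBr opprD addrACA.
- by move=> *; rewrite scaler0 addr0.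
- by move=> n p t IHt u IHu j a c x y jn; rewrite IHt ?IHu // scalerDr addrACA.
- by move=> n p d t IHt j a c x y jn; rewrite IHt // scalerDr !scalerA mulrC.
- move=> n p s t IHt j a c x y jn.
  have E z : lie_eval t (fun k => upd a j z (nperm s k)) =
      lie_eval t (upd (fun k => a (nperm s k)) (nperm s^-1%g j) z).
    apply: lie_eval_ext => k kn; rewrite /upd; congr (if _ then _ else _).
    rewrite -[j in LHS](nperm1 n) -(mulVg s) npermM.
    apply/eqP/eqP => [/nperm_inj->|->] //; exact: nperm_lt.
  by rewrite !E IHt // nperm_lt.
- by case=> // a c x y _; rewrite /upd.
- move=> m n l p q r hl hr i t IHt u IHu j a c x y jl.
  have im := ltn_ord i.
  (* Input [j] lies before, inside or after the block of [u]. *)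
  case: (ltnP j i) => ji.
    have E z : subst i n (upd a j z) (lie_eval u (fun k => upd a j z (i + k)%N)) =
        upd (subst i n a (lie_eval u (fun k => a (i + k)%N))) j z.
      have -> : (fun k => upd a j z (i + k)%N) = (fun k => a (i + k)%N).
        by apply: funext => k; rewrite /upd ifF //; lia.
      apply: funext => k; rewrite /subst /upd; case: (k =P i :> nat) => ki.
        by rewrite ifF //; lia.
      congr (if _ then _ else _); rewrite /outer; case: ifP => //; lia.
    by rewrite !E IHt //; lia.
  case: (ltnP j (i + n)) => jin.
    have E z : subst i n (upd a j z) (lie_eval u (fun k => upd a j z (i + k)%N)) =
        upd (subst i n a 0) i (lie_eval u (upd (fun k => a (i + k)%N) (j - i)%N z)).
      have -> : (fun k => upd a j z (i + k)%N) = upd (fun k => a (i + k)%N) (j - i)%N z.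
        apply: funext => k; rewrite /upd; congr (if _ then _ else _).
        by apply/eqP/eqP; lia.
      apply: funext => k; rewrite /subst /upd; case: (k =P i :> nat) => ki //.
      rewrite ifF //; rewrite /outer; case: ifP => //; lia.
    rewrite !E IHu ?IHt //; lia.
  have E z : lie_eval t (subst i n (upd a j z) (lie_eval u (fun k => upd a j z (i + k)%N))) =
      lie_eval t (upd (subst i n a (lie_eval u (fun k => a (i + k)%N))) (j - n)%N.+1 z).
    congr lie_eval.
    have -> : lie_eval u (fun k => upd a j z (i + k)%N) =
        lie_eval u (fun k => a (i + k)%N).
      by apply: lie_eval_ext => k kn; rewrite /upd ifF //; lia.
    apply: funext => k; rewrite /subst /upd; case: (k =P i :> nat) => ki.
      by rewrite ifF //; lia.
    congr (if _ then _ else _); rewrite /outer; case: ifP => //; lia.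
  by rewrite !E IHt //; lia.
Qed.

Lemma lie_eval_subst m n p (t : term K Lie_sig m p) (i : 'I_m) a c x y :
  lie_eval t (subst i n a (c *: x + y)) =
  c *: lie_eval t (subst i n a x) + lie_eval t (subst i n a y).
Proof. by rewrite !(subst_upd _ _ _ (_ + _), subst_upd _ _ _ x, subst_upd _ _ _ y) lie_eval_linear. Qed.

Lemma lie_eval_subst0 m n p (t : term K Lie_sig m p) (i : 'I_m) a :
  lie_eval t (subst i n a 0) = 0.
Proof.
have := lie_eval_subst n t i a (-1) 0 0.
by rewrite scaler0 addr0 scaleN1r addNr.
Qed.

(** The commutator model is ungraded. Because it vanishes outside degree 0, it cannot conflict with
    the Koszul sign of the parallel axiom. *)
Lemma lie_eval_deg n p (t : term K Lie_sig n p) a : p != 0 -> lie_eval t a = 0.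
Proof.
elim: t a => {n p} //=.
- by move=> n p t IHt u IHu a p0; rewrite IHt ?IHu ?addr0.
- by move=> n p c t IHt a p0; rewrite IHt ?scaler0.
- by move=> n p s t IHt a p0; rewrite IHt.
- move=> m n l p q r hl hr i t IHt u IHu a r0.
  have [p0|p0] := eqVneq p 0; last by rewrite IHt.
  by rewrite IHu ?lie_eval_subst0 //; rewrite hr p0 add0r in r0.
Qed.

Lemma lie_eval_congr :
  operad_congr (fun n p (t u : term K Lie_sig n p) => forall a, lie_eval t a = lie_eval u a).
Proof.
split=> /=.
- move=> n p; split=> //=; try by move=> *; rewrite ?(addrA, add0r, scalerA,
    scale1r, scalerDr, scalerDl, scaleN1r, addNr).
  + by move=> x y w xy yw a; rewrite xy.
  + by move=> x x' y y' xx yy a; rewrite xx yy.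
  + by move=> c x x' xx a; rewrite xx.
  + by move=> x y a; rewrite addrC.
- by move=> n p s x x' xx a; rewrite xx.
- move=> m n l p q r hl hr i x x' y y' xx yy a; rewrite xx.
  by congr (lie_eval _ (subst _ _ _ _)).
split=> //=.
- move=> m n l p q r hl hr i x y y' a.
  by rewrite -[X in subst _ _ _ (X + _)]scale1r lie_eval_subst scale1r.
- move=> m n l p q r hl hr i c x y a.
  by rewrite -[_ *: _]addr0 lie_eval_subst lie_eval_subst0 addr0.
- by move=> n p x a; apply: lie_eval_ext => j jn; rewrite nperm1.
- by move=> n p s t x a; apply: lie_eval_ext => j jn; rewrite npermM.
- move=> n p hl hr i x a; rewrite /subst !ord1 /=.
  by apply: lie_eval_ext.
- move=> n p hl hr i x a; apply: lie_eval_ext => j jn; rewrite /subst addn0.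
  case: eqP => [->//|ji]; congr a; rewrite /outer; case: ifP => // _; lia.
- move=> a b c ab bc abc p q r pq qr pqr h1 d1 h2 d2 h3 d3 h4 d4 i j k x y z hk th.
  rewrite (@subst_seq _ _ _ _ _ _ _ _ _ _ h1 (ltn_ord j) hk) (@subst_seq_block _ _ _ _ _ _ _ hk).
  rewrite (_ : (fun t => th (i + (j + t))%N) = (fun t => th (k + t)%N)) //.
  by apply: funext => t; rewrite hk addnA.
- move=> a b c ab ac abc p q r pq pr pqr h1 d1 h2 d2 h3 d3 h4 d4 i k k' i' x y z.
  move=> h1' h2' h3' th.
  (* If [q] is nonzero both sides vanish; otherwise the sign is 1. *)
  have [q0|q0] := eqVneq q 0; last first.
    rewrite (lie_eval_deg y) // (lie_eval_deg y) // lie_eval_subst0.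
    rewrite h3' -(@subst_par _ b c i k k' th _ _ h1' h2').
    by rewrite lie_eval_subst0 scaler0.
  have -> : koszul K q r = 1 by rewrite /koszul q0 mul0n expr0.
  rewrite scale1r h3' -(@subst_par _ b c i k k' th _ _ h1' h2').
  congr lie_eval; congr (subst _ _ _ _).
  + congr (subst _ _ _ _); apply: lie_eval_ext => t tb.
    by rewrite (@subst_par_block2 _ _ _ _ _ _ _ _ h1' h2').
  + by apply: lie_eval_ext => t tb; rewrite (@subst_par_block1 _ _ _ _ _ _ _ _ _ h1' h2').
- move=> m n l p q r hl hr i s t u x y h1 h2 a.
  apply: lie_eval_ext => v vm.
  rewrite (@subst_equiv _ _ _ _ _ _ _ _ _ _ hl vm h1); congr (subst _ _ _ _ _).
  apply: lie_eval_ext => k kn.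
  have il : (i + k < l)%N by have := ltn_ord i; clear -hl kn; lia.
  by rewrite (nperm_ord t kn) (nperm_ord u il) (h2 (Ordinal kn)).
Qed.

Lemma lie_eval_rel n p (y : free_operad K Lie_sig n p) : Lie_rel y ->
  forall a, lie_eval (trepr y) a = lie_eval (tzero K Lie_sig n p) a.
Proof.
(* Values depend only on the class in the free operad, so the chosen representative of a relation
   may be replaced by an explicit term. *)
have HE n' p' (t u : term K Lie_sig n' p') : tcl t = tcl u ->
  forall a, lie_eval t a = lie_eval u a by apply: congr_tcl lie_eval_congr _ _ _ _.
pose g := tgen K (tt : Lie_sig).
pose g2 := tcomp (erefl : 3%N = (2 + 2).-1%N) deg00 ord_max g g.
pose g1 := tcomp (erefl : 3%N = (2 + 2).-1%N) deg00 ord0 g g.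
case=> a.
- rewrite (HE _ _ _ (tadd g (tact (tperm ord0 ord_max) g))); last first.
    by rewrite treprK !tclX.
  rewrite /= -[0%N]/(nat_of_ord (@ord0 1)) -[1%N]/(nat_of_ord (@ord_max 1)).
  by rewrite !npermE tpermL tpermR addrC subrKA subrr.
- rewrite (HE _ _ _ (tadd (tadd g2 (tscale (-1) g1))
      (tscale (-1) (tact (tperm ord0 (lift ord0 ord0)) g2)))); last first.
    by rewrite treprK !tclX !scaleN1r.
  rewrite /= /subst /= /outer /=.
  have E (k : 'I_3) : nperm (tperm ord0 (lift ord0 ord0)) k =
    tperm ord0 (lift ord0 ord0) k :> nat := npermE _ _.
  have -> : nperm (tperm ord0 (lift ord0 (@ord0 1))) 0 = 1%N.
    by rewrite (E ord0) tpermL.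
  have -> : nperm (tperm ord0 (lift ord0 (@ord0 1))) 1 = 0%N.
    by rewrite (E (lift ord0 ord0)) tpermR.
  have -> : nperm (tperm ord0 (lift ord0 (@ord0 1))) 2 = 2%N.
    by rewrite (E ord_max) tpermD.
  rewrite !scaleN1r !(mulmxBl, mulmxBr) !mulmxA.
  move: (a 0%N *m a 1%N *m a 2%N) (a 1%N *m a 0%N *m a 2%N) (a 0%N *m a 2%N *m a 1%N)
    (a 2%N *m a 0%N *m a 1%N) (a 1%N *m a 2%N *m a 0%N) (a 2%N *m a 1%N *m a 0%N) => m1 m2 m3 m4 m5 m6.
  apply/matrixP => i j; rewrite !mxE; ring.
Qed.
End LieModel.

(** * The operad O in a Grassmann algebra *)

Section DerivingModel.
Variables (K : fieldType) (N : nat).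
Local Notation A := 'M[K]_(gdim N).
Implicit Types (th : nat -> A).

(* O acts by exterior multiplication: in a composite, the odd variable plugged into
   input i of the outer operation is the sum of the inputs of the inner one (d is a
   derivation). *)
Fixpoint d_eval n p (t : term K O_sig n p) (th : nat -> A) : A :=
  match t with
  | tgen g => if (g : O_gen) is O_d then th 0%N else 1%:M
  | tzero n p => 0
  | tadd n p t u => d_eval t th + d_eval u th
  | tscale n p c t => c *: d_eval t th
  | tact n p s t => d_eval t (fun j => th (nperm s j))
  | tid => 1%:M
  | tcomp m n l p q r hl hr i t u =>
      d_eval t (subst i n th (\sum_(k < n) th (i + k)%N)) *m
      d_eval u (fun j => th (i + j)%N)
  end.

Lemma d_eval_ext n p (t : term K O_sig n p) th th' :
  (forall j, (j < n)%N -> th j = th' j) -> d_eval t th = d_eval t th'.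
Proof.
elim: t th th' => {n p} /=.
- by case=> th th' E //; apply: E.
- by [].
- by move=> n p t IHt u IHu th th' E; rewrite (IHt th th') ?(IHu th th').
- by move=> n p c t IHt th th' E; rewrite (IHt th th').
- by move=> n p s t IHt th th' E; apply: IHt => j jn; rewrite E ?nperm_lt.
- by [].
- move=> m n l p q r hl hr i t IHt u IHu th th' E.
  have E' j : (j < n)%N -> th (i + j)%N = th' (i + j)%N.
    by move=> jn; rewrite E //; have := ltn_ord i; clear -jn hl; lia.
  rewrite (IHu _ (fun j => th' (i + j)%N)) //; congr (_ *m _).
  rewrite (eq_bigr (fun k : 'I_n => th' (i + k)%N)) => [|k _]; last exact: E'.
  by apply: IHt => j jm; apply: (@subst_lt _ _ _ _ _ _ _ _ _ hl jm E).
Qed.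

Definition godd th := forall j, gpar true (th j).

Lemma godd_subst th i n : godd th -> godd (subst i n th (\sum_(k < n) th (i + k)%N)).
Proof.
move=> oth j; rewrite /subst; case: eqP => // _.
by apply: (@gpar_sum _ _ _ _ (fun k => th (i + k)%N)).
Qed.

(** Degree in O becomes Grassmann parity, so that graded commutativity of values reproduces Koszul
    signs. *)
Lemma d_eval_par n p (t : term K O_sig n p) th :
  godd th -> gpar (odd `|p|%N) (d_eval t th).
Proof.
elim: t th => {n p} /=.
- by case=> th oth //=; apply: gpar1.
- by move=> *; apply: gpar0.
- by move=> n p t IHt u IHu th oth; apply: gparD; [apply: IHt|apply: IHu].
- by move=> n p c t IHt th oth; apply/gparZ/IHt.
- by move=> n p s t IHt th oth; apply: IHt.
- by move=> *; apply: gpar1.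
- move=> m n l p q r hl hr i t IHt u IHu th oth.
  rewrite hr odd_abszD; apply: gpar_mul; first by apply/IHt/godd_subst.
  by apply: IHu.
Qed.

(** The total of the odd variables does not change when a block is replaced by its sum; iterated
    composites therefore agree. *)
Lemma sum_subst b c bc j (f : nat -> A) : bc = (b + c).-1 -> (j < b)%N ->
  \sum_(t < b) subst j c f (\sum_(k < c) f (j + k)%N) t = \sum_(t < bc) f t.
Proof.
move=> -> jb; have {jb} -> : b = (j + (b - j).-1.+1)%N by lia.
move: (b - j).-1 => d.
have -> : (j + d.+1 + c).-1 = (j + (c + d))%N by lia.
rewrite big_split_ord [in RHS]big_split_ord /= big_ord_recl /=; congr (_ + _).
  apply: eq_bigr => k _; rewrite /subst /outer.
  by have kj := ltn_ord k; rewrite ifF ?kj //; clear -kj; lia.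
rewrite big_split_ord /= {1}/subst addn0 eqxx; congr (_ + _).
apply: eq_bigr => k _; rewrite /subst /outer /bump /=.
by rewrite ifF ?ifF; [congr f|..]; lia.
Qed.

(** Only odd arguments are allowed: the sign in the parallel axiom is exactly the one for exchanging
    the values of the two inner operations. *)
Lemma d_eval_congr : operad_congr (fun n p (t u : term K O_sig n p) =>
  forall th, godd th -> d_eval t th = d_eval u th).
Proof.
split=> /=.
- move=> n p; split=> //=; try by move=> *; rewrite ?(addrA, add0r, scalerA,
    scale1r, scalerDr, scalerDl, scaleN1r, addNr).
  + by move=> x y xy th oth; rewrite xy.
  + by move=> x y w xy yw th oth; rewrite xy ?yw.
  + by move=> x x' y y' xx yy th oth; rewrite xx ?yy.
  + by move=> c x x' xx th oth; rewrite xx.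
  + by move=> x y th oth; rewrite addrC.
- by move=> n p s x x' xx th oth; rewrite xx.
- move=> m n l p q r hl hr i x x' y y' xx yy th oth.
  by rewrite xx ?yy //; apply: godd_subst.
split=> //=.
- by move=> *; rewrite mulmxDl.
- by move=> *; rewrite scalemxAl.
- by move=> *; rewrite mulmxDr.
- by move=> *; rewrite scalemxAr.
- by move=> n p x th _; apply: d_eval_ext => j jn; rewrite nperm1.
- by move=> n p s t x th _; apply: d_eval_ext => j jn; rewrite npermM.
- move=> n p hl hr i x th _; rewrite mul1mx !ord1 /=.
  by apply: d_eval_ext.
- move=> n p hl hr i x th _; rewrite mulmx1; apply: d_eval_ext => j jn.
  rewrite /subst big_ord1 addn0; case: eqP => [->//|ji].
  by congr th; rewrite /outer; case: ifP => // _; lia.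
- move=> a b c ab bc abc p q r pq qr pqr h1 d1 h2 d2 h3 d3 h4 d4 i j k x y z hk th _.
  rewrite (@subst_seq _ _ _ _ _ _ _ _ _ _ h1 (ltn_ord j) hk) (@subst_seq_block _ _ _ _ _ _ _ hk).
  rewrite (_ : (fun t => th (i + (j + t))%N) = (fun t => th (k + t)%N)); last first.
    by apply: funext => t; rewrite hk addnA.
  rewrite mulmxA; congr (_ *m _ *m _).
    congr (d_eval x _); congr (subst _ _ _ _).
    rewrite -(@sum_subst _ _ _ _ (fun t => th (i + t)%N) h1 (ltn_ord j)).
    apply: eq_bigr => t _.
    rewrite -(@subst_seq_block _ _ _ _ _ _ _ hk); congr (subst _ _ _ _ _).
    by apply: eq_bigr => s _; rewrite hk addnA.
  congr (d_eval y _); congr (subst _ _ _ _).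
  by apply: eq_bigr => s _; rewrite hk addnA.
- move=> a b c ab ac abc p q r pq pr pqr h1 d1 h2 d2 h3 d3 h4 d4 i k k' i' x y z.
  move=> h1' h2' h3' th oth.
  rewrite -!mulmxA [d_eval y _ *m _](gpar_comm (b := odd `|q|%N) (b' := odd `|r|%N)); first 1 last.
  + by apply: d_eval_par => j; apply: godd_subst.
  + by apply: d_eval_par => j.
  rewrite -scalemxAr koszulE h3' -(@subst_par _ b c i k k' th _ _ h1' h2').
  congr (_ *: _); congr (_ *m _); last congr (_ *m _).
    congr (d_eval x _); congr (subst _ _ _ _); first congr (subst _ _ _ _).
  + by apply: eq_bigr => t _; rewrite (@subst_par_block2 _ _ _ _ _ _ _ _ h1' h2').
  + by apply: eq_bigr => t _; rewrite (@subst_par_block1 _ _ _ _ _ _ _ _ _ h1' h2').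
  + congr (d_eval z _).
    by apply: funext => t; rewrite (@subst_par_block2 _ _ _ _ _ _ _ _ h1' h2').
  + by apply: d_eval_ext => t tb; rewrite (@subst_par_block1 _ _ _ _ _ _ _ _ _ h1' h2').
- move=> m n l p q r hl hr i s t u x y h1 h2 th oth.
  have hk (k : 'I_n) : th (nperm u (i + k)) = th (s i + t k)%N.
    have il : (i + k < l)%N by have := ltn_ord i; have := ltn_ord k; clear -hl; lia.
    by rewrite (nperm_ord u il) (h2 k).
  congr (_ *m _).
    apply: d_eval_ext => v vm.
    rewrite (@subst_equiv _ _ _ _ _ _ _ _ _ _ hl vm h1); congr (subst _ _ _ _ _).
    rewrite (reindex_inj (@perm_inj _ t)); apply: eq_bigr => k _.
    by rewrite hk.
  apply: d_eval_ext => k kn.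
  by rewrite (nperm_ord t kn) -hk.
Qed.

Lemma d_eval_rel n p (y : free_operad K O_sig n p) : O_rel y ->
  forall th, godd th -> d_eval (trepr y) th = d_eval (tzero K O_sig n p) th.
Proof.
have HE n' p' (t u : term K O_sig n' p') : tcl t = tcl u ->
  forall th, godd th -> d_eval t th = d_eval u th
  by apply: congr_tcl d_eval_congr _ _ _ _.
pose d : term K O_sig 1 1 := tgen K (O_d : O_sig).
pose m : term K O_sig 2 0 := tgen K (O_mul : O_sig).
case=> th oth.
- rewrite (HE _ _ _ (tadd m (tscale (-1) (tact (tperm ord0 ord_max) m)))) //; last first.
    by rewrite treprK !tclX scaleN1r.
  by rewrite /= scaleN1r subrr.
- rewrite (HE _ _ _ (tcomp (erefl : 1%N = (1 + 1).-1%N) deg11 ord0 d d)) //; last first.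
    by rewrite treprK !tclX.
  by rewrite /= /subst /= big_ord1 addn0 gpar_sq.
- rewrite (HE _ _ _ (tadd (tadd (tcomp (erefl : 2%N = (1 + 2).-1%N) deg10 ord0 d m)
      (tscale (-1) (tcomp (erefl : 2%N = (2 + 1).-1%N) deg01 ord0 m d)))
      (tscale (-1) (tcomp (erefl : 2%N = (2 + 1).-1%N) deg01 ord_max m d)))) //; last first.
    by rewrite treprK !tclX !scaleN1r.
  rewrite /= /subst /= !big_ord_recl big_ord0 /= mulmx1 !mul1mx !scaleN1r !addn0.
  by rewrite addr0 addrAC addrK subrr.
- rewrite (HE _ _ _ (tadd (tcomp (erefl : 3%N = (2 + 2).-1%N) deg00 ord0 m m)
      (tscale (-1) (tcomp (erefl : 3%N = (2 + 2).-1%N) deg00 ord_max m m)))) //; last first.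
    by rewrite treprK !tclX scaleN1r.
  by rewrite /= mul1mx scaleN1r subrr.
Qed.
End DerivingModel.

(** * The relations of Lie, LL and O *)

Lemma perm3P (s t : 'S_3) : s ord0 = t ord0 ->
  s (lift ord0 ord0) = t (lift ord0 ord0) -> s ord_max = t ord_max -> s = t.
Proof.
move=> s0 s1 s2; apply/permP => -[[|[|[|//]]] j3].
- by rewrite (_ : Ordinal j3 = ord0) //; apply: val_inj.
- by rewrite (_ : Ordinal j3 = lift ord0 ord0) //; apply: val_inj.
- by rewrite (_ : Ordinal j3 = ord_max) //; apply: val_inj.
Qed.

Section Swaps.
Variables (K : fieldType) (P : operad K).
Let L := op_ok P.

Lemma swap12K p : involutive (@swap12 K P p).
Proof. by move=> x; rewrite /swap12 -(ol_actM L) tperm2 (ol_act1 L). Qed.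
Lemma comp1_tau (p q r : int) (hr : r = p + q) (x : P 2%N p) (y : P 2%N q) :
  comp1 hr x (tau y) = swap12 (comp1 hr x y).
Proof.
rewrite /comp1 /tau /swap12.
have [u [u1 u2 ->]] := op_comp_actr (erefl : 3%N = (2 + 2).-1%N) hr ord0
  (tperm ord0 ord_max) x y.
congr op_act; apply: perm3P.
- by apply: val_inj; rewrite /= (u2 ord0) // !tpermL.
- by apply: val_inj; rewrite /= (u2 ord_max) // !tpermR.
- by rewrite (u1 ord_max) // tpermD.
Qed.

Lemma op_comp_swap12 (p q r : int) (hl : 3%N = (3 + 1).-1%N) (hr : r = p + q)
    (i : 'I_3) (x : P 3%N p) (y : P 1%N q) :
  op_comp hl hr (tperm ord0 (lift ord0 ord0) i) (swap12 x) y = swap12 (op_comp hl hr i x y).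
Proof.
rewrite /swap12.
have [u [u1 u2 E]] := op_comp_act hl hr i (tperm ord0 (lift ord0 (@ord0 1))) 1%g x y.
rewrite (ol_act1 L) in E; rewrite E; congr op_act; apply/permP => j; apply: val_inj.
have outer1 (k m : 'I_3) : m != k -> outer k 1 m = m.
  by rewrite /outer -val_eqE /=; case: ltngtP => // km _; rewrite addn1.
case: (eqVneq j i) => [->|ji].
  by rewrite /= (u2 ord0) /= ?addn0 // perm1 addn0.
by rewrite /= (u1 _ j ji) ?outer1 // (inj_eq perm_inj).
Qed.
End Swaps.

(** * Consequences of the LL relations for a pair of brackets *)

Section BracketRelations.
Variables (K : fieldType) (P : operad K) (par : P 2%N 0) (br : P 2%N 1).
Let L := op_ok P.

Definition brG (g : bool) : P 2%N (dg g) :=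
  match g return P 2%N (dg g) with true => br | false => par end.

Hypothesis anti : par + tau par = 0.
Hypothesis rel1 : comp2 deg11 br br + comp1 deg11 br br + swap12 (comp2 deg11 br br) = 0.
Hypothesis rel2 : comp2 deg10 br par - comp1 deg01 par br - swap12 (comp2 deg01 par br) = 0.
Hypothesis rel3 : comp1 deg10 br par - comp1 deg01 par br + comp1 deg01 par (tau br) = 0.
Hypothesis rel4 : comp2 deg00 par par - comp1 deg00 par par - swap12 (comp2 deg00 par par) = 0.

(** Three of the left-nested composites are solved from a single relation. For [(1,2),3], [rel3]
    leads to ([1,2],3) and its transposed form, and [rel2] then expands both. *)
Lemma br_normal3 (trk : bool) g g' (p : int) (hr : p = dg g + dg g') :
  (trk -> g = false) -> normal3 brG trk g' false (comp1 hr (brG g) (brG g')).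
Proof.
case: g g' hr => [] [] hr tg /=.
- have ep : p = 2 := hr.
  move: hr; rewrite ep => hr; rewrite (eq_irrelevance hr deg11).
  have -> : comp1 deg11 br br =
      -1 *: comp2 deg11 br br + -1 *: swap12 (comp2 deg11 br br).
    apply/eqP; rewrite -subr_eq0 !scaleN1r opprD !opprK addrCA addrA; exact/eqP.
  apply: N3_add; apply: N3_scale.
    by apply: (@N3_comp _ _ _ _ _ _ true true) => // /tg.
  by apply: (@N3_swap _ _ _ _ _ _ true true) => // /tg.
- have ep : p = 1 := hr.
  move: hr; rewrite ep => hr; rewrite (eq_irrelevance hr deg10).
  have -> : comp1 deg10 br par =
      (comp2 deg10 br par + -1 *: swap12 (comp2 deg01 par br)) +
      (-1 *: swap12 (comp2 deg10 br par) + comp2 deg01 par br).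
    have E1 : comp1 deg01 par br = comp2 deg10 br par - swap12 (comp2 deg01 par br).
      by apply/eqP; rewrite eq_sym -subr_eq0 addrAC; exact/eqP.
    have -> : comp1 deg10 br par = comp1 deg01 par br - swap12 (comp1 deg01 par br).
      by apply/eqP; rewrite -subr_eq0 opprB addrCA addrC -comp1_tau; exact/eqP.
    rewrite E1 !scaleN1r; congr (_ + _).
    have := swap12K (comp2 deg01 par br).
    rewrite /swap12 op_actB opprB addrC => ->; by rewrite addrC.
  (* The four resulting terms do not share a set of derived inputs; this case occurs only without
     tracking. *)
  have nt : trk -> False by move/tg.
  apply: N3_add; apply: N3_add; try apply: N3_scale.
  + by apply: (@N3_comp _ _ _ _ _ _ true false) => // /nt.
  + by apply: (@N3_swap _ _ _ _ _ _ false true) => // /nt.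
  + by apply: (@N3_swap _ _ _ _ _ _ true false) => // /nt.
  + by apply: (@N3_comp _ _ _ _ _ _ false true) => // /nt.
- have ep : p = 1 := hr.
  move: hr; rewrite ep => hr; rewrite (eq_irrelevance hr deg01).
  have -> : comp1 deg01 par br =
      comp2 deg10 br par + -1 *: swap12 (comp2 deg01 par br).
    by apply/eqP; rewrite scaleN1r eq_sym -subr_eq0 addrAC; exact/eqP.
  apply: N3_add; last apply: N3_scale.
  + by apply: (@N3_comp _ _ _ _ _ _ true false).
  + by apply: (@N3_swap _ _ _ _ _ _ false true).
- have ep : p = 0 := hr.
  move: hr; rewrite ep => hr; rewrite (eq_irrelevance hr deg00).
  have -> : comp1 deg00 par par =
      comp2 deg00 par par + -1 *: swap12 (comp2 deg00 par par).
    by apply/eqP; rewrite scaleN1r eq_sym -subr_eq0 addrAC; exact/eqP.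
  apply: N3_add; last apply: N3_scale.
  + by apply: (@N3_comp _ _ _ _ _ _ false false).
  + by apply: (@N3_swap _ _ _ _ _ _ false false).
Qed.

Lemma br_sym : exists c : K, brG false = c *: tau (brG false).
Proof. by exists (-1); rewrite scaleN1r /=; apply/eqP; rewrite -addr_eq0 anti. Qed.

Lemma br_comp_GB : exists c : K,
  forall (hl : 2%N = (2 + 1).-1%N) (hr : 1 = 0 + 1),
  op_comp hl hr ord0 (brG false) (0 : P 1%N 1) = c *: brG true.
Proof. by exists 0 => hl hr; rewrite op_comp0r scale0r. Qed.
Lemma br_comp_GB0 : forall (r : int) (hl : 2%N = (2 + 1).-1%N) (hr : r = 1 + 1),
  op_comp hl hr ord0 (brG true) (0 : P 1%N 1) = 0.
Proof. by move=> *; rewrite op_comp0r. Qed.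
Lemma br_comp_B n q e (y : P n q) : rspan brG 0 false false e y ->
  forall l (r : int) (hl : l = (1 + n).-1%N) (hr : r = 1 + q) i,
  rspan brG 0 false false e (op_comp hl hr i (0 : P 1%N 1) y).
Proof. by move=> *; rewrite op_comp0l; apply: RS_0. Qed.

Lemma br_rspan_comp m n (p q : int) e (x : P m p) (y : P n q) l r
    (hl : l = (m + n).-1%N) (hr : r = p + q) i :
  rspan brG 0 false false e x -> rspan brG 0 false false e y ->
  rspan brG 0 false false e (op_comp hl hr i x y).
Proof.
move=> Hx Hy; exact: (rspan_comp br_normal3 br_comp_GB br_comp_GB0 br_comp_B Hx Hy).
Qed.

Lemma br_move_last n p e (x : P n p) : rspan brG 0 true false e x ->
  forall (t : 'S_n) (e' : nat -> bool), (forall j : 'I_n, e' (t j) = e j) ->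
  e' n.-1 = false -> rspan brG 0 true true e' (op_act t x).
Proof. exact: (rspan_move_last br_normal3 br_comp_GB br_comp_GB0 br_sym). Qed.
End BracketRelations.

Section PresentedRelations.
Variables (K : fieldType) (X : signature).
Variable R : forall n p, free_operad K X n p -> Prop.

Definition pcl n p (x : free_operad K X n p) : presented R n p := qcl (ideal_gen R) x.

Lemma pclD n p (x y : free_operad K X n p) : pcl (x + y) = pcl x + pcl y.
Proof. exact: qclD. Qed.
Lemma pclZ n p a (x : free_operad K X n p) : pcl (a *: x) = a *: pcl x.
Proof. exact: qclZ. Qed.
Lemma pclB n p (x y : free_operad K X n p) : pcl (x - y) = pcl x - pcl y.
Proof. by rewrite pclD -scaleN1r pclZ scaleN1r. Qed.
Lemma pcl_act n p (s : 'S_n) (x : free_operad K X n p) : pcl (op_act s x) = op_act s (pcl x).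
Proof. exact: qcl_act. Qed.
Lemma pcl_comp m n l (p q r : int) (hl : l = (m + n).-1%N) (hr : r = p + q) i
    (x : free_operad K X m p) (y : free_operad K X n q) :
  pcl (op_comp hl hr i x y) = op_comp hl hr i (pcl x) (pcl y).
Proof. exact: qcl_comp. Qed.
Lemma pcl_rel n p (x : free_operad K X n p) : R x -> pcl x = 0.
Proof. by move=> Rx; apply/qclE => I HI; rewrite subr0; apply: HI. Qed.
End PresentedRelations.

Definition pclE := (pclB, pclD, pclZ, pcl_act, pcl_comp).

(** * Lie, as a pair of brackets with zero odd bracket *)

Section LieOperad.
Variable K : fieldType.
Local Notation Lie := (operad_Lie K).

Definition lie_par : Lie 2%N 0 := pgen (@Lie_rel K) (tt : Lie_sig).
Definition lieG := brG lie_par (0 : Lie 2%N 1).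

Lemma lie_anti : lie_par + tau lie_par = 0.
Proof. by have := pcl_rel (@Lie_anti K); rewrite /tau !pclE. Qed.
Lemma lie_jacobi : comp2 deg00 lie_par lie_par - comp1 deg00 lie_par lie_par
  - swap12 (comp2 deg00 lie_par lie_par) = 0.
Proof. by have := pcl_rel (@Lie_jacobi K); rewrite /comp2 /comp1 /swap12 !pclE. Qed.

Lemma lie_rel1 : comp2 deg11 (0 : Lie 2%N 1) (0 : Lie 2%N 1) + comp1 deg11 0 0
  + swap12 (comp2 deg11 0 0) = 0.
Proof. by rewrite /comp1 /comp2 /swap12 !op_comp0r op_act0 !addr0. Qed.
Lemma lie_rel2 : comp2 deg10 (0 : Lie 2%N 1) lie_par - comp1 deg01 lie_par 0
  - swap12 (comp2 deg01 lie_par 0) = 0.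
Proof. by rewrite /comp1 /comp2 /swap12 !op_comp0r !op_comp0l op_act0 !subr0. Qed.
Lemma lie_rel3 : comp1 deg10 (0 : Lie 2%N 1) lie_par - comp1 deg01 lie_par 0
  + comp1 deg01 lie_par (tau 0) = 0.
Proof. by rewrite /comp1 /tau op_comp0l op_act0 !op_comp0r subr0 addr0. Qed.

Lemma lie_rspan n p (x : Lie n p) : rspan lieG 0 false false (fun=> false) x.
Proof.
elim/presented_ind: x => {n p}.
- by case; apply: (@rspan_G _ _ lieG 0 false false false).
- by move=> *; apply: RS_0.
- by move=> *; apply: RS_add.
- by move=> *; apply: RS_scale.
- by move=> n p s x Hx; apply: RS_act Hx.
- exact: RS_id.
- by move=> m n l p q r hl hr i x y; apply: br_rspan_comp;
    [apply: lie_rel1|apply: lie_rel2|apply: lie_rel3|apply: lie_jacobi].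
Qed.

Lemma lie_move_last n p e (x : Lie n p) : rspan lieG 0 true false e x ->
  forall (t : 'S_n) (e' : nat -> bool), (forall j : 'I_n, e' (t j) = e j) ->
  e' n.-1 = false -> rspan lieG 0 true true e' (op_act t x).
Proof. exact: (br_move_last lie_anti lie_rel1 lie_rel2 lie_rel3 lie_jacobi). Qed.

Lemma lie_rspan_tracked fx n p (e : nat -> bool) (x : Lie n p) j : (j < n)%N -> e j ->
  rspan lieG 0 true fx e x -> x = 0.
Proof.
move=> jn ej Hx; elim: Hx j jn ej => {n p e x} //.
- by move=> e /(_ isT) e0 [] // _; rewrite e0.
- move=> n l q r g hl hr e e0 y /(_ isT) eg ee0 _ IH [_|j jn] ej.
    by move: eg hr; rewrite ej => <- hr; rewrite op_comp0l.
  have jn' : (j < n)%N by clear -jn hl; lia.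
  by rewrite (IH j) ?op_comp0r // -ee0.
- move=> n p s e e0 x _ ee0 _ IH j jn ej.
  rewrite (IH (s^-1%g (Ordinal jn))) ?op_act0 //.
  by rewrite -ee0 permKV.
- by move=> n p e x y _ IHx _ IHy j jn ej; rewrite (IHx j) // (IHy j) // addr0.
- by move=> n p e a x _ IHx j jn ej; rewrite (IHx j) // scaler0.
Qed.

(** A piece with a derived input contains the zero bracket, so only the empty set survives. The
    tracked form is the one to which [lie_move_last] applies. *)
Lemma lie_rspan0 n p (x : Lie n p) : rspan lieG 0 true false (fun=> false) x.
Proof.
have [y -> Hy] := rspan_split (lie_rspan x).
apply: (big_ind (rspan lieG 0 true false (fun=> false))) => [||e _].
- exact: RS_0.
- by move=> *; apply: RS_add.
case: (pickP (fun j : 'I_n => e j)) => [j ej|e0].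
  rewrite (@lie_rspan_tracked false n p (ffnat e) (y e) j) ?ffnatE //; exact: RS_0.
by apply: rspan_ext (Hy e) => j jn; rewrite -[j]/(nat_of_ord (Ordinal jn)) ffnatE e0.
Qed.
End LieOperad.

(** * LL, spanned by right-normed monomials *)

Section LLOperad.
Variable K : fieldType.
Local Notation LL := (operad_LL K).

Definition ll_par : LL 2%N 0 := pgen (@LL_rel K) (LL_par : LL_sig).
Definition ll_br : LL 2%N 1 := pgen (@LL_rel K) (LL_br : LL_sig).
Definition llG := brG ll_par ll_br.

Lemma ll_anti : ll_par + tau ll_par = 0.
Proof. by have := pcl_rel (@LL_anti K); rewrite /tau !pclE. Qed.
Lemma ll_rel1 : comp2 deg11 ll_br ll_br + comp1 deg11 ll_br ll_br
  + swap12 (comp2 deg11 ll_br ll_br) = 0.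
Proof. by have := pcl_rel (@LL_rel1 K); rewrite /comp2 /comp1 /swap12 !pclE. Qed.
Lemma ll_rel2 : comp2 deg10 ll_br ll_par - comp1 deg01 ll_par ll_br
  - swap12 (comp2 deg01 ll_par ll_br) = 0.
Proof. by have := pcl_rel (@LL_rel2 K); rewrite /comp2 /comp1 /swap12 !pclE. Qed.
Lemma ll_rel3 : comp1 deg10 ll_br ll_par - comp1 deg01 ll_par ll_br
  + comp1 deg01 ll_par (tau ll_br) = 0.
Proof. by have := pcl_rel (@LL_rel3 K); rewrite /comp2 /comp1 /tau !pclE. Qed.
Lemma ll_rel4 : comp2 deg00 ll_par ll_par - comp1 deg00 ll_par ll_par
  - swap12 (comp2 deg00 ll_par ll_par) = 0.
Proof. by have := pcl_rel (@LL_rel4 K); rewrite /comp2 /comp1 /swap12 !pclE. Qed.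

Lemma ll_rspan n p (x : LL n p) : rspan llG 0 false false (fun=> false) x.
Proof.
elim/presented_ind: x => {n p}.
- by case; [apply: (@rspan_G _ _ llG 0 false false false)
           |apply: (@rspan_G _ _ llG 0 false false true)].
- by move=> *; apply: RS_0.
- by move=> *; apply: RS_add.
- by move=> *; apply: RS_scale.
- by move=> n p s x Hx; apply: RS_act Hx.
- exact: RS_id.
- by move=> m n l p q r hl hr i x y; apply: br_rspan_comp;
    [apply: ll_rel1|apply: ll_rel2|apply: ll_rel3|apply: ll_rel4].
Qed.

Lemma ll_move_last n p e (x : LL n p) : rspan llG 0 true false e x ->
  forall (t : 'S_n) (e' : nat -> bool), (forall j : 'I_n, e' (t j) = e j) ->
  e' n.-1 = false -> rspan llG 0 true true e' (op_act t x).
Proof. exact: (br_move_last ll_anti ll_rel1 ll_rel2 ll_rel3 ll_rel4). Qed.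
End LLOperad.

(** * O, with odd bracket d(x)1 *)

Section DerivingOperad.
Variable K : fieldType.
Local Notation O := (operad_O K).
Let L := op_ok O.

Definition o_mul : O 2%N 0 := pgen (@O_rel K) (O_mul : O_sig).
Definition o_d : O 1%N 1 := pgen (@O_rel K) (O_d : O_sig).

Local Notation e112 := (erefl : 1%N = (1 + 1).-1%N).
Local Notation e122 := (erefl : 2%N = (1 + 2).-1%N).
Local Notation e212 := (erefl : 2%N = (2 + 1).-1%N).
Local Notation e223 := (erefl : 3%N = (2 + 2).-1%N).
Local Notation e313 := (erefl : 3%N = (3 + 1).-1%N).
Local Notation o1 := (lift ord0 ord0 : 'I_3).

Definition o_md : O 2%N 1 := op_comp e212 deg01 ord0 o_mul o_d.
Definition o_dm : O 2%N 1 := op_comp e212 deg01 ord_max o_mul o_d.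
Definition oG := brG o_mul o_md.

Lemma o_comm : tau o_mul = o_mul.
Proof.
have := pcl_rel (@O_comm K); rewrite /tau !pclE => /eqP.
by rewrite subr_eq0 => /eqP.
Qed.
Lemma o_dd : op_comp e112 deg11 ord0 o_d o_d = 0.
Proof. by have := pcl_rel (@O_dd K); rewrite !pclE. Qed.
Lemma o_der : op_comp e122 deg10 ord0 o_d o_mul = o_md + o_dm.
Proof.
have := pcl_rel (@O_der K); rewrite !pclE => /eqP.
by rewrite subr_eq add0r subr_eq addrC => /eqP.
Qed.
Lemma o_assoc : comp1 deg00 o_mul o_mul = comp2 deg00 o_mul o_mul.
Proof.
have := pcl_rel (@O_assoc K); rewrite /comp1 /comp2 !pclE => /eqP.
by rewrite subr_eq0 => /eqP.
Qed.

Definition o_m3 : O 3%N 0 := comp2 deg00 o_mul o_mul.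
Definition o_x1 : O 3%N 1 := op_comp e313 deg01 ord0 o_m3 o_d.
Definition o_x2 : O 3%N 1 := op_comp e313 deg01 o1 o_m3 o_d.
(** The order matters: inserting the two d's the other way round changes the sign, which is why
    [o_swap_x12] has one. *)
Definition o_x12 : O 3%N 2 := op_comp e313 deg11 o1 o_x1 o_d.

Lemma o_comp_md (hr : 1 = 0 + 1) : comp1 hr o_mul o_md = o_x1.
Proof.
rewrite (eq_irrelevance hr deg01) /comp1 /o_md /o_x1 /o_m3 -o_assoc.
exact: (@ol_seq _ _ _ _ _ _ _ _ L 2 2 1 3 2 3 0 0 1 0 1 1).
Qed.
Lemma o_comp1_dm : comp1 deg01 o_mul o_dm = o_x2.
Proof.
rewrite /comp1 /o_dm /o_x2 /o_m3 -o_assoc.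
exact: (@ol_seq _ _ _ _ _ _ _ _ L 2 2 1 3 2 3 0 0 1 0 1 1).
Qed.
Lemma o_md_mul (hr : 1 = 1 + 0) : comp2 hr o_md o_mul = o_x1.
Proof.
rewrite (eq_irrelevance hr deg10) /comp2 /o_md /o_x1 /o_m3.
rewrite (@ol_par _ _ _ _ _ _ _ _ L 2 1 2 2 3 3 0 1 0 1 0 1
  e212 deg01 e223 deg10 e223 deg00 e313 deg01 ord0 ord_max ord_max ord0) //.
by rewrite /koszul muln0 expr0 scale1r.
Qed.
Lemma o_mul_md (hr : 1 = 0 + 1) : comp2 hr o_mul o_md = o_x2.
Proof.
rewrite (eq_irrelevance hr deg01) /comp2 /o_md /o_x2 /o_m3.
exact: (@ol_seq _ _ _ _ _ _ _ _ L 2 2 1 3 2 3 0 0 1 0 1 1).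
Qed.
Lemma o_md_md (hr : 2 = 1 + 1) : comp2 hr o_md o_md = o_x12.
Proof.
rewrite (eq_irrelevance hr deg11) /comp2 {2}/o_md /o_x12 -(o_md_mul deg10).
exact: (@ol_seq _ _ _ _ _ _ _ _ L 2 2 1 3 2 3 1 0 1 1 1 2).
Qed.

(** By the Leibniz rule the outer d meets either the inner one, where dd = 0, or the second slot;
    there, exchanging the two d's costs the sign. *)
Lemma o_d_md (hr : 2 = 1 + 1) : op_comp e122 hr ord0 o_d o_md =
  - op_comp e212 deg11 ord_max o_md o_d.
Proof.
rewrite (eq_irrelevance hr deg11) {1}/o_md.
rewrite (@ol_seq _ _ _ _ _ _ _ _ L 1 2 1 2 2 2 1 0 1 1 1 2
  e212 deg01 e122 deg11 e122 deg10 e212 deg11 ord0 ord0 ord0) //.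
rewrite o_der (ol_compDl L) {1}/o_md /o_dm.
rewrite -(@ol_seq _ _ _ _ _ _ _ _ L 2 1 1 2 1 2 0 1 1 1 2 2
  e112 deg11 e212 (esym (add0r 2)) e212 deg01 e212 deg11 ord0 ord0 ord0) //.
rewrite o_dd op_comp0r add0r /o_md.
rewrite (@ol_par _ _ _ _ _ _ _ _ L 2 1 1 2 2 2 0 1 1 1 1 2
  e212 deg01 e212 deg11 e212 deg01 e212 deg11 ord0 ord_max ord_max ord0) //.
by rewrite /koszul expr1 scaleN1r opprK.
Qed.

Lemma o_md_d (r : int) (hl : 2%N = (2 + 1).-1%N) (hr : r = 1 + 1) :
  op_comp hl hr ord0 o_md o_d = 0.
Proof.
have er : r = 2 by rewrite hr.
move: hr; rewrite er => hr.
rewrite (eq_irrelevance hr deg11) (eq_irrelevance hl e212) /o_md.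
rewrite -(@ol_seq _ _ _ _ _ _ _ _ L 2 1 1 2 1 2 0 1 1 1 2 2
  e112 deg11 e212 (esym (add0r 2)) e212 deg01 e212 deg11 ord0 ord0 ord0) //.
by rewrite o_dd op_comp0r.
Qed.

Lemma o_comp1_md_mul (hr : 1 = 1 + 0) : comp1 hr o_md o_mul = o_x1 + o_x2.
Proof.
rewrite (eq_irrelevance hr deg10) /comp1 {1}/o_md.
rewrite -(@ol_seq _ _ _ _ _ _ _ _ L 2 1 2 2 2 3 0 1 0 1 1 1
  e122 deg10 e223 deg01 e212 deg01 e223 deg10 ord0 ord0 ord0) //.
rewrite o_der (ol_compDr L).
by rewrite -(o_comp_md deg01) -o_comp1_dm.
Qed.

Lemma o_comp1_md_md (hr : 2 = 1 + 1) : comp1 hr o_md o_md = - o_x12.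
Proof.
rewrite (eq_irrelevance hr deg11) /comp1 {1}/o_md.
rewrite -(@ol_seq _ _ _ _ _ _ _ _ L 2 1 2 2 2 3 0 1 1 1 2 2
  e122 deg11 e223 (esym (add0r 2)) e212 deg01 e223 deg11 ord0 ord0 ord0) //.
rewrite o_d_md -scaleN1r (ol_compZr L) scaleN1r; congr (- _).
rewrite (@ol_seq _ _ _ _ _ _ _ _ L 2 2 1 3 2 3 0 1 1 1 2 2
  e212 deg11 e223 (esym (add0r 2)) e223 deg01 e313 deg11 ord0 ord_max o1) //.
by rewrite -/(comp1 deg01 o_mul o_md) o_comp_md.
Qed.

Lemma o_swap_m3 : swap12 o_m3 = o_m3.
Proof. by rewrite /o_m3 -o_assoc -comp1_tau o_comm. Qed.
Lemma o_swap_x1 : swap12 o_x1 = o_x2.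
Proof.
rewrite /o_x1 -op_comp_swap12 o_swap_m3 /o_x2.
by apply: op_comp_irr; rewrite tpermL.
Qed.
Lemma o_swap_x2 : swap12 o_x2 = o_x1.
Proof. by rewrite -o_swap_x1 swap12K. Qed.
Lemma o_swap_x12 : swap12 o_x12 = - o_x12.
Proof.
rewrite /o_x12 -op_comp_swap12 o_swap_x1 tpermR /o_x1 /o_x2.
rewrite [in RHS](@ol_par _ _ _ _ _ _ _ _ L 3 1 1 3 3 3 0 1 1 1 1 2
  e313 deg01 e313 deg11 e313 deg01 e313 deg11 ord0 o1 o1 ord0) //.
by rewrite /koszul expr1 scaleN1r opprK.
Qed.

Lemma o_normal3 (trk : bool) g g' (p : int) (hr : p = dg g + dg g') :
  (trk -> g = false) -> normal3 oG trk g' false (comp1 hr (oG g) (oG g')).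
Proof.
case: g g' hr => [] [] hr tg.
- have nt : trk -> False by move/tg.
  have ep : p = 2 := hr.
  move: hr; rewrite ep => hr.
  rewrite (o_comp1_md_md hr : comp1 hr (oG true) (oG true) = _) -(o_md_md deg11) -scaleN1r.
  by apply: N3_scale; apply: (@N3_comp _ _ _ _ _ _ true true) => // /nt.
- have nt : trk -> False by move/tg.
  have ep : p = 1 := hr.
  move: hr; rewrite ep => hr.
  rewrite (o_comp1_md_mul hr : comp1 hr (oG true) (oG false) = _).
  rewrite -(o_md_mul deg10) -(o_mul_md deg01).
  apply: N3_add.
    by apply: (@N3_comp _ _ _ _ _ _ true false) => // /nt.
  by apply: (@N3_comp _ _ _ _ _ _ false true) => // /nt.
- have ep : p = 1 := hr.
  move: hr; rewrite ep => hr.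
  rewrite (o_comp_md hr : comp1 hr (oG false) (oG true) = _) -(o_md_mul deg10).
  by apply: (@N3_comp _ _ _ _ _ _ true false).
- have ep : p = 0 := hr.
  move: hr; rewrite ep => hr; rewrite (eq_irrelevance hr deg00).
  rewrite (o_assoc : comp1 deg00 (oG false) (oG false) = _).
  by apply: (@N3_comp _ _ _ _ _ _ false false).
Qed.

Lemma o_comp_GB : exists c : K,
  forall (hl : 2%N = (2 + 1).-1%N) (hr : 1 = 0 + 1),
  op_comp hl hr ord0 (oG false) o_d = c *: oG true.
Proof.
exists 1 => hl hr.
by rewrite (eq_irrelevance hl e212) (eq_irrelevance hr deg01) scale1r.
Qed.

(** Leibniz on {a,y}: d on a turns the product into the odd bracket and kills an odd bracket; d on
    the right argument is handled by induction. *)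
Lemma o_comp_B n q e (y : O n q) : rspan oG o_d false false e y ->
  forall l (r : int) (hl : l = (1 + n).-1%N) (hr : r = 1 + q) i,
  rspan oG o_d false false e (op_comp hl hr i o_d y).
Proof.
elim=> {n q e y}.
- move=> e _ l r hl hr i.
  by apply: (@op_comp_idr _ _ _ _ _ _ _ _ _ _ (fun l r z => rspan oG o_d false false e z)); apply: RS_B.
- move=> e _ _ l r hl hr i.
  have el : l = 1%N := hl.
  have er : r = 2 by rewrite hr.
  move: hl hr; rewrite el er => hl hr.
  rewrite (eq_irrelevance hl e112) (eq_irrelevance hr deg11) (ord1 i) o_dd.
  exact: RS_0.
- move=> n' n q0 q g hn hq e e0 y _ _ Hy IH l r hl hr i.
  have el : l = n := hl.
  move: hl; rewrite el => hl {l el}; rewrite (ord1 i) {i}.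
  have d4 : r = (1 + dg g) + q0 by rewrite hr hq addrA.
  rewrite (@ol_seq _ _ _ _ _ _ _ _ L 1 2 n' 2 n n _ _ _ (1 + dg g) _ _
    hn hq hl hr e122 erefl hn d4 ord0 ord_max ord_max) //.
  have dq : r = dg g + (1 + q0) by rewrite d4 [1 + dg g]addrC addrA.
  (* The term in which d has been pushed past a into the right argument. *)
  have X : rspan oG o_d false false e
      (op_comp hn d4 ord_max (op_comp e212 (addrC 1 (dg g)) ord_max (oG g) o_d) y).
    rewrite -(@ol_seq _ _ _ _ _ _ _ _ L 2 1 n' 2 n' n _ _ _ _ (1 + q0) _
      (erefl : n' = (1 + n').-1%N) erefl hn dq e212 (addrC 1 (dg g)) hn d4 ord_max ord0 ord_max) //.
    apply: (@RS_comp _ _ _ _ _ _ _ _ _ _ _ _ _ _ (fun j => e j.+1)) => //.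
    by apply: rspan_untracked; apply: IH.
  case: g hq hr d4 dq X => hq hr d4 dq X.
  + have -> : op_comp e122 erefl ord0 o_d (oG true) =
        -1 *: op_comp e212 (addrC 1 (dg true)) ord_max (oG true) o_d.
      rewrite scaleN1r -[LHS]/(op_comp e122 (erefl : 2 = 1 + 1) ord0 o_d o_md) o_d_md.
      by congr (- _); apply: op_comp_irr.
    by rewrite (ol_compZl L); apply: RS_scale.
  + have -> : op_comp e122 erefl ord0 o_d (oG false) =
        o_md + op_comp e212 (addrC 1 (dg false)) ord_max (oG false) o_d.
      rewrite -[LHS]/(op_comp e122 deg10 ord0 o_d o_mul) o_der.
      by congr (_ + _); apply: op_comp_irr.
    rewrite (ol_compDl L); apply: RS_add => //.
    apply: (@RS_comp _ _ oG o_d false false _ _ _ _ true _ d4 _ (fun j => e j.+1)) => //.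
    exact: rspan_untracked Hy.
- move=> n p s e e0 x _ ee0 _ IH l r hl hr i.
  have [u [_ u2 ->]] := op_comp_actr hl hr i s o_d x.
  apply: (@RS_act _ _ _ _ _ _ _ _ _ e (fun j => e (nperm u j))) => //.
    by move=> j; rewrite npermE.
  by apply: rspan_untracked; apply: IH.
- by move=> *; rewrite op_comp0r; apply: RS_0.
- by move=> n q e x y _ IHx _ IHy l r hl hr i; rewrite (ol_compDr L); apply: RS_add.
- by move=> n q e a x _ IHx l r hl hr i; rewrite (ol_compZr L); apply: RS_scale.
Qed.

Lemma o_sym : exists c : K, oG false = c *: tau (oG false).
Proof. by exists 1; rewrite scale1r (o_comm : tau (oG false) = _). Qed.

(** The product is commutative and associative and two d's anticommute, so the scalar is -1 exactly
    when both brackets are odd. *)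
Lemma o_Gcomm g h (p : int) (hr : p = dg g + dg h) (hr' : p = dg h + dg g) :
  exists c : K, comp2 hr (oG g) (oG h) = c *: swap12 (comp2 hr' (oG h) (oG g)).
Proof.
case: g h hr hr' => [] [] hr hr'.
- have ep : p = 2 := hr.
  exists (-1); move: hr hr'; rewrite ep => hr hr'.
  rewrite (o_md_md hr : comp2 hr (oG true) (oG true) = _).
  rewrite (o_md_md hr' : comp2 hr' (oG true) (oG true) = _).
  by rewrite o_swap_x12 scaleN1r opprK.
- have ep : p = 1 := hr.
  exists 1; move: hr hr'; rewrite ep => hr hr'.
  rewrite (o_md_mul hr : comp2 hr (oG true) (oG false) = _).
  rewrite (o_mul_md hr' : comp2 hr' (oG false) (oG true) = _).
  by rewrite o_swap_x2 scale1r.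
- have ep : p = 1 := hr.
  exists 1; move: hr hr'; rewrite ep => hr hr'.
  rewrite (o_mul_md hr : comp2 hr (oG false) (oG true) = _).
  rewrite (o_md_mul hr' : comp2 hr' (oG true) (oG false) = _).
  by rewrite o_swap_x1 scale1r.
- have ep : p = 0 := hr.
  exists 1; move: hr hr'; rewrite ep => hr hr'.
  rewrite (eq_irrelevance hr deg00) (eq_irrelevance hr' deg00).
  rewrite (erefl : comp2 deg00 (oG false) (oG false) = o_m3).
  by rewrite o_swap_m3 scale1r.
Qed.

Lemma o_rspan n p (x : O n p) : rspan oG o_d false false (fun=> false) x.
Proof.
elim/presented_ind: x => {n p}.
- by case; [apply: RS_B|apply: (@rspan_G _ _ oG o_d false false false)].
- by move=> *; apply: RS_0.
- by move=> *; apply: RS_add.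
- by move=> *; apply: RS_scale.
- by move=> n p s x Hx; apply: RS_act Hx.
- exact: RS_id.
- move=> m n l p q r hl hr i x y Hx Hy.
  exact: (rspan_comp o_normal3 o_comp_GB o_md_d o_comp_B Hx Hy).
Qed.

Lemma o_move_last n p e (x : O n p) : rspan oG o_d true false e x ->
  forall (t : 'S_n) (e' : nat -> bool), (forall j : 'I_n, e' (t j) = e j) ->
  e' n.-1 = false -> rspan oG o_d true true e' (op_act t x).
Proof. exact: (rspan_move_last o_normal3 o_comp_GB o_md_d o_sym). Qed.
End DerivingOperad.

(** * The morphism from LL to the Hadamard product *)

Section Hadamard.
Variable K : fieldType.
Local Notation Lie := (operad_Lie K).
Local Notation LL := (operad_LL K).
Local Notation O := (operad_O K).
Local Notation D := (operad_D K).
Local Notation H := (hadamard (operad_Lie K) (operad_D K)).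

Definition dval n p (x : D n p) : O n p := so_val x.

Lemma dval_inj n p : injective (@dval n p).
Proof. exact: so_val_inj. Qed.
Lemma dvalD n p (x y : D n p) : dval (x + y) = dval x + dval y.
Proof. exact: so_valD. Qed.
Lemma dvalZ n p a (x : D n p) : dval (a *: x) = a *: dval x.
Proof. exact: so_valZ. Qed.
Lemma dval0 n p : dval (0 : D n p) = 0.
Proof. by rewrite -(scale0r (0 : D n p)) dvalZ scale0r. Qed.
Lemma dvalN n p (x : D n p) : dval (- x) = - dval x.
Proof. by rewrite -scaleN1r dvalZ scaleN1r. Qed.
Lemma dval_act n p s (x : D n p) : dval (op_act s x) = op_act s (dval x).
Proof. by []. Qed.
Lemma dval_comp m n l (p q r : int) (hl : l = (m + n).-1%N) (hr : r = p + q) i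
    (x : D m p) (y : D n q) :
  dval (op_comp hl hr i x y) = op_comp hl hr i (dval x) (dval y).
Proof. by []. Qed.

Lemma oG_mem g : oG K g \in @so_mem _ _ (D_sub K) 2 (dg g).
Proof. by case: g. Qed.
Definition dG g : D 2%N (dg g) := SoCar (oG_mem g).
Lemma dval_dG g : dval (dG g) = oG K g.
Proof. by []. Qed.

Lemma dval_mono n e p : dval (mono dG n e p) = mono (oG K) n e p.
Proof.
elim: n e p => [|[|n] IH] e p.
- exact: dval0.
- by case: p => [[|p]|p] //=; apply: dval0.
by rewrite !monoS dval_comp IH.
Qed.

Lemma d_Gcomm g h (p : int) (hr : p = dg g + dg h) (hr' : p = dg h + dg g) :
  exists c : K, comp2 hr (dG g) (dG h) = c *: swap12 (comp2 hr' (dG h) (dG g)).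
Proof.
have [c Hc] := o_Gcomm K hr hr'; exists c; apply: dval_inj.
by rewrite dvalZ dval_act !dval_comp !dval_dG.
Qed.

Lemma pureBl n k i j (e : k = i + j) (a b : Lie n i) (c : D n j) :
  pure e (a - b) c = pure e a c - pure e b c :> H n k.
Proof. by rewrite -scaleN1r pureDl pureZl scaleN1r. Qed.
Lemma pureNr n k i j (e : k = i + j) (a : Lie n i) (c : D n j) :
  pure e a (- c) = - pure e a c :> H n k.
Proof. by rewrite -scaleN1r pureZr scaleN1r. Qed.

Definition hG g : H 2%N (dg g) := pure (esym (add0r (dg g))) (lie_par K) (dG g).

Lemma hG_comp (hl : 3%N = (2 + 2).-1%N) g g' (r : int) (hr : r = dg g + dg g') s
    (er : r = 0 + r) :
  op_comp hl hr s (hG g) (hG g') =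
  pure er (op_comp hl deg00 s (lie_par K) (lie_par K)) (op_comp hl hr s (dG g) (dG g')) :> H _ _.
Proof.
rewrite -[LHS]/(had_comp hl hr s (hG g) (hG g')).
rewrite (had_comp_pure hl hr s _ _ _ _ _ _ er deg00 hr).
by rewrite /koszul muln0 expr0 scale1r.
Qed.

Lemma h_act n k i j (e : k = i + j) s (a : Lie n i) (b : D n j) :
  op_act s (pure e a b : H n k) = (pure e (op_act s a) (op_act s b) : H n k).
Proof. exact: had_act_pure. Qed.

Lemma h_tau g : tau (hG g) = pure (esym (add0r (dg g))) (tau (lie_par K)) (tau (dG g)) :> H _ _.
Proof. exact: h_act. Qed.

Let er0 : 0 = 0 + 0 :> int := deg00.
Let er1 : 1 = 0 + 1 :> int := deg01.
Let er2 : 2 = 0 + 2 :> int := esym (add0r 2).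

Let dmul : D 2%N 0 := dG false.
Let dmd : D 2%N 1 := dG true.
Definition h_par : H 2%N 0 := hG false.
Definition h_br : H 2%N 1 := hG true.
Local Notation e223 := (erefl : 3%N = (2 + 2).-1%N).
Local Notation lp := (lie_par K).

Let h_bb s : op_comp e223 deg11 s h_br h_br =
  pure er2 (op_comp e223 deg00 s lp lp) (op_comp e223 deg11 s dmd dmd) :> H _ _.
Proof. exact: (@hG_comp e223 true true). Qed.
Let h_bp s : op_comp e223 deg10 s h_br h_par =
  pure er1 (op_comp e223 deg00 s lp lp) (op_comp e223 deg10 s dmd dmul) :> H _ _.
Proof. exact: (@hG_comp e223 true false). Qed.
Let h_pb s : op_comp e223 deg01 s h_par h_br =
  pure er1 (op_comp e223 deg00 s lp lp) (op_comp e223 deg01 s dmul dmd) :> H _ _.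
Proof. exact: (@hG_comp e223 false true). Qed.
Let h_pp s : op_comp e223 deg00 s h_par h_par =
  pure er0 (op_comp e223 deg00 s lp lp) (op_comp e223 deg00 s dmul dmul) :> H _ _.
Proof. exact: (@hG_comp e223 false false). Qed.

Lemma d_comm : tau dmul = dmul.
Proof. by apply: dval_inj; rewrite dval_act; apply: o_comm. Qed.
Lemma lie_tau : tau (lie_par K) = - lie_par K.
Proof. by apply/eqP; rewrite -addr_eq0 addrC lie_anti. Qed.

Lemma h_anti : h_par + tau h_par = 0.
Proof. by rewrite (h_tau false : tau h_par = _) (d_comm : tau (dG false) = _) -pureDl lie_anti pure0l. Qed.

(** The three D factors coincide up to sign, and the signs of [o_comp1_md_md] and [o_swap_x12] turn
    the sum into the Jacobi identity tensored with one element. *)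
Lemma h_rel1 : comp2 deg11 h_br h_br + comp1 deg11 h_br h_br
  + swap12 (comp2 deg11 h_br h_br) = 0.
Proof.
rewrite /comp1 /comp2 /swap12 !h_bb h_act.
have E1 : op_comp e223 deg11 ord0 dmd dmd =
  - op_comp e223 deg11 ord_max dmd dmd.
  by apply: dval_inj; rewrite dvalN; apply: etrans (o_comp1_md_md K deg11) _;
     rewrite -(o_md_md K deg11).
have E2 : op_act (tperm ord0 (lift ord0 ord0))
    (op_comp e223 deg11 ord_max dmd dmd) =
  - op_comp e223 deg11 ord_max dmd dmd.
  apply: dval_inj; rewrite dvalN dval_act dval_comp.
  rewrite (o_md_md K deg11 : op_comp _ deg11 ord_max (dval dmd) (dval dmd) = _).
  exact: o_swap_x12.
by rewrite E1 E2 !pureNr -!pureBl (lie_jacobi K) pure0l.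
Qed.

Lemma h_rel2 : comp2 deg10 h_br h_par - comp1 deg01 h_par h_br
  - swap12 (comp2 deg01 h_par h_br) = 0.
Proof.
rewrite /comp1 /comp2 /swap12 ?h_bp ?h_pb h_act.
have E1 : op_comp e223 deg01 ord0 dmul dmd =
  op_comp e223 deg10 ord_max dmd dmul.
  by apply: dval_inj; apply: etrans (o_comp_md K deg01) _; rewrite -(o_md_mul K deg10).
have E2 : op_act (tperm ord0 (lift ord0 ord0))
    (op_comp e223 deg01 ord_max dmul dmd) =
  op_comp e223 deg10 ord_max dmd dmul.
  apply: dval_inj; rewrite dval_act !dval_comp.
  rewrite (o_md_mul K deg10 : op_comp _ deg10 ord_max (dval dmd) (dval dmul) = _).
  rewrite (o_mul_md K deg01 : op_comp _ deg01 ord_max (dval dmul) (dval dmd) = _).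
  exact: o_swap_x2.
by rewrite E1 E2 -!pureBl (lie_jacobi K) pure0l.
Qed.

(** This is the Leibniz rule in D; the sign of the transposed term comes from antisymmetry in
    Lie. *)
Lemma h_rel3 : comp1 deg10 h_br h_par - comp1 deg01 h_par h_br
  + comp1 deg01 h_par (tau h_br) = 0.
Proof.
rewrite comp1_tau /comp1 /swap12 ?h_bp ?h_pb h_act.
set l1 := op_comp _ _ _ (lie_par K) _.
have -> : op_act (tperm ord0 (lift ord0 ord0)) l1 = - l1.
  by apply: etrans (esym (comp1_tau _ _ _)) _; rewrite lie_tau /comp1 -sub0r op_compBr op_comp0r sub0r.
have -> : op_comp e223 deg10 ord0 dmd dmul =
  op_comp e223 deg01 ord0 dmul dmd +
  op_act (tperm ord0 (lift ord0 ord0))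
    (op_comp e223 deg01 ord0 dmul dmd).
  apply: dval_inj; rewrite dvalD dval_act !dval_comp.
  rewrite (o_comp1_md_mul K deg10 : op_comp _ deg10 ord0 (dval dmd) (dval dmul) = _).
  rewrite (o_comp_md K deg01 : op_comp _ deg01 ord0 (dval dmul) (dval dmd) = _).
  by congr (_ + _); rewrite -[RHS]/(swap12 (o_x1 K)) o_swap_x1.
rewrite pureDr -(scaleN1r l1) pureZl scaleN1r.
by rewrite [X in X - _ - _]addrC addrK subrr.
Qed.

Lemma h_rel4 : comp2 deg00 h_par h_par - comp1 deg00 h_par h_par
  - swap12 (comp2 deg00 h_par h_par) = 0.
Proof.
rewrite /comp1 /comp2 /swap12 !h_pp h_act.
have E1 : op_comp e223 deg00 ord0 dmul dmul =
  op_comp e223 deg00 ord_max dmul dmul.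
  by apply: dval_inj; apply: (o_assoc K).
have E2 : op_act (tperm ord0 (lift ord0 ord0))
    (op_comp e223 deg00 ord_max dmul dmul) =
  op_comp e223 deg00 ord_max dmul dmul.
  by apply: dval_inj; apply: (o_swap_m3 K).
by rewrite E1 E2 -!pureBl (lie_jacobi K) pure0l.
Qed.

Definition h_gen (g : LL_sig) : H (gen_ar g) (gen_deg g) :=
  match (g : LL_gen) as g' return H (@gen_ar LL_sig g') (@gen_deg LL_sig g') with
  | LL_par => h_par
  | LL_br => h_br
  end.

(** [presented_lift] wants the relations to vanish on chosen representatives. Seen on the free
    operad, evaluation is a morphism and each relation can be computed through its structure. *)
Definition ll_free n p (x : free_operad K LL_sig n p) : H n p := op_eval h_gen (trepr x).

Lemma ll_free_cl n p (t : term K LL_sig n p) :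
  ll_free (tcl t : free_operad K LL_sig n p) = op_eval h_gen t.
Proof. by apply: (congr_tcl (op_eval_congr h_gen)); rewrite treprK. Qed.
Lemma ll_freeD n p (x y : free_operad K LL_sig n p) : ll_free (x + y) = ll_free x + ll_free y.
Proof. by rewrite -{1}(treprK x) -{1}(treprK y) -tclD ll_free_cl. Qed.
Lemma ll_freeN n p (x : free_operad K LL_sig n p) : ll_free (- x) = - ll_free x.
Proof. by rewrite -{1}(treprK x) -scaleN1r -tclZ ll_free_cl /= scaleN1r. Qed.
Lemma ll_free_act n p s (x : free_operad K LL_sig n p) :
  ll_free (op_act s x) = op_act s (ll_free x).
Proof.
rewrite -{1}(treprK x); apply: etrans (ll_free_cl (tact s (trepr x))).
by rewrite tcl_act.
Qed.
Lemma ll_free_comp m n l (p q r : int) (hl : l = (m + n).-1%N) (hr : r = p + q) i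
    (x : free_operad K LL_sig m p) (y : free_operad K LL_sig n q) :
  ll_free (op_comp hl hr i x y) = op_comp hl hr i (ll_free x) (ll_free y).
Proof.
rewrite -{1}(treprK x) -{1}(treprK y).
apply: etrans (ll_free_cl (tcomp hl hr i (trepr x) (trepr y))).
by rewrite tcl_comp.
Qed.
Lemma ll_free_gen (g : LL_sig) : ll_free (free_gen K g) = h_gen g.
Proof. exact: ll_free_cl. Qed.

Lemma ll_free_rel n p (y : free_operad K LL_sig n p) : LL_rel y -> ll_free y = 0.
Proof.
have Ep : ll_free (free_gen K (LL_par : LL_sig)) = h_par := ll_free_gen _.
have Eb : ll_free (free_gen K (LL_br : LL_sig)) = h_br := ll_free_gen _.
case=> {n p y}; rewrite /comp2 /comp1 /swap12 /tau;
  do ! rewrite ?ll_freeD ?ll_freeN ?ll_free_act ?ll_free_comp ?Ep ?Eb.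
- exact: h_anti.
- exact: h_rel1.
- exact: h_rel2.
- exact: h_rel3.
- exact: h_rel4.
Qed.

Definition ll_map n p : LL n p -> H n p := @presented_lift _ _ (@LL_rel K) _ h_gen n p.

Lemma ll_map_linear n p : linear (@ll_map n p).
Proof. exact: (presented_lift_linear ll_free_rel). Qed.
Lemma ll_map_act n p s (x : LL n p) : ll_map (op_act s x) = op_act s (ll_map x).
Proof. exact: (presented_lift_act ll_free_rel). Qed.
Lemma ll_map_comp m n l (p q r : int) (hl : l = (m + n).-1%N) (hr : r = p + q) i
    (x : LL m p) (y : LL n q) :
  ll_map (op_comp hl hr i x y) = op_comp hl hr i (ll_map x) (ll_map y).
Proof. exact: (presented_lift_comp ll_free_rel). Qed.
Lemma ll_map_id : ll_map (op_id LL) = op_id H.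
Proof. exact: (presented_lift_id ll_free_rel). Qed.
Lemma ll_mapD n p (x y : LL n p) : ll_map (x + y) = ll_map x + ll_map y.
Proof. by have := ll_map_linear 1 x y; rewrite !scale1r. Qed.
Lemma ll_map0 n p : ll_map (0 : LL n p) = 0.
Proof. by apply: (addrI (ll_map 0)); rewrite -ll_mapD !addr0. Qed.
Lemma ll_mapZ n p a (x : LL n p) : ll_map (a *: x) = a *: ll_map x.
Proof. by have := ll_map_linear a x 0; rewrite ll_map0 !addr0. Qed.
Lemma ll_map_sum n p (I : Type) (r : seq I) (Q : pred I) (F : I -> LL n p) :
  ll_map (\sum_(i <- r | Q i) F i) = \sum_(i <- r | Q i) ll_map (F i).
Proof. by apply: (big_morph (@ll_map n p)) => [x y|]; [apply: ll_mapD|apply: ll_map0]. Qed.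
Lemma ll_map_gen g : ll_map (llG K g) = hG g.
Proof.
case: g; first exact: (presented_lift_gen ll_free_rel (LL_br : LL_sig)).
exact: (presented_lift_gen ll_free_rel (LL_par : LL_sig)).
Qed.

Definition lie_word n i : Lie n i := mono (lieG K) n (fun=> false) i.

(** No sign appears, since the Lie factors have degree 0. The degree [i] is only propositionally 0
    because the recursion of [mono] replaces it by [i - dg false]. *)
Lemma ll_map_mono n e (r i j : int) (er : r = i + j) : i = 0 ->
  ll_map (mono (llG K) n e r) = pure er (lie_word n i) (mono dG n e j).
Proof.
elim: n e r i j er => [|[|n] IH] e r i j er i0.
- by rewrite ll_map0 pure0l.
- have ej : r = j by rewrite er i0 add0r.
  move: er; rewrite ej i0; case: j {ej} => [[|j]|j] er; rewrite /= ?ll_map0 ?pure0r //.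
  rewrite ll_map_id; congr (pure _ _ _).
  exact: eq_irrelevance.
have er' : r - dg (e 0%N) = (i - dg false) + (j - dg (e 0%N)).
  by rewrite er subr0 addrA.
have i1 : i - dg false = 0 by rewrite i0.
rewrite /lie_word !monoS ll_map_comp ll_map_gen (IH _ _ _ _ er' i1).
apply: etrans (had_comp_pure _ _ _ _ _ _ _ _ _ er (mono_deg i (dg false))
  (mono_deg j (dg (e 0%N)))) _.
have -> : koszul K (dg (e 0%N)) (i - dg false) = 1.
  by rewrite /koszul i1 muln0 expr0.
by rewrite scale1r.
Qed.
End Hadamard.

(** * Bijectivity *)

Section Expansion.
Variables (K : fieldType) (P : operad K) (G : forall g : bool, P 2%N (dg g)) (B : P 1%N 1).
Let L := op_ok P.
Hypothesis move_last : forall n p e (x : P n p), rspan G B true false e x ->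
  forall (t : 'S_n) (e' : nat -> bool), (forall j : 'I_n, e' (t j) = e j) ->
  e' n.-1 = false -> rspan G B true true e' (op_act t x).

(** Move [m] to the last place by a transposition, expand there, and transport back: every
    permutation [s * t] of the expansion sends the last place to [m]. *)
Lemma rspan_expand_at n p e (x : P n p) (m : 'I_n) :
  rspan G B true false e x -> e m = false ->
  exists (t : 'S_n) (c : 'S_n -> K), (forall j : 'I_n, j.+1 = n -> t j = m) /\
  x = \sum_(s : 'S_n | fixlast s) c s *:
        op_act (s * t)%g (mono G n (fun j => e (nperm (s * t)%g j)) p).
Proof.
move=> Hx em.
have ln : (n.-1 < n)%N by have := ltn_ord m; clear; lia.
pose t := tperm m (Ordinal ln).
have tl (j : 'I_n) : j.+1 = n -> t j = m.
  move=> jn; have -> : j = Ordinal ln by apply: val_inj => /=; clear -jn; lia.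
  exact: tpermR.
have Ht : rspan G B true true (fun j => e (nperm t j)) (op_act t^-1%g x).
  apply: (move_last Hx) => [j|]; first by rewrite npermE permKV.
  by rewrite (nperm_ord _ ln) tl //= prednK //; clear -ln; lia.
have [c Hc] := rspan_expand Ht.
exists t, c; split=> //.
rewrite -[LHS](op_actK t x) Hc op_act_sum; apply: eq_bigr => s _.
rewrite (ol_actZ L) -(ol_actM L); congr (_ *: op_act _ _).
by apply: mono_ext => j _; rewrite npermM.
Qed.
End Expansion.

(** * Surjectivity *)

Section Surjectivity.
Variable K : fieldType.
Local Notation Lie := (operad_Lie K).
Local Notation LL := (operad_LL K).
Local Notation O := (operad_O K).
Local Notation D := (operad_D K).
Local Notation H := (hadamard (operad_Lie K) (operad_D K)).

Definition ll_im n p (u : H n p) : Prop := exists x, ll_map x = u.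

Lemma ll_im0 n p : ll_im (0 : H n p).
Proof. by exists 0; rewrite ll_map0. Qed.
Lemma ll_imD n p (u v : H n p) : ll_im u -> ll_im v -> ll_im (u + v).
Proof. by move=> [x <-] [y <-]; exists (x + y); rewrite ll_mapD. Qed.
Lemma ll_imZ n p a (u : H n p) : ll_im u -> ll_im (a *: u).
Proof. by move=> [x <-]; exists (a *: x); rewrite ll_mapZ. Qed.
Lemma ll_im_act n p s (u : H n p) : ll_im u -> ll_im (op_act s u).
Proof. by move=> [x <-]; exists (op_act s x); rewrite ll_map_act. Qed.

Lemma fixlastV n (s : 'S_n) : fixlast s -> fixlast s^-1%g.
Proof.
move=> /fixlastP fs; apply/fixlastP => j jn.
by rewrite -[in LHS](fs j jn) permK.
Qed.

(** With the last input underived, the Lie factor expands into words ending in the same input as the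
    D monomial, and each such tensor is matched with a single LL monomial. *)
Lemma ll_im_mono n (r i j : int) (er : r = i + j) (a : Lie n i) e :
  e n.-1 = false -> ll_im (pure er a (mono (dG K) n e j) : H n r).
Proof.
move=> en.
have Ha : rspan (lieG K) 0 true true (fun=> false) a.
  rewrite -(ol_act1 (op_ok Lie) a).
  exact: (lie_move_last (lie_rspan0 a)).
have [i0|i0] := eqVneq i 0; last first.
  rewrite (rspan_deg Ha) ?pure0l; first exact: ll_im0.
  by rewrite big1 // => ip; rewrite ip eqxx in i0.
have [c ->] := rspan_expand Ha.
apply: (big_ind (fun x => ll_im (pure er x (mono (dG K) n e j) : H n r)))
  => [|x y Hx Hy|s fs].
- rewrite pure0l; exact: ll_im0.
- by rewrite pureDl; apply: ll_imD.
rewrite pureZl; apply: ll_imZ.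
(* The permutation of the Lie word is made to act on the whole tensor; its inverse then falls on the
   D monomial, which it only rescales. *)
rewrite -(op_actK s (mono (dG K) n e j)) -[pure _ _ _]h_act; apply: ll_im_act.
have [k|c' ->] := mono_act (@d_Gcomm K) (e := e) (e' := fun k => e (nperm s k)) j
    (fixlastV fs).
  by rewrite npermE permKV.
rewrite pureZr; apply: ll_imZ.
by exists (mono (llG K) n (fun k => e (nperm s k)) r); apply: ll_map_mono.
Qed.

Lemma ll_map_surj n p (u : H n p) : ll_im u.
Proof.
elim/tens_ind: u => [i j er a b|u v|c u]; [|exact: ll_imD|exact: ll_imZ].
have /orP[jn|/eqP b0] := so_valP b; last first.
  rewrite (_ : b = 0) ?pure0r; first exact: ll_im0.
  by apply: dval_inj; rewrite dval0.
have Hm (x : O n j) : x \in @so_mem _ _ (D_sub K) n j by apply/orP; left.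
(* In this arity and degree D is all of O, so the pieces of the expansion in O lift back to D. *)
pose dl x : D n j := SoCar (Hm x).
have dlD x y : dl (x + y) = dl x + dl y by apply: dval_inj; rewrite dvalD.
have dl0 : dl 0 = 0 by apply: dval_inj; rewrite dval0.
have dlZ c x : dl (c *: x) = c *: dl x by apply: dval_inj; rewrite dvalZ.
have -> : b = dl (dval b) by apply: dval_inj.
have [y -> Hy] := rspan_split (o_rspan (dval b)).
apply: (big_ind (fun x => ll_im (pure er a (dl x) : H n p))) => [|x x' Hx Hx'|e _].
- rewrite dl0 pure0r; exact: ll_im0.
- by rewrite dlD pureDr; apply: ll_imD.
have [je|/eqP je] := eqVneq j (Posz (\sum_(k < n) ffnat e k)%N); last first.
  rewrite (rspan_deg (Hy e) je) dl0 pure0r; exact: ll_im0.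
(* The degree bound of D: fewer than n of the n inputs are derived. *)
have [m em] : exists m : 'I_n, e m = false.
  case: (pickP (fun m => ~~ e m)) => [m /negbTE em|et]; first by exists m.
  move: jn; rewrite je (eq_bigr (fun=> 1%N)) => [|k _].
    by rewrite sum1_card card_ord ltxx andbF.
  by rewrite ffnatE; have /negbFE -> := et k.
have [|t [c [tl ->]]] := rspan_expand_at (@o_move_last K) (m := m) (Hy e).
  by rewrite ffnatE.
apply: (big_ind (fun x => ll_im (pure er a (dl x) : H n p))) => [|x x' Hx Hx'|s fs].
- rewrite dl0 pure0r; exact: ll_im0.
- by rewrite dlD pureDr; apply: ll_imD.
rewrite dlZ pureZr; apply: ll_imZ.
set w := (s * t)%g.
have -> : dl (op_act w (mono (oG K) n (fun k => ffnat e (nperm w k)) j)) =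
    op_act w (mono (dG K) n (fun k => ffnat e (nperm w k)) j).
  by apply: dval_inj; rewrite dval_act dval_mono.
rewrite -(op_actK w a) -[pure _ _ _]h_act; apply: ll_im_act.
apply: ll_im_mono.
have ln : (n.-1 < n)%N by have := ltn_ord m; clear; lia.
rewrite (nperm_ord w ln) permM.
have ln' : (Ordinal ln).+1 = n by rewrite /= prednK //; clear -ln; lia.
by move/fixlastP: fs => /(_ _ ln') ->; rewrite tl // ffnatE.
Qed.
End Surjectivity.

(** * Injectivity, by reading off coefficients *)

Section Injectivity.
Variable K : fieldType.
Local Notation Lie := (operad_Lie K).
Local Notation LL := (operad_LL K).
Local Notation O := (operad_O K).
Local Notation D := (operad_D K).
Local Notation H := (hadamard (operad_Lie K) (operad_D K)).

Section LieWords.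
Variable N : nat.
Local Notation A := 'M[K]_N.
Let lHE := @lie_eval_congr K N.
Let lHR := @lie_eval_rel K N.

Definition lev n p (x : Lie n p) (a : nat -> A) : A := lie_eval (term_of x) a.

Lemma lev_comp m n l (p q r : int) (hl : l = (m + n).-1%N) (hr : r = p + q) i
    (x : Lie m p) (y : Lie n q) a :
  lev (op_comp hl hr i x y) a = lev x (subst i n a (lev y (fun j => a (i + j)%N))).
Proof. exact: (term_of_comp lHE lHR). Qed.
Lemma lev_act n p (s : 'S_n) (x : Lie n p) a :
  lev (op_act s x) a = lev x (fun j => a (nperm s j)).
Proof. exact: (term_of_act lHE lHR). Qed.
Lemma levD n p (x y : Lie n p) a : lev (x + y) a = lev x a + lev y a.
Proof. exact: (term_ofD lHE lHR). Qed.
Lemma levZ n p c (x : Lie n p) a : lev (c *: x) a = c *: lev x a.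
Proof. exact: (term_ofZ lHE lHR). Qed.
Lemma lev_par a : lev (lie_par K) a = a 0%N *m a 1%N - a 1%N *m a 0%N.
Proof. exact: (term_of_congr lHE lHR). Qed.
Lemma lev_id a : lev (op_id Lie) a = a 0%N.
Proof. exact: (term_of_congr lHE lHR (tid K Lie_sig)). Qed.

Fixpoint chain (n : nat) (a : nat -> A) (v : 'cV[K]_N) : 'cV[K]_N :=
  if n is k.+1 then a 0%N *m chain k (fun j => a j.+1) v else v.

(** A commutator a x - x a acts on v as a x once a kills v. Of all the words in the expanded
    bracket, only the one in the given order survives. *)
Lemma lev_word n a v : (0 < n)%N -> (forall j, (j.+1 < n)%N -> a j *m v = 0) ->
  lev (lie_word K n 0) a *m v = chain n a v.
Proof.
case: n => // n _.
rewrite /lie_word => Ha.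
suff E i : i = 0 -> lev (mono (lieG K) n.+1 (fun=> false) i) a *m v = chain n.+1 a v.
  exact: E.
elim: n i a Ha => [|n IH] i a Ha i0.
  by rewrite i0 (lev_id a : lev (mono (lieG K) 1 (fun=> false) 0) a = _).
rewrite monoS lev_comp (lev_par : lev (lieG K false) =1 _) /subst /=.
have E : lev (mono (lieG K) n.+1 (fun=> false) (i - dg false)) (fun j => a (1 + j)%N) *m v =
    chain n.+1 (fun j => a j.+1) v.
  by apply: IH => [j jn|]; [apply: Ha|rewrite i0].
by rewrite mulmxBl -!mulmxA E (Ha 0%N) // mulmx0 subr0.
Qed.
End LieWords.

Section MatrixUnits.
Variable n : nat.

Definition unit_step (i : nat) : 'M[K]_n.+1 := delta_mx (inord i) (inord i.+1).
Definition unit_vec (i : nat) : 'cV[K]_n.+1 := delta_mx (inord i) ord0.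

Lemma unit_stepE i j : (i < n)%N -> (j <= n)%N ->
  unit_step i *m unit_vec j = if i.+1 == j then unit_vec i else 0.
Proof.
move=> iN jN; rewrite /unit_step /unit_vec.
have -> : (i.+1 == j) = (inord i.+1 == inord j :> 'I_n.+1).
  by rewrite -val_eqE /= !inordK.
by case: eqP => [->|/eqP ij]; [rewrite mul_delta_mx|rewrite mul_delta_mx_0].
Qed.

(** Each unit matrix lowers exactly one basis vector by one step, so the product is nonzero only if
    the steps b, b+1, ... come in this order. *)
Lemma chain_unit k b (f : nat -> nat) : (forall j, (j < k)%N -> (f j < n)%N) ->
  (b + k <= n)%N ->
  chain k (fun j => unit_step (f j)) (unit_vec (b + k)) =
  if [forall j : 'I_k, f j == (b + j)%N] then unit_vec b else 0.
Proof.
elim: k b f => [|k IH] b f fn bk /=.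
  by rewrite addn0 ifT //; apply/forallP => -[].
rewrite -addSnnS (IH b.+1 (fun j => f j.+1)); first 1 last.
- by move=> j jk; apply: fn.
- by rewrite addSnnS.
have bn : (b.+1 <= n)%N by clear -bk; lia.
case: (boolP [forall j : 'I_k.+1, _]) => [/forallP Hf|/forallPn[j fj]].
  rewrite ifT; last first.
    by apply/forallP => j; have := Hf (lift ord0 j); rewrite lift0 addSnnS.
  by rewrite unit_stepE ?fn // (eqP (Hf ord0)) addn0 eqxx.
case: ifP => [/forallP Hf|_]; last by rewrite mulmx0.
rewrite unit_stepE ?fn //; case: eqP => // -[f0].
have [j0|j0] := posnP j; first by move: fj; rewrite j0 addn0 f0 eqxx.
have jk : (j.-1 < k)%N by have := ltn_ord j; clear -j0; lia.
have := Hf (Ordinal jk); rewrite /= addSnnS prednK // => fj'.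
by rewrite fj' in fj.
Qed.
End MatrixUnits.

Section DerivingWords.
Variable N : nat.
Local Notation A := 'M[K]_(gdim N).
Let dHE := @d_eval_congr K N.
Let dHR := @d_eval_rel K N.

Definition dev n p (x : O n p) (th : nat -> A) : A := d_eval (term_of x) th.

Lemma dev_comp m n l (p q r : int) (hl : l = (m + n).-1%N) (hr : r = p + q) i
    (x : O m p) (y : O n q) th : godd th ->
  dev (op_comp hl hr i x y) th =
  dev x (subst i n th (\sum_(k < n) th (i + k)%N)) *m dev y (fun j => th (i + j)%N).
Proof. exact: (term_of_comp dHE dHR). Qed.
Lemma dev_act n p (s : 'S_n) (x : O n p) th : godd th ->
  dev (op_act s x) th = dev x (fun j => th (nperm s j)).
Proof. exact: (term_of_act dHE dHR). Qed.
Lemma devD n p (x y : O n p) th : godd th -> dev (x + y) th = dev x th + dev y th.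
Proof. exact: (term_ofD dHE dHR). Qed.
Lemma devZ n p c (x : O n p) th : godd th -> dev (c *: x) th = c *: dev x th.
Proof. exact: (term_ofZ dHE dHR). Qed.
Lemma dev_mul th : godd th -> dev (o_mul K) th = 1%:M.
Proof. exact: (term_of_congr dHE dHR). Qed.
Lemma dev_d th : godd th -> dev (o_d K) th = th 0%N.
Proof. exact: (term_of_congr dHE dHR). Qed.
Lemma dev_id th : godd th -> dev (op_id O) th = 1%:M.
Proof. exact: (term_of_congr dHE dHR (tid K O_sig)). Qed.

Lemma dev_G g th : godd th -> dev (oG K g) th = if g then th 0%N else 1%:M.
Proof.
case: g => oth; last exact: dev_mul.
apply: etrans (dev_comp _ _ _ _ _ oth) _.
rewrite dev_mul ?mul1mx; last exact: godd_subst.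
by rewrite dev_d.
Qed.

Lemma dev_mono n e p th : godd th -> (0 < n)%N -> e n.-1 = false ->
  p = Posz (\sum_(j < n) e j)%N -> dev (mono (oG K) n e p) th = gprod n th e.
Proof.
case: n => // n oth _; elim: n e p th oth => [|n IH] e p th oth en pe.
  move: pe; rewrite big_ord1 en => ->.
  by rewrite /= en dev_id ?mul1mx.
rewrite monoS dev_comp // dev_G; last exact: godd_subst.
rewrite IH //.
by rewrite pe big_ord_recl PoszD addrC addKr.
Qed.
End DerivingWords.

Section Coefficient.
Variables (n : nat) (p : int) (w : 'S_n) (e : nat -> bool).

(** The inverse of [w] makes the word of order [w] meet the unit matrices in their natural order. *)
Definition ltest (j : nat) : 'M[K]_n.+1 := unit_step n (nperm w^-1%g j).
(** Inputs outside [e] get 0, which kills every monomial having a derived input outside [e]. *)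
Definition dtest (j : nat) : 'M[K]_(gdim n) :=
  if e j then ggen K n (nperm w^-1%g j) else 0.

Lemma dtest_odd : godd dtest.
Proof. by move=> j; rewrite /dtest; case: ifP => _; [apply: ggen_odd|apply: gpar0]. Qed.

Definition lcoef i (a : Lie n i) : K := (lev a ltest *m unit_vec n n) ord0 ord0.

Lemma lcoef_lin i c (a b : Lie n i) : lcoef (c *: a + b) = c * lcoef a + lcoef b.
Proof. by rewrite /lcoef levD levZ mulmxDl -scalemxAl !mxE. Qed.

(* Detects the monomial with order of inputs w and set of derived inputs e. *)
Definition coef (u : H n p) : 'M[K]_(gdim n) :=
  tens_lift (fun i j _ (a : Lie n i) (b : D n j) => lcoef a *: dev (dval b) dtest) u.

Let Fl i j (er : p = i + j) (b : D n j) :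
  linear (fun a : Lie n i => lcoef a *: dev (dval b) dtest).
Proof. by move=> c x y; rewrite lcoef_lin scalerDl scalerA. Qed.
Let Fr i j (er : p = i + j) (a : Lie n i) :
  linear (fun b : D n j => lcoef a *: dev (dval b) dtest).
Proof.
move=> c x y; rewrite dvalD dvalZ devD ?devZ; try exact: dtest_odd.
by rewrite scalerDr !scalerA mulrC.
Qed.

Lemma coef_pure i j (er : p = i + j) (a : Lie n i) (b : D n j) :
  coef (pure er a b) = lcoef a *: dev (dval b) dtest.
Proof. exact: (tens_lift_pure Fl Fr). Qed.
Lemma coefD u v : coef (u + v) = coef u + coef v.
Proof. exact: (tens_liftD Fl Fr). Qed.
Lemma coefZ c u : coef (c *: u) = c *: coef u.
Proof. exact: (tens_liftZ Fl Fr). Qed.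
Lemma coef0 : coef 0 = 0.
Proof. by apply: (addrI (coef 0)); rewrite -coefD !addr0. Qed.
Lemma coef_sum (I : Type) (r : seq I) (Q : pred I) (F : I -> H n p) :
  coef (\sum_(i <- r | Q i) F i) = \sum_(i <- r | Q i) coef (F i).
Proof. by apply: (big_morph coef) => [x y|]; [apply: coefD|apply: coef0]. Qed.

Lemma coef_mono (s : 'S_n) e' : (0 < n)%N -> e' n.-1 = false ->
  p = Posz (\sum_(j < n) e' j)%N ->
  coef (ll_map (op_act s (mono (llG K) n e' p))) =
  lcoef (op_act s (lie_word K n 0)) *: gprod n (fun j => dtest (nperm s j)) e'.
Proof.
move=> n0 en pe.
have er : p = 0 + p by rewrite add0r.
rewrite ll_map_act (@ll_map_mono K n e' p 0 p er erefl) h_act coef_pure dval_act dval_mono.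
rewrite dev_act; last exact: dtest_odd.
by rewrite dev_mono // => j; apply: dtest_odd.
Qed.

(** The hypothesis says that both words end in the same letter, as they do inside one piece of the
    expansion. *)
Lemma lcoef_word (s : 'S_n) : (0 < n)%N -> fixlast (s * w^-1)%g ->
  lcoef (op_act s (lie_word K n 0)) = (s == w)%:R.
Proof.
move=> n0 /fixlastP fl; set sg := (s * w^-1)%g in fl.
have E j : nperm w^-1%g (nperm s j) = nperm sg j by rewrite npermM.
have sl j : (j < n)%N -> (nperm sg j < n)%N by apply: nperm_lt.
have ln : (n.-1 < n)%N by clear -n0; lia.
have sgl : nperm sg n.-1 = n.-1.
  by rewrite (nperm_ord _ ln) fl //= prednK.
rewrite /lcoef lev_act lev_word //; last first.
  (* Only the step n-1, assigned to the common last letter, acts nontrivially on the vector of index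
     n. *)
  move=> j jn; rewrite /ltest E unit_stepE ?sl //; last by clear -jn; lia.
  case: eqP => // sj; exfalso.
  have : j = n.-1; last by clear -jn; lia.
  by apply: (@nperm_inj _ sg) => //; [clear -jn; lia|rewrite sgl; clear -sj; lia].
have -> : (fun j => ltest (nperm s j)) = (fun j => unit_step n (nperm sg j)).
  by apply: funext => j; rewrite /ltest E.
rewrite (@chain_unit n n 0 (nperm sg) sl (leqnn n) :
  chain n (fun j => unit_step n (nperm sg j)) (unit_vec n n) = _).
have -> : (s == w) = [forall j : 'I_n, nperm sg j == (0 + j)%N].
  apply/eqP/forallP => [sw j|H].
    by rewrite /sg sw mulgV nperm1.
  apply/eqP; rewrite eq_mulgV1 -/sg; apply/eqP/permP => j.
  by apply: val_inj; rewrite perm1 /= -npermE; apply/eqP/H.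
case: ifP => _; last by rewrite mxE.
by rewrite /unit_vec mxE eqxx andbT -val_eqE /= inordK.
Qed.
End Coefficient.

(** Sets of different sizes are separated by degree. Distinct sets of the same size leave some k in
    [e'] outside [e], and the Grassmann factor for k is 0. *)
Lemma coef_other n p (w : 'S_n) (e e' : nat -> bool) (y : LL n p) :
  rspan (llG K) 0 true false e' y ->
  p = Posz (\sum_(j < n) e j)%N -> (exists j : 'I_n, e' j != e j) ->
  coef w e (ll_map y) = 0.
Proof.
move=> Hy pe [j0 e0].
have [pe'|/eqP pe'] := eqVneq p (Posz (\sum_(j < n) e' j)%N); last first.
  by rewrite (rspan_deg Hy pe') ll_map0 coef0.
have n0 : (0 < n)%N by apply: leq_trans (ltn_ord j0).
case: (pickP (fun m : 'I_n => ~~ e' m)) => [m /negbTE em|et]; last first.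
  rewrite (rspan_full erefl Hy) ?ll_map0 ?coef0 // => j jn.
  by have /negbFE := et (Ordinal jn).
have [k ek] : exists k : 'I_n, e' k && ~~ e k.
  apply/existsP; apply: contraT; rewrite negb_exists => /forallP H.
  have leE (j : 'I_n) : (e' j <= e j)%N.
    by have := H j; case: (e' j) (e j) => [] [].
  have e0' : e' j0 = false /\ e j0 = true.
    by have := H j0; move: e0; case: (e' j0) (e j0) => [] [].
  have : (\sum_(j < n) e' j = \sum_(j < n) e j)%N by apply: (can_inj absz_nat); rewrite -pe -pe'.
  rewrite (bigD1 j0) //= [in RHS](bigD1 j0) //=; case: e0' => -> ->.
  by move/eqP; rewrite add0n add1n ltn_eqF // ltnS; apply: leq_sum.
have [t [c [tl ->]]] := rspan_expand_at (@ll_move_last K) Hy em.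
rewrite ll_map_sum coef_sum big1 // => s fs.
rewrite ll_mapZ coefZ; set v := (s * t)%g.
have ln : (n.-1 < n)%N by clear -n0; lia.
have ln' : (Ordinal ln).+1 = n by rewrite /= prednK.
rewrite coef_mono //; first 1 last.
- rewrite (nperm_ord v ln) permM; move/fixlastP: fs => /(_ _ ln') ->.
  by rewrite tl.
- rewrite pe' (reindex_inj (@perm_inj _ v)); congr Posz; apply: eq_bigr => j _.
  by rewrite npermE.
have /andP[ek1 ek2] := ek.
rewrite (@gprod0 _ _ n _ _ (v^-1%g k)) ?scaler0 //.
- by rewrite npermE permKV.
- by rewrite npermE permKV /dtest (negbTE ek2).
Qed.

Lemma ll_map_inj n p (x : LL n p) : ll_map x = 0 -> x = 0.
Proof.
have [y -> Hy] := rspan_split (ll_rspan x) => fx0.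
apply: big1 => e _.
have [pe|/eqP pe] := eqVneq p (Posz (\sum_(j < n) ffnat e j)%N); last first.
  exact: rspan_deg (Hy e) pe.
case: (pickP (fun m : 'I_n => ~~ e m)) => [m /negbTE em|et]; last first.
  apply: (rspan_full erefl (Hy e)) => j jn.
  by rewrite -[j]/(nat_of_ord (Ordinal jn)) ffnatE; have /negbFE := et (Ordinal jn).
have n0 : (0 < n)%N by apply: leq_trans (ltn_ord m).
have [|t [c [tl ye]]] := rspan_expand_at (@ll_move_last K) (m := m) (Hy e).
  by rewrite ffnatE.
rewrite ye big1 // => s fs.
have ln : (n.-1 < n)%N by clear -n0; lia.
have ln' : (Ordinal ln).+1 = n by rewrite /= prednK.
pose w := (s * t)%g.
have last_false (s' : 'S_n) : fixlast s' -> ffnat e (nperm (s' * t)%g n.-1) = false.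
  move=> /fixlastP/(_ _ ln') fs'; rewrite (nperm_ord _ ln) permM fs' tl // ffnatE.
  by [].
have deg_w (v : 'S_n) : p = Posz (\sum_(j < n) ffnat e (nperm v j))%N.
  rewrite pe (reindex_inj (@perm_inj _ v)); congr Posz; apply: eq_bigr => j _.
  by rewrite npermE.
(* The tested coefficient [c s] is isolated in two steps: the Grassmann test leaves only the piece
   [y e], then the Lie test leaves only [s]. *)
have := congr1 (coef w (ffnat e)) fx0.
rewrite ll_map_sum coef_sum coef0 (bigD1 e) //= [X in _ + X]big1 ?addr0; last first.
  move=> e' ee'; apply: (coef_other _ (Hy e')) => //.
  apply/existsP; apply: contraNT ee'; rewrite negb_exists => /forallP E.
  by apply/eqP/ffunP => j; have := E j; rewrite negbK !ffnatE => /eqP.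
rewrite ye ll_map_sum coef_sum (bigD1 s) //= [X in _ + X]big1 ?addr0; last first.
  move=> s' /andP[fs' s's].
  rewrite ll_mapZ coefZ coef_mono ?last_false // lcoef_word //; last first.
    by rewrite /w invMg mulgA mulgK; apply: fixlastM => //; apply: fixlastV.
  by rewrite /w (inj_eq (mulIg t)) (negbTE s's) scale0r scaler0.
rewrite ll_mapZ coefZ coef_mono ?last_false // lcoef_word //; last first.
  by rewrite /w mulgV; apply/fixlastP => j _; rewrite perm1.
rewrite eqxx scale1r.
(* On the derived inputs the test values become the standard generators in increasing order, whose
   product is nonzero by [gprod_ggen]. *)
have -> : gprod n (fun j => dtest w (ffnat e) (nperm (s * t)%g j))
    (fun j => ffnat e (nperm (s * t)%g j)) =
    gprod n (ggen K n) (fun j => ffnat e (nperm (s * t)%g j)).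
  apply: gprod_ext => j jn ej.
  by rewrite /dtest ej -npermM /w mulgV nperm1.
move/eqP; rewrite scaler_eq0 (negbTE (gprod_ggen _ _ _)) orbF => /eqP ->.
by rewrite scale0r.
Qed.
End Injectivity.

Theorem proposition3p7 (K : fieldType) (charK0 : [pchar K]%R =i pred0) :
  exists f : forall (n : nat) (p : int),
      operad_LL K n p -> hadamard (operad_Lie K) (operad_D K) n p,
    is_operad_iso f.
Proof.
exists (@ll_map K); split.
- exact: ll_map_linear.
- move=> n p.
  have inj : injective (@ll_map K n p).
    move=> x y xy; apply/eqP; rewrite -subr_eq0; apply/eqP/ll_map_inj.
    by rewrite -scaleN1r ll_mapD ll_mapZ scaleN1r xy subrr.
  (* The inverse map picks a preimage by choice. *)
  pose g u := projT1 (cid (@ll_map_surj K n p u)).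
  have gK u : ll_map (g u) = u := projT2 (cid (ll_map_surj u)).
  by exists g => // x; apply: inj; rewrite gK.
- exact: ll_map_id.
- exact: ll_map_act.
- exact: ll_map_comp.
Qed.
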